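(* There is an absolute constant $c>0$ such that for every $n\ge 1$ there exists a function $f_n:\underbrace{\mathbb{R}^n\times\cdots\times\mathbb{R}^n}_{n}\to\mathcal{S}^n_0$ with the following property: for every isotropic convex body $K\subset\mathbb{R}^n$ and independent random vectors $X_1,\dots,X_n$ uniformly distributed on $K$, with probability greater than $1-e^{-n}$ the set $f_n(X_1,\dots,X_n)$ is a simplex with barycenter at the origin that is contained in $K$ and satisfies $$\mathrm{vol}(f_n(X_1,\dots,X_n))\ge \frac{c^n L_K^n}{n^{n/2}}.$$
   Context: A convex body in $\mathbb{R}^n$ is a compact convex set with non-empty interior. $\mathrm{vol}$ denotes Lebesgue measure in $\mathbb{R}^n$. A simplex in $\mathbb{R}^n$ always means an $n$-simplex, i.e. the convex hull of $n+1$ affinely independent points of $\mathbb{R}^n$. The barycenter of a convex body $K$ is $\frac{1}{\mathrm{vol}(K)}\int_K x\,dx$. $\mathcal{S}^n_0$ denotes the family of all simplices in $\mathbb{R}^n$ with barycenter at the origin. A convex body $K\subset\mathbb{R}^n$ is isotropic if $\mathrm{vol}(K)=1$, $\int_K x\,dx=0$, and there is a constant $L_K>0$ such that $\int_K\langle x,\theta\rangle^2\,dx=L_K^2$ for all $\theta$ in the Euclidean unit sphere $S^{n-1}$; $L_K$ is called the isotropic constant of $K$. The constant $c$ is independent of $n$ and $K$; the function $f_n$ depends only on $n$, not on $K$. *)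

(* Defs.v *)
From HB Require Import structures.
From mathcomp Require Import all_boot all_order all_algebra.
From mathcomp Require Import all_classical all_reals all_analysis.

Set Implicit Arguments.
Unset Strict Implicit.
Unset Printing Implicit Defensive.

Import Order.TTheory GRing.Theory Num.Theory.
Import numFieldNormedType.Exports.

Local Open Scope classical_set_scope.
Local Open Scope ring_scope.

Definition measure_rV_display : measure_display -> measure_display.
Proof. exact. Qed.

(* The product sigma-algebra on R^n = 'rV[R]_n, built like the one of the
   library on n.-tuple T; it coincides with the Borel sigma-algebra. *)
Section measurable_rV.
Context {R : realType} (n : nat).

Let coord : 'I_n -> 'rV[R]_n -> R := fun i x => x ord0 i.

Let rV_set0 : g_sigma_preimage coord set0.
Proof. exact: sigma_algebra0. Qed.

Let rV_setC A : g_sigma_preimage coord A -> g_sigma_preimage coord (~` A).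
Proof. exact: sigma_algebraC. Qed.

Let rV_bigcup (F : (set 'rV[R]_n)^nat) :
  (forall i, g_sigma_preimage coord (F i)) ->
  g_sigma_preimage coord (\bigcup_i (F i)).
Proof. exact: sigma_algebra_bigcup. Qed.

HB.instance Definition _ := @isMeasurable.Build
  (measure_rV_display default_measure_display)
  'rV[R]_n (g_sigma_preimage coord) rV_set0 rV_setC rV_bigcup.

End measurable_rV.

Section lebesgue_measure_rV.
Context {R : realType}.
Local Open Scope ereal_scope.

Definition rV_cons n (p : measurableTypeR R * 'rV[R]_n) : 'rV[R]_n.+1 :=
  row_mx (p.1)%:M p.2 : 'rV_(1 + n).

Fixpoint lebesgue_rV n : set 'rV[R]_n -> \bar R :=
  match n with
  | 0%N => \d_(0%R : 'rV[R]_0)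
  | m.+1 => pushforward (@lebesgue_measure R \x @lebesgue_rV m) (@rV_cons m)
  end.

Lemma rV_cons0 n (p : measurableTypeR R * 'rV[R]_n) : rV_cons p ord0 ord0 = p.1.
Proof.
rewrite /rV_cons; have -> : (ord0 : 'I_n.+1) = lshift n (ord0 : 'I_1).
  exact/val_inj.
by rewrite (@row_mxEl _ _ 1 n) mxE eqxx.
Qed.

Lemma rV_consS n (p : measurableTypeR R * 'rV[R]_n) (i : 'I_n) :
  rV_cons p ord0 (lift ord0 i) = p.2 ord0 i.
Proof.
rewrite /rV_cons; have -> : lift ord0 i = rshift 1 i by exact/val_inj.
by rewrite (@row_mxEr _ _ 1 n).
Qed.

Lemma measurable_coord_rV n (i : 'I_n) :
  measurable_fun [set: 'rV[R]_n] (fun x : 'rV[R]_n => x ord0 i).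
Proof.
move=> _ A mA; apply: sub_sigma_algebra.
case: n i => [[] []//|n i].
rewrite -bigcup_mkord_ord; exists i; first exact: ltn_ord.
by exists A => //; rewrite inord_val.
Qed.

Lemma measurable_fun_rVP d (T : measurableType d) n (f : T -> 'rV[R]_n) :
  (forall i, measurable_fun [set: T] (fun t => f t ord0 i)) ->
  measurable_fun [set: T] f.
Proof.
move=> mf; move=> _ A mA; rewrite setTI; move: A mA.
apply: smallest_sub.
  split=> [|A mA|F mF].
  - by rewrite preimage_set0.
  - by rewrite setTD -preimage_setC; exact: measurableC.
  - by rewrite preimage_bigcup; exact: bigcupT_measurable.
case: n => [|n] in f mf *; first by rewrite big_ord0.
rewrite -bigcup_mkord_ord; apply: bigcup_sub => i Ii A [B mB <-].
by rewrite setTI -comp_preimage -[X in measurable X]setTI; exact: mf.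
Qed.

Lemma measurable_rV_cons n : measurable_fun setT (@rV_cons n).
Proof.
apply: measurable_fun_rVP => i; case: (unliftP ord0 i) => [j|] ->.
  rewrite (_ : (fun t => _) = (fun x : 'rV[R]_n => x ord0 j) \o snd).
    by apply: measurableT_comp => //; exact: measurable_coord_rV.
  by apply/funext => p /=; rewrite rV_consS.
rewrite (_ : (fun t => _) = fst)//.
by apply/funext => p /=; rewrite rV_cons0.
Qed.


Let product_sigma_finite d1 d2 (T1 : measurableType d1)
  (T2 : measurableType d2) (m1 : {sigma_finite_measure set T1 -> \bar R})
  (m2 : {sigma_finite_measure set T2 -> \bar R}) :
  sigma_finite [set: T1 * T2] (m1 \x m2).
Proof.
have /sigma_finiteP[F [TF ndF Foo]] := sigma_finiteT m1.
have /sigma_finiteP[G [TG ndG Goo]] := sigma_finiteT m2.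
exists (fun n => F n `*` G n).
  rewrite -setXTT TF TG predeqE => -[x y]; split.
    move=> [/= [n _ Fnx] [k _ Gky]]; exists (maxn n k) => //; split.
    - by move: x Fnx; exact/subsetPset/ndF/leq_maxl.
    - by move: y Gky; exact/subsetPset/ndG/leq_maxr.
  by move=> [n _ []/= ? ?]; split; exists n.
move=> k; have [? ?] := Foo k; have [? ?] := Goo k.
split; first exact: measurableX.
by rewrite product_measure1E// lte_mul_pinfty// ge0_fin_numE.
Qed.

Let rV_cons_sigma_finite n
    (mu : {measure set (measurableTypeR R * 'rV[R]_n)%type -> \bar R}) :
  sigma_finite setT mu -> sigma_finite setT (pushforward mu (@rV_cons n)).
Proof.
move=> [F FT Foo].
pose g (x : 'rV[R]_n.+1) : measurableTypeR R * 'rV[R]_n :=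
  (x ord0 ord0, \row_i x ord0 (lift ord0 i)).
have gK : cancel (@rV_cons n) g.
  move=> [a v]; rewrite /g rV_cons0; congr (_, _).
  by apply/rowP => i; rewrite mxE rV_consS.
have mg : measurable_fun setT g.
  apply/measurable_fun_pairP; split; first exact: measurable_coord_rV.
  apply: measurable_fun_rVP => i.
  rewrite (_ : (fun t => _) = (fun x : 'rV[R]_n.+1 => x ord0 (lift ord0 i))).
    exact: measurable_coord_rV.
  by apply/funext => x /=; rewrite mxE.
exists (fun k => g @^-1` F k).
  by rewrite -preimage_bigcup -FT preimage_setT.
move=> k; have [mF muF] := Foo k; split.
  by rewrite -[X in measurable X]setTI; exact: mg.
rewrite /pushforward -comp_preimage.
by rewrite (_ : g \o @rV_cons n = id)//; apply/funext => x; exact: gK.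
Qed.

Section rV_cons_image.
Variables (n : nat)
  (mu : {measure set (measurableTypeR R * 'rV[R]_n)%type -> \bar R}).
Hypothesis mu_sf : sigma_finite setT mu.

Let image of sigma_finite setT mu := pushforward mu (@rV_cons n).

Let image0 : image mu_sf set0 = 0.
Proof. by rewrite /image /pushforward preimage_set0 measure0. Qed.

Let image_ge0 A : 0 <= image mu_sf A.
Proof. by rewrite /image /pushforward. Qed.

Let image_sigma_additive : semi_sigma_additive (image mu_sf).
Proof.
pose nu : {measure set 'rV[R]_n.+1 -> \bar R} := pushforward mu (@rV_cons n).
exact: (@measure_semi_sigma_additive _ _ _ (nu (@measurable_rV_cons n))).
Qed.

HB.instance Definition _ := isMeasure.Build _ _ _ (image mu_sf)
  image0 image_ge0 image_sigma_additive.

HB.instance Definition _ := Measure_isSigmaFinite.Build _ _ _ (image mu_sf)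
  (rV_cons_sigma_finite mu_sf).

Definition rV_cons_image : {sigma_finite_measure set 'rV[R]_n.+1 -> \bar R} :=
  image mu_sf.

End rV_cons_image.

Let lebesgue_rV_bundled n :
  {m : {sigma_finite_measure set 'rV[R]_n -> \bar R} |
   (m : set 'rV[R]_n -> \bar R) = @lebesgue_rV n}.
Proof.
elim: n => [|n [m mE]] /=.
  by exists (\d_(0%R : 'rV[R]_0) : {sigma_finite_measure set _ -> \bar R}).
rewrite -mE.
pose mu : {measure set (measurableTypeR R * 'rV[R]_n)%type -> \bar R} :=
  @lebesgue_measure R \x m.
have mu_sf : sigma_finite setT mu by exact: product_sigma_finite.
by exists (rV_cons_image mu_sf).
Qed.

Let lebesgue_rV0 n : @lebesgue_rV n set0 = 0.
Proof. by have [m <-] := lebesgue_rV_bundled n. Qed.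

Let lebesgue_rV_ge0 n A : 0 <= @lebesgue_rV n A.
Proof. by have [m <-] := lebesgue_rV_bundled n. Qed.

Let lebesgue_rV_sigma_additive n : semi_sigma_additive (@lebesgue_rV n).
Proof.
have [m <-] := lebesgue_rV_bundled n; exact: measure_semi_sigma_additive.
Qed.

HB.instance Definition _ n := isMeasure.Build _ _ _ (@lebesgue_rV n)
  (@lebesgue_rV0 n) (@lebesgue_rV_ge0 n) (@lebesgue_rV_sigma_additive n).

Let lebesgue_rV_sigma_finite n : sigma_finite setT (@lebesgue_rV n).
Proof. have [m <-] := lebesgue_rV_bundled n; exact: sigma_finiteT. Qed.

HB.instance Definition _ n := Measure_isSigmaFinite.Build _ _ _
  (@lebesgue_rV n) (@lebesgue_rV_sigma_finite n).

Lemma lebesgue_rV_box n (A : 'I_n -> set R) :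
  (forall i, measurable (A i)) ->
  lebesgue_rV [set x : 'rV[R]_n | forall i, A i (x ord0 i)] =
  \prod_(i < n) lebesgue_measure (A i).
Proof.
elim: n A => [|n IH] A mA.
  by rewrite big_ord0 /= diracE mem_set// => -[].
pose B : set 'rV[R]_n := [set x | forall i, A (lift ord0 i) (x ord0 i)].
have mB : measurable B.
  rewrite (_ : B = \bigcap_(i in [set: 'I_n])
      ((fun x : 'rV[R]_n => x ord0 i) @^-1` A (lift ord0 i))).
    apply: fin_bigcap_measurable => // i _.
    by rewrite -[X in measurable X]setTI; exact: measurable_coord_rV.
  by apply/seteqP; split=> [x Bx i _|x Bx i]; [exact: Bx|exact: (Bx i I)].
rewrite big_ord_recl -IH//= /pushforward -product_measure1E//; last first.
  exact: mA.
congr (_ _); apply/seteqP; split=> -[a v] /=.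
  move=> h; split; first by have := h ord0; rewrite rV_cons0.
  by move=> i; have := h (lift ord0 i); rewrite rV_consS.
move=> [/= Aa Bv] i; case: (unliftP ord0 i) => [j|] ->.
  by rewrite rV_consS; exact: Bv.
by rewrite rV_cons0.
Qed.

End lebesgue_measure_rV.

Arguments lebesgue_rV : clear implicits.

Section convex_geometry.
Context {R : realType} {n : nat}.
Implicit Types (K T : set 'rV[R]_n) (x theta : 'rV[R]_n).

Local Notation vol := (lebesgue_rV R n).

Definition dotp x theta : R := \sum_(i < n) x ord0 i * theta ord0 i.

Definition convex_body K := [/\ compact K, convex_set K & K° !=set0].

Definition vec_integral K : 'rV[R]_n := \row_i \int[vol]_(x in K) (x ord0 i).

Definition barycenter K : 'rV[R]_n := (fine (vol K))^-1 *: vec_integral K.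

Definition conv_hull m (v : 'I_m -> 'rV[R]_n) : set 'rV[R]_n :=
  [set x | exists w : 'I_m -> R,
    [/\ forall i, 0 <= w i, \sum_i w i = 1 & x = \sum_i w i *: v i]].

Definition affinely_independent m (v : 'I_m -> 'rV[R]_n) :=
  forall w : 'I_m -> R, \sum_i w i = 0 -> \sum_i w i *: v i = 0 ->
  forall i, w i = 0.

Definition simplex T := exists v : 'I_n.+1 -> 'rV[R]_n,
  affinely_independent v /\ T = conv_hull v.

Definition centered_simplex : set (set 'rV[R]_n) :=
  [set T | simplex T /\ barycenter T = 0].

(* L is the isotropic constant of K; it is determined by K when n >= 1. *)
Definition isotropic K (L : R) :=
  [/\ convex_body K, vol K = 1%E, vec_integral K = 0, 0 < L &
      forall theta, dotp theta theta = 1 ->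
        \int[vol]_(x in K) (dotp x theta ^+ 2) = L ^+ 2].

End convex_geometry.

Section random_vectors.
Context {R : realType} d (Omega : measurableType d) (P : probability Omega R).

Definition uniform_on n (K : set 'rV[R]_n) (X : {RV P >-> 'rV[R]_n}) :=
  forall A, measurable A ->
    distribution P X A =
    ((fine (lebesgue_rV R n K))^-1%:E * lebesgue_rV R n (A `&` K))%E.

Definition independent_RVs d' (T : measurableType d') m
    (X : 'I_m -> {RV P >-> T}) :=
  forall (J : {set 'I_m}) (A : 'I_m -> set T), (forall i, measurable (A i)) ->
    P (\bigcap_(i in [set` J]) (X i @^-1` A i)) =
    (\prod_(i in J) P (X i @^-1` A i))%E.

End random_vectors.

(* Main.v *)
(* Take f(x_1, ..., x_n) = s (S - b), where S is the convex hull of 0, x_1, ...,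
   x_n, b is its barycenter and s is a small absolute constant.  By
   Prekopa-Leindler each marginal <X, theta> of K has log-concave tails, hence
   exponential moments at scale L, a mass bounded below beyond a multiple of L,
   and P(|<X, theta>| <= t) <= C t / L.  The last estimate, a cofactor expansion
   of det(X_1, ..., X_n) and Jensen's inequality for |.|^(-1/2) bound
   E |det|^(-1/2), so |det| >= c^n L^n sqrt(n!) outside an event of probability
   e^(-n) / 4.  A net argument gives |X_1 + ... + X_n| <= C n L outside another
   such event; since K contains a ball of radius proportional to L, the point -b
   is then an absolute multiple of a point of K, and convexity puts s (S - b)
   inside K. *)
Require Import Defs.
From HB Require Import structures.
From mathcomp Require Import all_boot all_order all_algebra.
From mathcomp Require Import all_classical all_reals all_analysis.
From mathcomp Require Import measurable_realfun ring lra.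

Set Implicit Arguments.
Unset Strict Implicit.
Unset Printing Implicit Defensive.

Import Order.TTheory GRing.Theory Num.Theory.
Import numFieldNormedType.Exports.

Local Open Scope classical_set_scope.
Local Open Scope ring_scope.

(** The shrinking factor must be fixed before [K] and [L] are known, so every estimate on a marginal
    is made at scale [L] with numerical constants. Densities of marginals are never formed:
    log-concavity is used as a midpoint inequality for tails along arithmetic progressions, where
    successive ratios decrease. A small initial ratio gives exponential decay; a tail still of size
    [tail_mass] after k steps forces an initial drop of order 1/k, which is the small ball estimate.
    That estimate guarantees integrability of |<X, theta>|^(-a) only for a < 1; the choice a = 1/2
    keeps to square roots. Given the other rows, det is a linear form in one row with the cofactors
    as coefficients. Bounding its norm below by a single cofactor would lose the factor sqrt(n!),
    which cannot be spared: a simplex has volume |det| / n! and the target is of order n^(-n/2).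
    Jensen averages over all m cofactors and gains m^(-1/4) per row, hence (n!)^(-1/4) for
    |det|^(-1/2). *)

Definition image_measure d d' (T1 : measurableType d) (T2 : measurableType d')
    (R : realType) (m : {measure set T1 -> \bar R}) (f : T1 -> T2)
    (mf : measurable_fun [set: T1] f) : {measure set T2 -> \bar R} :=
  measure_function_pushforward__canonical__measure_function_Measure m mf.

(** The right-hand side is itself a measure in [A], a scaled pushforward, so uniqueness of Lebesgue
    measure leaves only half-open intervals to check. For a < 0 the preimage is closed at the other
    end, which does not change its length. *)
Lemma lebesgue_measure_affine (R : realType) (a b : R) (A : set R) :
  a != 0 -> measurable A ->
  (lebesgue_measure A = `|a|%:E * lebesgue_measure ((fun x => (a * x + b)%R) @^-1` A))%E.
Proof.
move=> a0 mA.
have mf : measurable_fun setT (fun x : measurableTypeR R => (a * x + b)%R : measurableTypeR R).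
  by apply: measurable_funD => //; exact: measurable_funM.
pose nu : {measure set measurableTypeR R -> \bar R} :=
  mscale (NngNum (normr_ge0 a)) (image_measure lebesgue_measure mf).
rewrite -[RHS]/(nu A).
apply: lebesgue_measure_unique => // _ [[u v]] _ <-.
rewrite /= /mscale /= /pushforward.
have [ap|an|a00] := ltgtP 0 a.
- rewrite (_ : _ @^-1` _ = `](u - b) / a, (v - b) / a]%classic); last first.
    apply/seteqP; split => x /=; rewrite !in_itv/= ltr_pdivrMr// ler_pdivlMr//; lra.
  rewrite !lebesgue_measure_itv/= !lte_fin ltr_pM2r ?invr_gt0// ltrD2r.
  case: ifPn => // _; last by rewrite mule0.
  rewrite -!EFinB -EFinM gtr0_norm//; congr EFin; field.
  by rewrite gt_eqF.
- rewrite (_ : _ @^-1` _ = `[(v - b) / a, (u - b) / a[%classic); last first.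
    apply/seteqP; split => x /=; rewrite !in_itv/= ler_ndivrMr// ltr_ndivlMr//; lra.
  rewrite !lebesgue_measure_itv/= !lte_fin ltr_nM2r ?invr_lt0// ltrD2r.
  case: ifPn => // _; last by rewrite mule0.
  rewrite -!EFinB -EFinM ltr0_norm//; congr EFin; field.
  by rewrite lt_eqF.
- by rewrite -a00 eqxx in a0.
Qed.

Lemma ge0_integral_affine (R : realType) (a b : R) (f : R -> \bar R) :
  a != 0 -> measurable_fun setT f -> (forall x, 0 <= f x)%E ->
  (`|a|%:E * \int[lebesgue_measure]_x f (a * x + b)%R = \int[lebesgue_measure]_x f x)%E.
Proof.
move=> a0 mf f0.
have mg : measurable_fun setT (fun x : measurableTypeR R => (a * x + b)%R : measurableTypeR R).
  by apply: measurable_funD => //; exact: measurable_funM.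
pose nu : {measure set measurableTypeR R -> \bar R} :=
  mscale (NngNum (normr_ge0 a)) (image_measure lebesgue_measure mg).
transitivity (\int[nu]_x f x)%E.
  rewrite ge0_integral_mscale//=; congr (_ * _)%E.
  rewrite (ge0_integral_pushforward mg)//=; exact: eq_integral.
by apply: eq_measure_integral => // A mA _; exact/esym/lebesgue_measure_affine.
Qed.

(** * Linear change of variables in 'rV[R]_n *)

Section integral_rV.
Context {R : realType}.
Local Open Scope ereal_scope.
Local Notation vol n := (lebesgue_rV R n).

Lemma integral_rVS n (f : 'rV[R]_n.+1 -> \bar R) : measurable_fun setT f ->
  (forall x, 0 <= f x) ->
  \int[vol n.+1]_x f x =
  \int[lebesgue_measure]_t \int[vol n]_v f (rV_cons (t, v)).
Proof.
move=> mf f0.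
transitivity (\int[(lebesgue_measure \x vol n)%E]_p f (@rV_cons R n p)).
  transitivity (\int[image_measure (lebesgue_measure \x vol n)%E (@measurable_rV_cons R n)]_x f x).
    exact: eq_measure_integral.
  by rewrite (ge0_integral_pushforward (@measurable_rV_cons R n)).
rewrite fubini_tonelli1//.
exact: measurableT_comp (@measurable_rV_cons R n).
Qed.

Lemma integral_rVS_swap n (f : 'rV[R]_n.+1 -> \bar R) : measurable_fun setT f ->
  (forall x, 0 <= f x) ->
  \int[vol n.+1]_x f x =
  \int[vol n]_v \int[lebesgue_measure]_t f (rV_cons (t, v)).
Proof.
move=> mf f0; rewrite integral_rVS//.
rewrite (fubini_tonelli (fun p => f (rV_cons p)))//.
exact: measurableT_comp (@measurable_rV_cons R n).
Qed.

Lemma measurable_integral_rV_cons n (f : 'rV[R]_n.+1 -> \bar R) :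
  measurable_fun setT f -> (forall x, 0 <= f x) ->
  measurable_fun setT (fun t : measurableTypeR R => \int[vol n]_v f (rV_cons (t, v))).
Proof.
move=> mf f0.
apply: (measurable_fun_fubini_tonelli_F (fun p => f (rV_cons p))) => //.
exact: measurableT_comp (@measurable_rV_cons R n).
Qed.

Lemma measurable_rV_cons1 n (f : 'rV[R]_n.+1 -> \bar R) (v : 'rV[R]_n) :
  measurable_fun setT f -> measurable_fun setT (fun t : R => f (rV_cons (t, v))).
Proof.
move=> mf; apply: measurableT_comp mf _.
exact: measurableT_comp (@measurable_rV_cons R n) (measurable_pair2 v).
Qed.

Lemma measurable_rV_cons2 n (f : 'rV[R]_n.+1 -> \bar R) (t : measurableTypeR R) :
  measurable_fun setT f -> measurable_fun setT (fun v : 'rV[R]_n => f (rV_cons (t, v))).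
Proof.
move=> mf; apply: measurableT_comp mf _.
exact: measurableT_comp (@measurable_rV_cons R n) (measurable_pair1 t).
Qed.

Lemma measurable_affine_rV m n (M : 'M[R]_(m, n)) (c : 'rV[R]_n) :
  measurable_fun setT (fun x : 'rV[R]_m => (x *m M + c)%R).
Proof.
apply: measurable_fun_rVP => i.
under eq_fun => t do rewrite mxE.
apply: measurable_funD => //.
under eq_fun => t do rewrite mxE.
apply: measurable_sum => j; apply: measurable_funM => //.
exact: measurable_coord_rV.
Qed.

(** The translation [c] is universally quantified for the sake of the induction on blocks: a shear
    acts on each fibre as a translation that depends on the other coordinate. *)
Definition change_of_variables n (M : 'M[R]_n) :=
  forall (c : 'rV[R]_n) (f : 'rV[R]_n -> \bar R),
  measurable_fun setT f -> (forall x, 0 <= f x) ->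
  `|\det M|%:E * \int[vol n]_x f (x *m M + c)%R = \int[vol n]_x f x.

Lemma change_of_variables_mul n (M N : 'M[R]_n) :
  change_of_variables M -> change_of_variables N ->
  change_of_variables (M *m N).
Proof.
move=> hM hN c f mf f0; rewrite det_mulmx normrM EFinM [_%:E * _%:E]muleC -muleA.
rewrite -(hN c f mf f0); congr *%E.
rewrite -(hM 0%R (fun y => f (y *m N + c)%R))//; last first.
  by apply: measurableT_comp mf _; exact: measurable_affine_rV.
by congr *%E; apply: eq_integral => x _; rewrite addr0 mulmxA.
Qed.

Lemma integral_ge0T d (T : measurableType d) (mu : {measure set T -> \bar R})
  (f : T -> \bar R) : (forall x, 0 <= f x) -> 0 <= \int[mu]_x f x.
Proof. by move=> f0; apply: integral_ge0. Qed.

(** On row vectors the map sends (t, v) to (a t + v c, v D). For fixed v it is affine in t, so t is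
    integrated innermost and the substitution on the line precedes the one for [D]. *)
Lemma change_of_variables_lblock n (a : R) (c : 'cV[R]_n) (D : 'M[R]_n) :
  a != 0%R -> change_of_variables D ->
  change_of_variables (block_mx a%:M 0%R c D : 'M[R]_(1 + n)).
Proof.
move=> a0 hD e f mf f0.
pose e0 := e ord0 ord0; pose e' : 'rV[R]_n := rsubmx (e : 'rV_(1 + n)).
have eE : e = rV_cons (e0, e').
  rewrite /rV_cons /= -[LHS](@hsubmxK _ _ 1 n); congr row_mx.
  by apply/matrixP => i j; rewrite !ord1 !mxE eqxx mulr1n; congr (e _ _); exact/val_inj.
have fE (t : R) (v : 'rV[R]_n) :
    ((rV_cons (t, v) : 'rV_(1 + n)) *m (block_mx a%:M 0%R c D : 'M[R]_(1 + n)) + e)%R =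
    rV_cons (a * t + ((v *m c) ord0 ord0 + e0), v *m D + e')%R.
  rewrite eE /rV_cons /= mul_row_block mulmx0 add0r add_row_mx; congr row_mx.
  by apply/matrixP => i j; rewrite !ord1 -scalar_mxM !mxE !eqxx !mulr1n mulrC addrA.
rewrite integral_rVS_swap//; last first.
  by apply: measurableT_comp mf _; exact: (@measurable_affine_rV (1 + n) (1 + n)).
under eq_integral => v _ do under eq_integral => t _ do rewrite fE.
rewrite (@det_lblock _ 1 n) det_scalar1 normrM EFinM [_%:E * _%:E]muleC -muleA.
have mG : measurable_fun setT (fun y => \int[lebesgue_measure]_t f (rV_cons (t, y))).
  apply: (measurable_fun_fubini_tonelli_G (fun p => f (rV_cons p))) => //.
  exact: measurableT_comp (@measurable_rV_cons R n).
have mGD : measurable_fun setT (fun v => \int[lebesgue_measure]_t f (rV_cons (t, (v *m D + e')%R))).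
  apply: (@measurableT_comp _ _ _ _ _ _ _ _ _ mG); exact: measurable_affine_rV.
have step v : `|a|%:E * \int[lebesgue_measure]_t
      f (rV_cons ((a * t + ((v *m c) ord0 ord0 + e0))%R, (v *m D + e')%R)) =
    \int[lebesgue_measure]_t f (rV_cons (t, (v *m D + e')%R)).
  rewrite (ge0_integral_affine _ (f := fun s => f (rV_cons (s, (v *m D + e')%R)))) //.
  exact: measurable_rV_cons1.
(* Measurability of the inner integral comes from [step]: it is a constant multiple of a function
   already known to be measurable. *)
rewrite -ge0_integralZl//; last 2 first.
- apply: (@eq_measurable_fun _ _ _ _ _ (fun v => (`|a|^-1)%:E *
    \int[lebesgue_measure]_t f (rV_cons (t, (v *m D + e')%R)))).
    move=> v _ /=; rewrite -step muleA -EFinM mulVf ?mul1e//.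
    by rewrite normr_eq0.
  exact: measurable_funeM.
- by move=> v _; exact: integral_ge0T.
under eq_integral => v _ do rewrite step.
rewrite integral_rVS_swap//.
rewrite -(hD e' (fun v => \int[lebesgue_measure]_t f (rV_cons (t, v))))//.
by move=> v; exact: integral_ge0T.
Qed.

(** Here (t, v) goes to (a t, v D + t b): for fixed t the second block undergoes [D] and a
    translation, so v is integrated innermost, in the order opposite to the lower triangular
    case. *)
Lemma change_of_variables_ublock n (a : R) (b : 'rV[R]_n) (D : 'M[R]_n) :
  a != 0%R -> (\det D != 0)%R -> change_of_variables D ->
  change_of_variables (block_mx a%:M b 0%R D : 'M[R]_(1 + n)).
Proof.
move=> a0 D0 hD e f mf f0.
pose e0 := e ord0 ord0; pose e' : 'rV[R]_n := rsubmx (e : 'rV_(1 + n)).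
have eE : e = rV_cons (e0, e').
  rewrite /rV_cons /= -[LHS](@hsubmxK _ _ 1 n); congr row_mx.
  by apply/matrixP => i j; rewrite !ord1 !mxE eqxx mulr1n; congr (e _ _); exact/val_inj.
have fE (t : R) (v : 'rV[R]_n) :
    ((rV_cons (t, v) : 'rV_(1 + n)) *m (block_mx a%:M b 0%R D : 'M[R]_(1 + n)) + e)%R =
    rV_cons (a * t + e0, v *m D + (t *: b + e'))%R.
  rewrite eE /rV_cons /= mul_row_block mulmx0 addr0 add_row_mx; congr row_mx.
    by apply/matrixP => i j; rewrite !ord1 -scalar_mxM !mxE !eqxx !mulr1n mulrC.
  by rewrite mul_scalar_mx [in RHS]addrCA addrA.
rewrite integral_rVS//; last first.
  by apply: measurableT_comp mf _; exact: (@measurable_affine_rV (1 + n) (1 + n)).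
under eq_integral => v _ do under eq_integral => t _ do rewrite fE.
rewrite (@det_ublock _ 1 n) det_scalar1 normrM EFinM -muleA.
have mG := measurable_integral_rV_cons mf f0.
have mGD : measurable_fun setT (fun t : measurableTypeR R => \int[vol n]_v f (rV_cons ((a * t + e0)%R, v))).
  apply: (@measurableT_comp _ _ _ _ _ _ _ _ _ mG).
  by apply: measurable_funD => //; exact: measurable_funM.
have step t : `|\det D|%:E * \int[vol n]_v
      f (rV_cons ((a * t + e0)%R, (v *m D + (t *: b + e'))%R)) =
    \int[vol n]_v f (rV_cons ((a * t + e0)%R, v)).
  rewrite (hD _ (fun v => f (rV_cons (_, v)))) //.
  exact: measurable_rV_cons2.
rewrite -(@ge0_integralZl _ _ _ lebesgue_measure)//; last 2 first.
- apply: (@eq_measurable_fun _ _ _ _ _ (fun t : measurableTypeR R => (`|\det D|^-1)%:E *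
    \int[vol n]_v f (rV_cons ((a * t + e0)%R, v)))).
    move=> v _ /=; rewrite -step muleA -EFinM mulVf ?mul1e//.
    by rewrite normr_eq0.
  exact: measurable_funeM.
- by move=> v _; exact: integral_ge0T.
under eq_integral => v _ do rewrite step.
rewrite integral_rVS//.
rewrite (ge0_integral_affine _ (f := fun s => \int[vol n]_v f (rV_cons (s, v)))) //.
by move=> v; exact: integral_ge0T.
Qed.

(** One step of block elimination per dimension: a matrix with nonzero pivot is a unit lower block
    times an upper block whose corner is the Schur complement, and the induction hypothesis serves
    the diagonal blocks. *)
Lemma change_of_variables_unit n (M : 'M[R]_n) :
  (\det M != 0)%R -> change_of_variables M.
Proof.
elim: n M => [|n IH] M detM.
  move=> c f mf f0; rewrite det_mx00 normr1 mul1e.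
  by apply: eq_integral => x _; rewrite !thinmx0.
have pivot (N : 'M[R]_(1 + n)) : (\det N != 0)%R -> (ulsubmx N ord0 ord0 != 0)%R ->
    change_of_variables N.
  set a := ulsubmx N ord0 ord0 => detN a0.
  have NE : N = block_mx a%:M (ursubmx N) (dlsubmx N) (drsubmx N).
    by rewrite -[LHS]submxK; congr block_mx; rewrite [LHS]mx11_scalar.
  have NE2 : N = block_mx 1%:M 0 (a^-1 *: dlsubmx N) 1%:M *m
      block_mx a%:M (ursubmx N) 0 (drsubmx N - a^-1 *: (dlsubmx N *m ursubmx N))%R.
    rewrite mulmx_block !mul1mx !mul0mx !addr0 [LHS]NE; congr block_mx.
      by rewrite -scalemxAl mul_mx_scalar scalerA mulVf// scale1r.
    by rewrite -scalemxAl addrC subrK.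
  rewrite [X in change_of_variables X]NE2; move: detN; rewrite [X in \det X]NE2.
  rewrite det_mulmx det_lblock det_ublock !det1 !mul1r det_scalar1 mulf_eq0 negb_or => /andP[_ detD].
  apply: change_of_variables_mul; first apply: change_of_variables_lblock.
  - exact: oner_neq0.
  - by apply: IH; rewrite det1 oner_neq0.
  - by apply: change_of_variables_ublock => //; exact: IH.
(* A vanishing pivot is removed by a shear, b b^T being nonzero. *)
pose N : 'M[R]_(1 + n) := M.
have [a0|a0] := eqVneq (ulsubmx N ord0 ord0) 0%R; last exact: (pivot N).
pose b := ursubmx N.
have NE : N = block_mx 0%:M b (dlsubmx N) (drsubmx N).
  by rewrite -[LHS]submxK; congr block_mx; rewrite [LHS]mx11_scalar a0.
have b0 : b != 0%R.
  apply: contraNneq detM => b0; rewrite -[M]/N NE b0 (@det_lblock _ 1 n).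
  by rewrite det_scalar1 mul0r.
pose S : 'M[R]_(1 + n) := block_mx 1%:M 0 b^T 1%:M.
pose S' : 'M[R]_(1 + n) := block_mx 1%:M 0 (- b^T) 1%:M.
have SS' : S *m S' = 1%:M.
  rewrite mulmx_block !mul1mx !mul0mx !mulmx0 !mulmx1 !addr0 add0r subrr.
  by rewrite -scalar_mx_block.
rewrite (_ : M = N *m S *m S'); last by rewrite -mulmxA SS' mulmx1.
apply: change_of_variables_mul; last first.
  apply: change_of_variables_lblock; first exact: oner_neq0.
  by apply: IH; rewrite det1 oner_neq0.
apply: pivot.
  by rewrite det_mulmx det_lblock !det1 !mulr1.
rewrite NE mulmx_block block_mxKul mulmx1 -scalemx1 scale0r add0r mxE.
apply: contra_neq b0 => /eqP; rewrite psumr_eq0; last first.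
  by move=> i _; rewrite !mxE -expr2 sqr_ge0.
move=> /allP b0; apply/rowP => i; have := b0 i.
by rewrite mem_index_enum => /(_ isT) /=; rewrite [_^T _ _]mxE mulf_eq0 orbb [(0%R : 'rV_n) _ _]mxE => /eqP.
Qed.
End integral_rV.

(** * The Prekopa-Leindler inequality *)

Section prekopa_leindler.
Context {R : realType}.
Local Open Scope ereal_scope.
Local Notation mu := (@lebesgue_measure R).

Lemma lebesgue_measure_half (A : set R) (b : R) : measurable A ->
  mu A = 2%:E * mu [set x | A (2 * x - b)%R].
Proof.
move=> mA; rewrite (@lebesgue_measure_affine _ 2 (- b) A)//.
by rewrite ger0_norm.
Qed.

(** One-dimensional Brunn-Minkowski. With a the maximum of [A] and b the minimum of [B], the sets (A
    + b) / 2 and (a + B) / 2 both lie in [C], on either side of their only common point (a + b) /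
    2. *)
Lemma compact_midpoint_measure (A B C : set R) : compact A -> compact B ->
  A !=set0 -> B !=set0 -> measurable C ->
  (forall a b, A a -> B b -> C (2^-1 * (a + b))%R) ->
  mu A + mu B <= 2%:E * mu C.
Proof.
move=> cA cB A0 B0 mC ABC.
have cid D : {within D, continuous (@id R)}.
  by apply: continuous_subspaceT => x; exact: cvg_id.
have [a /set_mem Aa amax] := compact_EVT_max A0 cA (cid A).
have [b /set_mem Bb bmin] := compact_EVT_min B0 cB (cid B).
have mA : measurable A by exact: compact_measurable.
have mB : measurable B by exact: compact_measurable.
have mpre D c : measurable D -> measurable [set x : R | D (2 * x - c)%R].
  move=> mD; rewrite -[X in measurable X]setTI.
  apply: (_ : measurable_fun setT (fun x : R => 2 * x - c)%R) => //.
  by apply: measurable_funB => //; exact: measurable_funM.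
rewrite (lebesgue_measure_half b mA) (lebesgue_measure_half a mB).
rewrite -ge0_muleDr//; apply: lee_wpmul2l => //.
set P := [set x | _]; set Q := [set x | _].
have mP : measurable P by exact: mpre.
have mQ : measurable Q by exact: mpre.
pose p := (2^-1 * (a + b))%R.
(* Deleting the null point [p] makes the two sets disjoint, so that their measures add. *)
have -> : mu Q = mu (Q `\ p).
  apply/eqP; rewrite eq_le; apply/andP; split; last first.
    by apply: le_measure; rewrite ?inE//; exact: measurableD.
  rewrite -[leRHS]adde0 -(lebesgue_measure_set1 p).
  apply: le_trans (measureU2 _ _ _) => //; last exact: measurableD.
  have mQp : measurable (Q `\ p `|` [set p]) by apply: measurableU => //; exact: measurableD.
  apply: le_measure; rewrite ?inE//.
  by move=> x Qx; have [->|xp] := eqVneq x p; [right|left; split => //; exact/eqP].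
rewrite -measureU//; last 2 first.
- exact: measurableD.
- apply/seteqP; split => // x [Px [Qx /= xab]].
  have h1 : (2 * x - b <= a)%R := amax _ (mem_set Px).
  have h2 : (b <= 2 * x - a)%R := bmin _ (mem_set Qx).
  by exfalso; apply: xab => /=; rewrite /p; lra.
apply: le_measure; rewrite ?inE//.
  by apply: measurableU => //; exact: measurableD.
move=> x [Px|[Qx _]].
  by have := ABC _ _ Px Bb; congr (C _); lra.
by have := ABC _ _ Aa Qx; congr (C _); lra.
Qed.

(** Inner regularity passes from compact to measurable sets, one set at a time; finiteness of the
    measure of [C] allows the other term to be moved across the inequality. *)
Lemma midpoint_measure (A B C : set R) : measurable A -> measurable B ->
  A !=set0 -> B !=set0 -> measurable C ->
  (forall a b, A a -> B b -> C (2^-1 * (a + b))%R) ->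
  mu A + mu B <= 2%:E * mu C.
Proof.
move=> mA mB [a0 Aa0] [b0 Bb0] mC ABC.
have [->|Cfin] := eqVneq (mu C) +oo; first by rewrite gt0_muley// leey.
have {}Cfin : 2%:E * mu C \is a fin_num.
  by rewrite fin_numM// ge0_fin_numE// ltey.
have key K L : compact K -> compact L -> K `<=` A -> L `<=` B ->
    mu K + mu L <= 2%:E * mu C.
  move=> cK cL KA LB.
  (* Adjoining [a0] and [b0] guarantees that the compact sets are non-empty. *)
  apply: (@le_trans _ _ (mu (K `|` [set a0]) + mu (L `|` [set b0]))).
    apply: leeD; apply: le_measure; rewrite ?inE//; try by move=> x; left.
    - exact: compact_measurable.
    - by apply: measurableU => //; exact: compact_measurable.
    - exact: compact_measurable.
    - by apply: measurableU => //; exact: compact_measurable.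
  apply: compact_midpoint_measure => //.
  - by apply: compactU => //; exact: compact_set1.
  - by apply: compactU => //; exact: compact_set1.
  - by exists a0; right.
  - by exists b0; right.
  - by move=> a b [/KA Aa|->] [/LB Bb|->]; exact: ABC.
have fin D E : 0 <= D -> 0 <= E -> D + E <= 2%:E * mu C -> E \is a fin_num.
  move=> D0 E0 DE; rewrite ge0_fin_numE//; apply: (@le_lt_trans _ _ (2%:E * mu C)).
    by apply: le_trans DE; rewrite leeDr.
  by rewrite -ge0_fin_numE// mule_ge0.
have keyA L : compact L -> L `<=` B -> mu A + mu L <= 2%:E * mu C.
  move=> cL LB; have finL : mu L \is a fin_num.
    by apply: (fin (mu set0)) => //; apply: key => //; exact: compact0.
  rewrite -leeBrDr// (lebesgue_regularity_inner_sup mA).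
  by apply: ge_ereal_sup => _ [K [cK KA] <-]; rewrite leeBrDr//; exact: key.
have finA : mu A \is a fin_num.
  apply: (fin (mu set0)) => //; rewrite addeC; apply: keyA => //; exact: compact0.
rewrite -leeBrDl// (lebesgue_regularity_inner_sup mB).
by apply: ge_ereal_sup => _ [L [cL LB] <-]; rewrite leeBrDl//; exact: keyA.
Qed.

Lemma measurable_ltr_set d (T : measurableType d) (f g : T -> R) :
  measurable_fun setT f -> measurable_fun setT g -> measurable [set x | f x < g x]%R.
Proof.
move=> mf mg; have := measurable_fun_ltr mf mg.
by move=> /(_ measurableT [set true] I); rewrite setTI.
Qed.

Lemma measurable_ler_set d (T : measurableType d) (f g : T -> R) :
  measurable_fun setT f -> measurable_fun setT g -> measurable [set x | f x <= g x]%R.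
Proof.
move=> mf mg; have := measurable_fun_ler mf mg.
by move=> /(_ measurableT [set true] I); rewrite setTI.
Qed.

Lemma measurable_superlevel (f : R -> R) : measurable_fun setT f ->
  measurable_fun setT (fun r : measurableTypeR R => mu [set x | r < f x]%R).
Proof.
move=> mf.
pose S := [set p : measurableTypeR R * measurableTypeR R | (p.2 < f p.1)%R].
have mS : measurable S.
  apply: measurable_ltr_set => //; exact: measurableT_comp mf measurable_fst.
rewrite (_ : (fun r => _) = mu \o ysection S); first exact: measurable_fun_ysection.
apply/funext => r /=; congr (mu _); apply/seteqP; split => x.
  by rewrite /ysection /= inE.
by rewrite /ysection /= inE.
Qed.

Lemma layer_cake01 (f : R -> R) : measurable_fun setT f ->
  (forall x, 0 <= f x <= 1)%R ->
  \int[mu]_x (f x)%:E = \int[mu]_(r in `[0%R, 1%R]) mu [set x | r < f x]%R.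
Proof.
move=> mf f01.
pose S := [set p : measurableTypeR R * measurableTypeR R | (0 <= p.2)%R] `&`
  [set p : measurableTypeR R * measurableTypeR R | (p.2 < f p.1)%R].
have mS : measurable S.
  apply: measurableI; first exact: measurable_ler_set.
  apply: measurable_ltr_set => //; exact: measurableT_comp mf measurable_fst.
transitivity (\int[mu]_x \int[mu]_r (\1_S (x, r))%:E).
  apply: eq_integral => x _.
  transitivity (\int[mu]_r (\1_(`[0%R, f x[%classic) r)%:E).
    rewrite integral_indic//= setIT lebesgue_measure_itv/= lte_fin.
    have /andP[f0 _] := f01 x; rewrite sube0.
    by case: ltgtP f0 => // <-.
  apply: eq_integral => r _; rewrite !indicE; congr ((nat_of_bool _)%:R%:E).
  apply/idP/idP; rewrite !inE/= in_itv/=; first by move=> /andP[].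
  by move=> [-> ->].
rewrite (fubini_tonelli (fun p => (\1_S p)%:E))//=; last exact/measurable_EFinP/measurable_indic.
rewrite [RHS]integral_mkcond/=; apply: eq_integral => r _.
have mfr : measurable [set x | (r < f x)%R] by exact: measurable_ltr_set.
rewrite patchE; case: ifPn => [|r01].
  rewrite inE/= in_itv/= => /andP[r0 r1].
  rewrite -[X in mu X]setIT -integral_indic//.
  apply: eq_integral => x _; rewrite !indicE; congr ((nat_of_bool _)%:R%:E).
  apply/idP/idP; rewrite !inE/=; first by case.
  by [].
apply: integral0_eq => x _; rewrite indicE memNset//= => -[r0 rf].
by move: r01; rewrite notin_setE/= in_itv/= r0 (le_trans (ltW rf))//; case/andP: (f01 x).
Qed.

(** With both suprema equal to 1, the superlevel sets of [f] and [g] are non-empty at every level r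
    < 1, as the midpoint inequality for sets requires. If f a > r and g b > r then h ((a + b) / 2)^2
    > r^2, so the inequality holds level by level and integrates over r. *)
Lemma prekopa_leindler_normalized (f g h : R -> R) :
  measurable_fun setT f -> measurable_fun setT g -> measurable_fun setT h ->
  (forall x, 0 <= f x <= 1)%R -> (forall x, 0 <= g x <= 1)%R ->
  (forall x, 0 <= h x <= 1)%R ->
  (forall r, r < 1 -> exists x, r < f x)%R ->
  (forall r, r < 1 -> exists x, r < g x)%R ->
  (forall x y, f x * g y <= h (2^-1 * (x + y)) ^+ 2)%R ->
  \int[mu]_x (f x)%:E + \int[mu]_x (g x)%:E <= 2%:E * \int[mu]_x (h x)%:E.
Proof.
move=> mf mg mh f01 g01 h01 supf supg fgh.
have mlt (k : R -> R) r : measurable_fun setT k -> measurable [set x | (r < k x)%R].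
  by move=> mk; exact: measurable_ltr_set.
have mm (k : R -> R) : measurable_fun setT k ->
    measurable_fun (`[0%R, 1%R] : set (measurableTypeR R)) (fun r => mu [set x | r < k x]%R).
  by move=> mk; exact: (measurable_funTS (measurable_superlevel mk)).
have mmf := mm f mf; have mmg := mm g mg; have mmh := mm h mh.
rewrite !layer_cake01// -ge0_integralZl// -ge0_integralD//.
apply: ge0_le_integral => //.
- by move=> x _; exact: adde_ge0.
- exact: emeasurable_funD.
- exact: measurable_funeM.
move=> r /=; rewrite in_itv/= => /andP[r0 r1].
move: r1; rewrite le_eqVlt => /orP[/eqP ->|r1].
  rewrite (_ : [set x | (1 < f x)%R] = set0); last first.
    by apply/seteqP; split => x //=; rewrite ltNge; case/andP: (f01 x) => _ ->.
  rewrite (_ : [set x | (1 < g x)%R] = set0); last first.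
    by apply/seteqP; split => x //=; rewrite ltNge; case/andP: (g01 x) => _ ->.
  by rewrite measure0 adde0 mule_ge0.
apply: midpoint_measure; [exact: mlt|exact: mlt|exact: supf|exact: supg|exact: mlt|].
move=> a b /= rf rg; rewrite -(@ltr_pXn2r _ 2)// ?nnegrE//; last by case/andP: (h01 (2^-1 * (a + b))%R).
apply: lt_le_trans (fgh a b).
rewrite expr2; exact: ltr_pM.
Qed.
End prekopa_leindler.

Section prekopa_leindler_general.
Context {R : realType}.
Local Open Scope ereal_scope.
Local Notation mu := (@lebesgue_measure R).

(** The squared midpoint form avoids roots of extended reals. Boundedness makes the suprema finite,
    and a supremum equal to 0 means a vanishing function, treated apart. *)
Lemma prekopa_leindler_bounded (M : R) (f g h : R -> \bar R) :
  measurable_fun setT f -> measurable_fun setT g -> measurable_fun setT h ->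
  (forall x, 0 <= f x <= M%:E) -> (forall x, 0 <= g x <= M%:E) ->
  (forall x, 0 <= h x) ->
  (forall x y, f x * g y <= h (2^-1 * (x + y))%R * h (2^-1 * (x + y))%R) ->
  \int[mu]_x f x * \int[mu]_x g x <= \int[mu]_x h x * \int[mu]_x h x.
Proof.
move=> mf mg mh fM gM h0 fgh.
have rep (k : R -> \bar R) : measurable_fun setT k -> (forall x, 0 <= k x <= M%:E) ->
    exists k' : R -> R, [/\ measurable_fun setT k', (forall x, 0 <= k' x <= M)%R & k = EFin \o k'].
  move=> mk kM; have kE x : (fine (k x))%:E = k x.
    have /andP[k0 k1] := kM x; rewrite fineK// ge0_fin_numE//.
    by rewrite (le_lt_trans k1)// ltry.
  exists (fine \o k); split; first exact: measurableT_comp.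
    by move=> x; rewrite -!lee_fin /= kE.
  by apply/funext => x /=; rewrite kE.
have [f' [mf' f'M fE]] := rep f mf fM.
have [g' [mg' g'M gE]] := rep g mg gM.
have c0 : 0 <= \int[mu]_x h x by exact: integral_ge0T.
have sup_or_0 (k : R -> R) : (forall x, 0 <= k x <= M)%R ->
    (exists a, [/\ 0 < a, forall x, k x <= a & forall r, r < a -> exists x, r < k x]%R) \/
    (forall x, k x = 0%R).
  move=> kM; have hs : has_sup (range k).
    by split; [exists (k 0%R), 0%R|exists M => _ [x _ <-]; case/andP: (kM x)].
  have ub x : (k x <= sup (range k))%R by apply: ub_le_sup; [case: hs|exists x].
  have [a0|a0] := ltP 0%R (sup (range k)); [left|right].
    exists (sup (range k)); split => // r ra.
    by have [_ [x _ <-] rx] := sup_gt (proj1 hs) ra; exists x.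
  move=> x; apply/eqP; rewrite eq_le (le_trans (ub x))//=.
  by case/andP: (kM x).
have [[a [a0 fa asup]]|f'0] := sup_or_0 f' f'M; last first.
  rewrite [X in X * _](_ : _ = 0) ?mul0e ?mule_ge0//.
  by apply: integral0_eq => x _; rewrite fE /= f'0.
have [[b [b0 gb bsup]]|g'0] := sup_or_0 g' g'M; last first.
  rewrite [X in _ * X](_ : _ = 0) ?mule0 ?mule_ge0//.
  by apply: integral0_eq => x _; rewrite gE /= g'0.
have [hoo|hfin] := eqVneq (\int[mu]_x h x) +oo.
  by rewrite hoo mulyy leey.
(* Rescaling f, g, h by a = sup f, b = sup g and sqrt (a b) reduces to functions of
   supremum 1, for which the midpoint inequality is additive. *)
pose c := Num.sqrt (a * b)%R.
have cc : (c ^+ 2 = a * b)%R by rewrite sqr_sqrtr// mulr_ge0// ltW.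
have c_gt0 : (0 < c)%R by rewrite sqrtr_gt0 mulr_gt0.
(* [h] may be unbounded; cutting it at c preserves the hypothesis because f g <= a b = c^2. *)
pose h' x := (fine (mine (h x) c%:E) / c)%R.
have mineE x : (fine (mine (h x) c%:E))%:E = mine (h x) c%:E.
  rewrite fineK// ge0_fin_numE ?le_min ?h0 ?lee_fin ?(ltW c_gt0)//.
  by rewrite gt_min ltry orbT.
have main : \int[mu]_x (f' x / a)%:E + \int[mu]_x (g' x / b)%:E <= 2%:E * \int[mu]_x (h' x)%:E.
  apply: prekopa_leindler_normalized.
  - exact: measurable_funM.
  - exact: measurable_funM.
  - apply: measurable_funM => //; apply: measurableT_comp => //.
    exact: measurable_mine.
  - move=> x; rewrite divr_ge0 ?(ltW a0)//=; last by case/andP: (f'M x).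
    by rewrite ler_pdivrMr// mul1r.
  - move=> x; rewrite divr_ge0 ?(ltW b0)//=; last by case/andP: (g'M x).
    by rewrite ler_pdivrMr// mul1r.
  - move=> x; rewrite divr_ge0 ?(ltW c_gt0)//=.
      by rewrite ler_pdivrMr// mul1r -lee_fin mineE ge_min lexx orbT.
    by rewrite -lee_fin mineE le_min h0 lee_fin ltW.
  - move=> r r1; have [|x rx] := asup (r * a)%R; first by rewrite gtr_pMl.
    by exists x; rewrite ltr_pdivlMr.
  - move=> r r1; have [|x rx] := bsup (r * b)%R; first by rewrite gtr_pMl.
    by exists x; rewrite ltr_pdivlMr.
  move=> x y; rewrite mulf_div -cc expr_div_n ler_pM2r ?invr_gt0 ?exprn_gt0//.
  rewrite -lee_fin expr2 [leRHS]EFinM mineE.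
  have fg0 : (0 <= f' x * g' y)%R.
    by apply: mulr_ge0; [case/andP: (f'M x)|case/andP: (g'M y)].
  case: (leP (h (2^-1 * (x + y))%R) c%:E) => hc.
    by have := fgh x y; rewrite fE gE /= EFinM.
  rewrite -EFinM lee_fin -expr2 cc; apply: ler_pM => //.
    by case/andP: (f'M x).
  by case/andP: (g'M y).
have scale (k : R -> R) (s : R) : measurable_fun setT k -> (0 < s)%R -> (forall x, 0 <= k x)%R ->
    \int[mu]_x (k x / s)%:E = (s^-1)%:E * \int[mu]_x (k x)%:E.
  move=> mk s0 k0; rewrite -ge0_integralZl//.
  - by apply: eq_integral => x _; rewrite -EFinM mulrC.
  - exact/measurable_EFinP.
  - by move=> x _; rewrite lee_fin.
  - by rewrite lee_fin invr_ge0 ltW.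
have f'0 x : (0 <= f' x)%R by case/andP: (f'M x).
have g'0 x : (0 <= g' x)%R by case/andP: (g'M x).
have {main} : (a^-1)%:E * \int[mu]_x f x + (b^-1)%:E * \int[mu]_x g x <=
    2%:E * ((c^-1)%:E * \int[mu]_x h x).
  rewrite fE gE -!scale//; apply: le_trans main _.
  apply: lee_wpmul2l => //; rewrite -ge0_integralZl//; last first.
    by rewrite lee_fin invr_ge0 ltW.
  apply: ge0_le_integral => //.
  - move=> x _; rewrite lee_fin divr_ge0 ?(ltW c_gt0)//.
    by rewrite -lee_fin mineE le_min h0 lee_fin ltW.
  - apply/measurable_EFinP; apply: measurable_funM => //; apply: measurableT_comp => //.
    exact: measurable_mine.
  - exact: measurable_funeM.
  move=> x _; rewrite /h' EFinM mineE muleC; apply: lee_wpmul2l.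
    by rewrite lee_fin invr_ge0 ltW.
  by rewrite ge_min lexx.
have f0 : 0 <= \int[mu]_x f x by apply: integral_ge0T => x; case/andP: (fM x).
have g0 : 0 <= \int[mu]_x g x by apply: integral_ge0T => x; case/andP: (gM x).
have hr : \int[mu]_x h x = (fine (\int[mu]_x h x))%:E by rewrite fineK// ge0_fin_numE// ltey.
rewrite hr; set C := fine _ => key.
have fr : \int[mu]_x f x \is a fin_num.
  rewrite ge0_fin_numE// ltey; apply/eqP => foo; move: key; rewrite foo.
  rewrite gt0_muley ?lte_fin ?invr_gt0// addye//.
  by rewrite gt_eqF// (@lt_le_trans _ _ 0)// mule_ge0// lee_fin invr_ge0 ltW.
have gr : \int[mu]_x g x \is a fin_num.
  rewrite ge0_fin_numE// ltey; apply/eqP => goo; move: key; rewrite goo.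
  rewrite [(b^-1)%:E * _]gt0_muley ?lte_fin ?invr_gt0// addey//.
  by rewrite gt_eqF// (@lt_le_trans _ _ 0)// mule_ge0// lee_fin invr_ge0 ltW.
move: key f0 g0; rewrite -(fineK fr) -(fineK gr) -!EFinM -EFinD !lee_fin.
set A := fine _; set B := fine _ => key A0 B0.
have C0 : (0 <= C)%R by rewrite -lee_fin -hr.
(* The additive inequality X + Y <= 2 Z gives X Y <= Z^2 by the arithmetic-geometric mean; the
   factors a b and c^2 then cancel. *)
have ineq : ((a^-1 * A) * (b^-1 * B) <= (c^-1 * C) ^+ 2)%R.
  have X0 : (0 <= a^-1 * A)%R by rewrite mulr_ge0// invr_ge0 ltW.
  have Y0 : (0 <= b^-1 * B)%R by rewrite mulr_ge0// invr_ge0 ltW.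
  have Z0 : (0 <= c^-1 * C)%R by rewrite mulr_ge0// invr_ge0 ltW.
  move: X0 Y0 Z0 key; set X := (a^-1 * A)%R; set Y := (b^-1 * B)%R; set Z := (c^-1 * C)%R.
  move=> X0 Y0 Z0 XYZ; have := sqr_ge0 (X - Y)%R.
  have : ((X + Y) ^+ 2 <= (2 * Z) ^+ 2)%R by rewrite ler_pXn2r// nnegrE; lra.
  by rewrite !expr2; lra.
by move: ineq; rewrite mulrACA -invfM -cc exprMn exprVn ler_pM2l ?invr_gt0 ?exprn_gt0.
Qed.

(** The product of extended reals is discontinuous only at 0 times infinity, so vanishing factors
    are treated apart. *)
Lemma le_cvg_mul (u : (\bar R)^nat) (l k c : \bar R) : 0 <= c ->
  (forall n, u n * k <= c) -> u @ \oo --> l -> l * k <= c.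
Proof.
move=> c0 uk ul; have [->|l0] := eqVneq l 0; first by rewrite mul0e.
have [->|k0] := eqVneq k 0; first by rewrite mule0.
have : (u \* cst k) @ \oo --> l * k.
  apply: cvgeM => //; last exact: cvg_cst.
  by rewrite mule_defE (negbTE l0) (negbTE k0).
by move=> h; apply: (cvge_le _ h); apply: nearW => n; exact: uk.
Qed.

Lemma cvg_integral_mine d (T : measurableType d) (m : {measure set T -> \bar R}) (f : T -> \bar R) :
  measurable_fun setT f -> (forall x, 0 <= f x) ->
  (fun n => \int[m]_x (mine (f x) (n%:R)%:E)) @ \oo --> \int[m]_x f x.
Proof.
move=> mf f0.
have fE x : (fun n => mine (f x) (n%:R)%:E) @ \oo --> f x.
  case: (f x) (f0 x) => [r| |] // _.
    apply: cvg_near_cst; near=> n.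
    apply/min_idPl; rewrite lee_fin; near: n; exact: nbhs_infty_ger.
  rewrite (_ : (fun n => _) = (fun n => n%:R%:E)); last first.
    by apply/funext => n; apply/min_idPr; rewrite leey.
  exact/cvgeryP/cvgr_idn.
rewrite (_ : \int[m]_x f x = \int[m]_x limn (fun n => mine (f x) (n%:R)%:E)); last first.
  by apply: eq_integral => x _; apply/esym/cvg_lim.
apply: (@cvg_monotone_convergence _ _ _ _ _ measurableT (fun n x => mine (f x) (n%:R)%:E)) => //.
- move=> n; exact: measurable_mine.
- by move=> n x _; rewrite le_min f0 lee_fin ler0n.
- move=> x _ p q pq; rewrite le_min !ge_min lexx/= lee_fin ler_nat pq orbT.
Unshelve. all: by end_near.
Qed.

(** Truncation of [f] and [g] at levels n and m, removed one after the other by monotone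
    convergence. *)
Lemma prekopa_leindler1 (f g h : R -> \bar R) :
  measurable_fun setT f -> measurable_fun setT g -> measurable_fun setT h ->
  (forall x, 0 <= f x) -> (forall x, 0 <= g x) -> (forall x, 0 <= h x) ->
  (forall x y, f x * g y <= h (2^-1 * (x + y))%R * h (2^-1 * (x + y))%R) ->
  \int[mu]_x f x * \int[mu]_x g x <= \int[mu]_x h x * \int[mu]_x h x.
Proof.
move=> mf mg mh f0 g0 h0 fgh.
have c0 : 0 <= \int[mu]_x h x by exact: integral_ge0T.
apply: (le_cvg_mul _ _ (@cvg_integral_mine _ (measurableTypeR R) mu f mf f0)) => [|n]; first exact: mule_ge0.
rewrite muleC; apply: (le_cvg_mul _ _ (@cvg_integral_mine _ (measurableTypeR R) mu g mg g0)) => [|m]; first exact: mule_ge0.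
rewrite muleC; apply: (@prekopa_leindler_bounded (Num.max n%:R m%:R)) => //.
- exact: measurable_mine.
- exact: measurable_mine.
- by move=> x; rewrite le_min f0 lee_fin ler0n/= ge_min !lee_fin le_max lexx orbT.
- by move=> x; rewrite le_min g0 lee_fin ler0n/= ge_min !lee_fin le_max lexx !orbT.
move=> x y; apply: le_trans (fgh x y); apply: lee_pmul.
- by rewrite le_min f0 lee_fin ler0n.
- by rewrite le_min g0 lee_fin ler0n.
- by rewrite ge_min lexx.
- by rewrite ge_min lexx.
Qed.

Lemma eq_rV n (u v : 'rV[R]_n) : (forall i, u ord0 i = v ord0 i) -> u = v.
Proof. by move=> uv; apply/rowP => i; exact: uv. Qed.

Lemma rV_cons_midpoint n (s t : R) (u v : 'rV[R]_n) :
  rV_cons ((2^-1 * (s + t))%R : measurableTypeR R, (2^-1 *: (u + v))%R : 'rV[R]_n) =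
  (2^-1 *: (rV_cons (s, u) + rV_cons (t, v)))%R.
Proof.
apply: eq_rV => i; rewrite [RHS]mxE [X in _ = (_ * X)%R]mxE.
case: (unliftP ord0 i) => [k|] ->; last by rewrite !rV_cons0.
by rewrite !rV_consS /= !mxE.
Qed.

(** Induction on the dimension: for fixed leading coordinates s and t the slices satisfy the
    hypothesis in dimension n, so the partial integrals satisfy it on the line. In dimension 0 the
    measure is a Dirac mass. *)
Lemma prekopa_leindler n (f g h : 'rV[R]_n -> \bar R) :
  measurable_fun setT f -> measurable_fun setT g -> measurable_fun setT h ->
  (forall x, 0 <= f x) -> (forall x, 0 <= g x) -> (forall x, 0 <= h x) ->
  (forall x y, f x * g y <= h (2^-1 *: (x + y))%R * h (2^-1 *: (x + y))%R) ->
  \int[lebesgue_rV R n]_x f x * \int[lebesgue_rV R n]_x g x <=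
  \int[lebesgue_rV R n]_x h x * \int[lebesgue_rV R n]_x h x.
Proof.
elim: n f g h => [|n IH] f g h mf mg mh f0 g0 h0 fgh.
  have dirac0 (k : 'rV[R]_0 -> \bar R) : measurable_fun setT k ->
      \int[lebesgue_rV R 0]_x k x = k 0%R.
    move=> mk; transitivity (\int[\d_(0%R : 'rV[R]_0)]_x k x).
      exact: eq_measure_integral.
    by rewrite integral_dirac// diracT mul1e.
  by rewrite !dirac0//; have := fgh 0%R 0%R; rewrite !thinmx0.
rewrite !integral_rVS//; apply: prekopa_leindler1.
- exact: measurable_integral_rV_cons.
- exact: measurable_integral_rV_cons.
- exact: measurable_integral_rV_cons.
- by move=> x; exact: integral_ge0T.
- by move=> x; exact: integral_ge0T.
- by move=> x; exact: integral_ge0T.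
move=> s t; apply: IH => //; try exact: measurable_rV_cons2.
move=> u v.
by have := fgh (rV_cons (s, u)) (rV_cons (t, v)); rewrite -rV_cons_midpoint.
Qed.
End prekopa_leindler_general.

(** * One-dimensional isotropic log-concave variables *)

Section integral_tools.
Context d (T : measurableType d) (R : realType).
Variable nu : {measure set T -> \bar R}.
Local Open Scope ereal_scope.

Lemma markov_ge0 (g : T -> \bar R) (a : \bar R) : measurable_fun setT g ->
  (forall t, 0 <= g t) -> 0 <= a ->
  a * nu [set t | a <= g t] <= \int[nu]_t g t.
Proof.
move=> mg g0 a0.
have mA : measurable [set t | a <= g t].
  by have := emeasurable_fun_c_infty measurableT mg a; rewrite setTI.
rewrite -[X in nu X]setTI -integral_cst ?setTI//.
apply: (@le_trans _ _ (\int[nu]_(t in [set t | a <= g t]) g t)).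
  by apply: ge0_le_integral => //; exact: measurable_funTS.
exact: ge0_subset_integral.
Qed.

(** Layer estimate shared by the exponential moment and the moment of order -1/2: the weights [c k]
    dominate [g] on layers [A k] whose measures are known only through the bounds [b k]. *)
Lemma integral_le_series (g : T -> \bar R) (c b : nat -> R) (A : nat -> set T) (S : R) :
  measurable_fun setT g -> (forall t, 0 <= g t) ->
  (forall k, 0 <= c k)%R -> (forall k, measurable (A k)) ->
  (forall k, nu (A k) <= (b k)%:E) ->
  (forall N, \sum_(0 <= k < N) c k * b k <= S)%R ->
  (forall t, g t <= \sum_(0 <= k <oo) (c k * \1_(A k) t)%:E) ->
  \int[nu]_t g t <= S%:E.
Proof.
move=> mg g0 c0 mA Ab cbS gle.
have mf k : measurable_fun setT (fun t => (c k * \1_(A k) t)%:E).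
  by apply/measurable_EFinP; apply: measurable_funM => //; exact: measurable_indic.
have f0 k t : setT t -> 0 <= (c k * \1_(A k) t)%:E by rewrite lee_fin mulr_ge0.
apply: (@le_trans _ _ (\int[nu]_t \sum_(0 <= k <oo) (c k * \1_(A k) t)%:E)).
  apply: ge0_le_integral => //.
  by apply: ge0_emeasurable_sum => // k t _ _; exact: f0.
rewrite integral_nneseries//; apply: lime_le.
  by apply: is_cvg_nneseries => k _ _; apply: integral_ge0 => t; exact: f0.
apply: nearW => N; apply: (@le_trans _ _ (\sum_(0 <= k < N) (c k * b k)%:E)).
  apply: lee_sum => k _; under eq_integral => t _ do rewrite EFinM.
  rewrite ge0_integralZl_EFin//; last by apply/measurable_EFinP; exact: measurable_indic.
  by rewrite integral_indic// setIT EFinM lee_wpmul2l// lee_fin.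
by rewrite sumEFin lee_fin.
Qed.

Lemma term_le_series (c : nat -> R) (A : nat -> set T) t N : (forall k, 0 <= c k)%R ->
  A N t -> (c N)%:E <= \sum_(0 <= k <oo) (c k * \1_(A k) t)%:E.
Proof.
move=> c0 At; apply: le_trans (nneseries_lim_ge N.+1 _); last first.
  by move=> k _ _; rewrite lee_fin mulr_ge0.
rewrite big_nat_recr//= indicE mem_set// mulr1 leeDr//.
by apply: sume_ge0 => k _; rewrite lee_fin mulr_ge0.
Qed.

End integral_tools.

(** * Log-concave sequences *)

Section log_concave_sequences.
Context {R : realType}.

(** Log-concavity makes the ratios a (k+1) / a k non-increasing, so the initial ratio bounds them
    all; monotonicity covers the indices where the sequence has reached 0. *)
Lemma log_concave_geometric_decay (a : nat -> R) (q : R) : 0 <= q ->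
  (forall k, 0 <= a k) -> (forall k, a k.+1 <= a k) ->
  (forall k, a k * a k.+2 <= a k.+1 ^+ 2) ->
  a 1%N <= q * a 0%N -> forall k, a k <= q ^+ k * a 0%N.
Proof.
move=> q0 a0 dec lc a1.
have step k : a k.+1 <= q * a k.
  elim: k => // k IH; have [ak0|ak0] := eqVneq (a k.+1) 0.
    by rewrite ak0 mulr0 -ak0 dec.
  have akp : 0 < a k.+1 by rewrite lt_neqAle eq_sym ak0 a0.
  rewrite -(ler_pM2l akp); have := ler_wpM2r (a0 k.+2) IH; have := lc k; nra.
elim=> [|k IH]; first by rewrite expr0 mul1r.
by rewrite exprS -mulrA (le_trans (step k))// ler_wpM2l.
Qed.

(* Bernoulli: 1 + k u <= (1 + u)^k <= (1 - u)^(-k), with 1 - u = a 1 / a 0. *)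
Lemma log_concave_first_gap (a : nat -> R) (k : nat) :
  0 < a 0%N -> (forall j, 0 <= a j) -> (forall j, a j.+1 <= a j) ->
  (forall j, a j * a j.+2 <= a j.+1 ^+ 2) -> a 0%N <= 1 ->
  k%:R * (a 0%N - a 1%N) * a k <= 1.
Proof.
move=> a0 ap dec lc a01.
pose r := a 1%N / a 0%N.
have r0 : 0 <= r by rewrite divr_ge0.
have r1 : r <= 1 by rewrite ler_pdivrMr// mul1r.
have ak : a k <= r ^+ k * a 0%N.
  apply: log_concave_geometric_decay => //.
  by rewrite divfK// gt_eqF.
have rk : k%:R * (1 - r) * r ^+ k <= 1.
  have h1 : 1 + k%:R * (1 - r) <= (1 + (1 - r)) ^+ k.
    elim: k {ak} => [|k IH]; first by rewrite mul0r expr0 addr0.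
    rewrite exprS; apply: le_trans (ler_wpM2l _ IH); last by lra.
    have : 0 <= k%:R * (1 - r) ^+ 2 :> R by rewrite mulr_ge0// sqr_ge0.
    by rewrite -natr1; nra.
  have h2 : (1 + (1 - r)) ^+ k * r ^+ k <= 1.
    by rewrite -exprMn; apply: exprn_ile1; nra.
  by have := ler_wpM2r (exprn_ge0 k r0) h1; have := exprn_ge0 k r0; nra.
have gap : a 0%N - a 1%N = a 0%N * (1 - r) by rewrite mulrBr mulr1 /r mulrCA divff ?mulr1// gt_eqF.
have X0 : 0 <= k%:R * (1 - r) by rewrite mulr_ge0// subr_ge0.
apply: (@le_trans _ _ (k%:R * (a 0%N * (1 - r)) * (r ^+ k * a 0%N))).
  by rewrite gap ler_wpM2l// mulrCA mulr_ge0// ltW.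
rewrite (_ : _ * _ = (k%:R * (1 - r) * r ^+ k) * (a 0%N * a 0%N)); last by ring.
apply: le_trans (_ : 1 * 1 <= _); last by rewrite mulr1.
move: a0 a01; set x := a 0%N => a0 a01.
by apply: ler_pM => //; [rewrite mulr_ge0// exprn_ge0|rewrite mulr_ge0// ltW|nra].
Qed.
End log_concave_sequences.

Lemma integral_probability_cst d (T : measurableType d) (R : realType) (nu : probability T R) (c : R) :
  (\int[nu]_t c%:E = c%:E)%E.
Proof.
rewrite (integral_cst nu measurableT).
rewrite -[RHS]mule1; congr (_ * _)%E; exact: probability_setT.
Qed.

(** The midpoint form suffices, since tails are only compared along arithmetic progressions. *)
Definition log_concave_tails d (T : measurableType d) (R : realType)
    (nu : probability T R) (Y : T -> R) :=
  forall x y, (nu [set t | x <= Y t]%R * nu [set t | y <= Y t]%R <=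
    nu [set t | 2^-1 * (x + y) <= Y t]%R * nu [set t | 2^-1 * (x + y) <= Y t]%R)%E.

(** Centering is stated as equality of the means of the positive and negative parts, so that only
    integrals of non-negative functions occur. The tails of both [Y] and [- Y] are included to make
    the notion stable under change of sign. *)
Definition isotropic_marginal d (T : measurableType d) (R : realType)
    (nu : probability T R) (Y : T -> R) (L : R) :=
  [/\ measurable_fun setT Y, 0 < L,
      (\int[nu]_t (Num.max (Y t) 0)%:E = \int[nu]_t (Num.max (- Y t) 0)%:E)%E,
      (\int[nu]_t (Y t ^+ 2)%:E = (L ^+ 2)%:E)%E &
      log_concave_tails nu Y /\ log_concave_tails nu (fun t => - Y t)].

Section isotropic_marginal.
Context d (T : measurableType d) (R : realType) (nu : probability T R).
Implicit Types (Y : T -> R) (L x y : R).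

Lemma isotropic_marginalN Y L :
  isotropic_marginal nu Y L -> isotropic_marginal nu (fun t => - Y t) L.
Proof.
move=> [mY L0 m0 var [lc lcN]]; split => //.
- exact: measurable_funN.
- by under [RHS]eq_integral => t _ do rewrite opprK.
- by under eq_integral => t _ do rewrite sqrrN.
by split => //; rewrite (_ : (fun t => _) = Y)//; apply/funext => t; rewrite opprK.
Qed.

Let tail Y x : R := fine (nu [set t | x <= Y t]).

Lemma measurable_tail Y x : measurable_fun setT Y -> measurable [set t | x <= Y t].
Proof. by move=> mY; exact: measurable_ler_set. Qed.

Lemma tailE Y x : measurable_fun setT Y -> (nu [set t | x <= Y t]%R = (tail Y x)%:E)%E.
Proof. by move=> mY; rewrite fineK// fin_num_measure//; exact: measurable_tail. Qed.

Lemma tail_ge0 Y x : 0 <= tail Y x.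
Proof. by rewrite fine_ge0. Qed.

Lemma tail_le1 Y x : measurable_fun setT Y -> tail Y x <= 1.
Proof.
by move=> mY; rewrite -lee_fin -tailE// probability_le1//; exact: measurable_tail.
Qed.

Lemma le_tail Y x y : measurable_fun setT Y -> x <= y -> tail Y y <= tail Y x.
Proof.
move=> mY xy; rewrite -lee_fin -!tailE//; apply: le_measure; rewrite ?inE//.
- exact: measurable_tail.
- exact: measurable_tail.
by move=> t /= yt; exact: le_trans yt.
Qed.

Lemma tail_log_concave Y L x y : isotropic_marginal nu Y L ->
  tail Y x * tail Y y <= tail Y (2^-1 * (x + y)) ^+ 2.
Proof.
move=> [mY _ _ _ [lc _]]; have := lc x y.
by rewrite !tailE// -!EFinM lee_fin expr2.
Qed.

Lemma tail_chebyshev Y L : isotropic_marginal nu Y L ->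
  tail Y (2 * L) <= 4^-1 /\ 3 / 4 <= tail Y (- (2 * L)).
Proof.
move=> [mY L0 _ var _].
have key : (nu [set t | ((2 * L) ^+ 2)%:E <= (Y t ^+ 2)%:E]%E <= (4^-1)%:E)%E.
  have h : (((2 * L) ^+ 2)%:E * nu [set t | ((2 * L) ^+ 2)%:E <= (Y t ^+ 2)%:E]
      <= (L ^+ 2)%:E)%E.
    rewrite -var; apply: (@markov_ge0 _ _ _ nu (fun t => (Y t ^+ 2)%:E)).
    - by apply/measurable_EFinP; exact: measurable_funX.
    - by move=> t; rewrite lee_fin sqr_ge0.
    - by rewrite lee_fin sqr_ge0.
  rewrite -(@lee_pmul2l _ ((2 * L) ^+ 2)%:E)//; last first.
    by rewrite lte_fin exprn_gt0// mulr_gt0.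
  by apply: le_trans h _; rewrite -EFinM lee_fin; nra.
have mA : measurable [set t | ((2 * L) ^+ 2)%:E <= (Y t ^+ 2)%:E]%E.
  have := emeasurable_fun_c_infty measurableT (f := fun t => (Y t ^+ 2)%:E) _ ((2 * L) ^+ 2)%:E.
  by rewrite setTI; apply; apply/measurable_EFinP; exact: measurable_funX.
split.
  rewrite -lee_fin -tailE//; apply: le_trans key; apply: le_measure; rewrite ?inE//.
    exact: measurable_tail.
  by move=> t /= tY; rewrite lee_fin ler_pXn2r ?nnegrE//; lra.
have : (nu (~` [set t | - (2 * L) <= Y t]%R) <= (4^-1)%:E)%E.
  apply: le_trans key; apply: le_measure; rewrite ?inE//.
    by apply: measurableC; exact: measurable_tail.
  move=> t /= /negP; rewrite -ltNge => tY.
  by rewrite lee_fin -[leRHS]sqrrN ler_pXn2r ?nnegrE//; lra.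
rewrite probability_setC; last exact: measurable_tail.
by rewrite tailE// -EFinB lee_fin; lra.
Qed.

(** By Chebyshev the tail is at least 3/4 at -2L and at most 1/4 at 2L, so along steps of length 4L
    its initial ratio is at most 1/3. *)
Lemma tail_decay Y L k : isotropic_marginal nu Y L ->
  tail Y (- (2 * L) + (4 * L) * k%:R) <= 3^-1 ^+ k.
Proof.
move=> iY; have [mY L0 _ _ _] := iY; have [h1 h2] := tail_chebyshev iY.
pose a k := tail Y (- (2 * L) + (4 * L) * k%:R).
apply: le_trans (_ : 3^-1 ^+ k * a 0%N <= _); last first.
  by rewrite ler_piMr// ?exprn_ge0// tail_le1.
apply: log_concave_geometric_decay => //.
- by move=> j; exact: tail_ge0.
- by move=> j; apply: le_tail => //; rewrite lerD2l ler_pM2l ?ler_nat//; lra.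
- move=> j; apply: le_trans (tail_log_concave _ _ iY) _.
  rewrite (_ : 2^-1 * _ = - (2 * L) + 4 * L * j.+1%:R)// -!natr1; by field.
rewrite /a mulr0 addr0 mulr1 (_ : - (2 * L) + 4 * L = 2 * L); last by ring.
by lra.
Qed.

Lemma measure_tail_decay Y L k : isotropic_marginal nu Y L ->
  (nu [set t | - (2 * L) + (4 * L) * k%:R <= Y t]%R <= (3^-1 ^+ k)%:E)%E.
Proof.
by move=> iY; have [mY _ _ _ _] := iY; rewrite tailE// lee_fin; exact: tail_decay.
Qed.

Lemma expR_half_le2 : expR (2^-1 : R) <= 2.
Proof.
have := expR_ge1Dx (- 2^-1 : R); rewrite expRN => h.
have e0 := expR_gt0 (2^-1 : R).
have : 2^-1 <= (expR 2^-1)^-1 :> R by lra.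
by rewrite lef_pV2// posrE.
Qed.

(** Within step j of the progression of [tail_decay], exp (Y / (8L)) is at most e^((j+1)/2) <=
    2^(j+1), against a probability at most 3^(-j). The bound is 1 + 2 (1 + 2/3 + (2/3)^2 + ...) = 7,
    the 1 covering Y < -2L. *)
Lemma exponential_moment Y L : isotropic_marginal nu Y L ->
  (\int[nu]_t (expR (Y t / (8 * L)))%:E <= 7%:E)%E.
Proof.
move=> iY; have [mY L0 _ _ _] := iY.
pose c (k : nat) : R := if k is j.+1 then 2 ^+ k else 1.
pose b (k : nat) : R := if k is j.+1 then 3^-1 ^+ j else 1.
pose A (k : nat) : set T := if k is j.+1 then [set t | - (2 * L) + (4 * L) * j%:R <= Y t] else setT.
apply: (@integral_le_series _ _ _ _ _ c b A).
- apply/measurable_EFinP; apply: measurableT_comp => //.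
  exact: measurable_funM.
- by move=> t; rewrite lee_fin expR_ge0.
- by move=> [|k]//=; rewrite exprn_ge0.
- by move=> [|k]//=; exact: measurable_tail.
- move=> [|k] /=; first by rewrite probability_setT.
  exact: measure_tail_decay.
- move=> [|N]; first by rewrite big_nil; lra.
  rewrite big_nat_recl//= mulr1.
  have -> : \sum_(0 <= i < N) 2 ^+ i.+1 * 3^-1 ^+ i = 6 * (1 - (2 / 3) ^+ N) :> R.
    elim: N => [|N IH]; first by rewrite big_nil expr0 subrr mulr0.
    by rewrite big_nat_recr//= IH !exprS !exprMn; lra.
  have : 0 <= (2 / 3) ^+ N :> R by rewrite exprn_ge0// divr_ge0.
  by lra.
move=> t; have c0 k : 0 <= c k by case: k => [|k]//=; rewrite exprn_ge0.
have [Yt|Yt] := ltP (Y t) (- (2 * L)).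
  apply: le_trans (_ : (c 0%N)%:E <= _)%E; last by apply: term_le_series => //.
  rewrite lee_fin /=; apply: le_trans (_ : expR 0 <= _); last by rewrite expR0.
  by rewrite ler_expR ler_pdivrMr; lra.
pose j := Num.truncn ((Y t + 2 * L) / (4 * L)).
have L4 : 0 < 4 * L by lra.
have /andP[j1 j2] : (j%:R <= (Y t + 2 * L) / (4 * L) < j.+1%:R).
  apply: truncn_itv; rewrite divr_ge0 ?(ltW L4)//; lra.
apply: le_trans (_ : (c j.+1)%:E <= _)%E; last first.
  apply: term_le_series => //=.
  by move: j1; rewrite ler_pdivlMr//; lra.
rewrite lee_fin [c _]/(2 ^+ j.+1).
apply: le_trans (_ : expR (j.+1%:R * 2^-1) <= _); last first.
  by rewrite expRM_natl ler_pXn2r ?nnegrE ?expR_ge0// expR_half_le2.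
rewrite ler_expR ler_pdivrMr; last lra.
move: j2; rewrite ltr_pdivrMr//.
by rewrite (_ : j.+1%:R * 2^-1 * (8 * L) = j.+1%:R * (4 * L)); [lra|field].
Qed.
End isotropic_marginal.

(** * Mass away from the origin and small balls of a marginal *)

Section isotropic_marginal_tails.
Context {R : realType}.

(** With s = 2^11 as in [tail_lower_bound], this is 1 / (16 s) and [tail_mass] is 1 / (128 s^2). *)
Definition tail_point : R := (2 ^+ 15)^-1.
Definition tail_mass : R := (2 ^+ 29)^-1.
Definition small_ball_constant : R := 8 / (tail_point * tail_mass).

(** The value +oo at 0 makes a singular determinant count as a small one in Markov's inequality. *)
Definition inv_sqrt (y : R) : \bar R :=
  if y == 0 then +oo%E else ((Num.sqrt `|y|)^-1)%:E.

Lemma tail_point_gt0 : 0 < tail_point. Proof. by rewrite invr_gt0 exprn_gt0. Qed.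

Lemma tail_mass_gt0 : 0 < tail_mass.
Proof. by rewrite invr_gt0 exprn_gt0. Qed.

Context d (T : measurableType d) (nu : probability T R).
Implicit Types (Y : T -> R) (L x y : R).

Lemma exp4_le y : y ^+ 4 <= 24 * (expR y + expR (- y)).
Proof.
wlog y0 : y / 0 <= y => [hw|].
  have [/hw//|y0] := leP 0 y.
  have /hw : 0 <= - y by lra.
  by rewrite opprK addrC exprNn -signr_odd mul1r.
have := expR_ge1Dxn 3 y0; rewrite (_ : (4`!)%N = 24%N)//.
by have := expR_ge0 (- y); lra.
Qed.

(** The bound y^4 <= 24 (e^y + e^(-y)) at y = Y / (8L), with two exponential moments adding up to 7
    + 7 = 14. *)
Lemma fourth_moment Y L : isotropic_marginal nu Y L ->
  (\int[nu]_t (Y t ^+ 4)%:E <= (24 * 14 * 8 ^+ 4 * L ^+ 4)%:E)%E.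
Proof.
move=> iY; have [mY L0 _ _ _] := iY.
have mE (Z : T -> R) : measurable_fun setT Z ->
    measurable_fun setT (fun t => (expR (Z t / (8 * L)))%:E).
  by move=> mZ; apply/measurable_EFinP; apply: measurableT_comp => //; exact: measurable_funM.
have mN : measurable_fun setT (fun t => - Y t) by exact: measurable_funN.
apply: (@le_trans _ _ (\int[nu]_t ((24 * (8 * L) ^+ 4)%:E *
    ((expR (Y t / (8 * L)))%:E + (expR (- Y t / (8 * L)))%:E)))%E).
  apply: ge0_le_integral => //.
  - by move=> t _; rewrite lee_fin exprn_even_ge0.
  - by apply/measurable_EFinP; exact: measurable_funX.
  - by apply: measurable_funeM; apply: emeasurable_funD; exact: mE.
  move=> t _; rewrite -EFinD -EFinM lee_fin -[24 * _]mulrC -mulrA mulNr.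
  apply: le_trans (ler_wpM2l _ (exp4_le _)); last by rewrite exprn_ge0//; lra.
  by rewrite -exprMn mulrC divfK// gt_eqF; lra.
rewrite ge0_integralZl//; last 3 first.
- by apply: emeasurable_funD; exact: mE.
- by move=> t _; rewrite adde_ge0// lee_fin expR_ge0.
- by rewrite lee_fin mulr_ge0// exprn_ge0//; lra.
rewrite ge0_integralD//; [|exact: mE|exact: mE].
have h := leeD (exponential_moment iY) (exponential_moment (isotropic_marginalN iY)).
apply: le_trans (lee_wpmul2l _ h) _; first by rewrite lee_fin mulr_ge0// exprn_ge0//; lra.
by rewrite -EFinD -EFinM lee_fin exprMn; lra.
Qed.

(* E Y = 0 and E Y^4 <= C L^4 force E max(Y, 0) to be comparable to L; for b > 0
   max(y, 0) <= r + b 1_{y >= r} + y^2 / b then bounds P(Y >= r) from below. *)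
Lemma tail_lower_bound Y L : isotropic_marginal nu Y L ->
  (tail_mass%:E <= nu [set t | tail_point * L <= Y t]%R)%E.
Proof.
move=> iY; have [mY L0 mean var _] := iY; have := fourth_moment iY.
set p := nu _; set m4 := (\int[nu]_t (Y t ^+ 4)%:E)%E => hm4.
pose m := (\int[nu]_t (Num.max (Y t) 0)%:E)%E.
(* Chosen with s^2 = 1024 * 8^4, so that the fourth moment term of [h2] is at most (24 * 14 / 1024)
   L^2 and can be absorbed in L^2. *)
pose s : R := 2 ^+ 11; have s0 : 0 < s by rewrite exprn_gt0.
have mmax (Z : T -> R) : measurable_fun setT Z ->
    measurable_fun setT (fun t => (Num.max (Z t) 0)%:E).
  by move=> mZ; apply/measurable_EFinP; exact: measurable_maxr.
have mN : measurable_fun setT (fun t => - Y t) by exact: measurable_funN.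
have mI : measurable [set t | tail_point * L <= Y t] by exact: measurable_tail.
have p1 : (p <= 1)%E by rewrite /p probability_le1.
have p0 : (0 <= p)%E by exact: measure_ge0.
have pE : p = (fine p)%:E by rewrite fineK// ge0_fin_numE// (le_lt_trans p1)// ltry.
have h1 : (m <= (tail_point * L)%:E + ((16 * s * L)%:E * p + ((16 * s * L)^-1)%:E * (L ^+ 2)%:E))%E.
  pose A := [set t | tail_point * L <= Y t].
  (* This [b] makes E Y^2 / b equal to L / (16 s), that is [tail_point * L]. *)
  pose b := 16 * s * L; have b0 : 0 < b by rewrite !mulr_gt0.
  have mA : measurable_fun setT (fun t => (\1_A t)%:E : \bar R).
    by apply/measurable_EFinP; exact: measurable_indic.
  have mY2 : measurable_fun setT (fun t => (Y t ^+ 2)%:E).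
    by apply/measurable_EFinP; exact: measurable_funX.
  have bA0 t : (0 <= b%:E * (\1_A t)%:E)%E by rewrite -EFinM lee_fin mulr_ge0// ltW.
  have bY0 t : (0 <= (b^-1)%:E * (Y t ^+ 2)%:E)%E.
    by rewrite -EFinM lee_fin mulr_ge0// ?sqr_ge0// invr_ge0 ltW.
  have tL : 0 < tail_point * L by rewrite mulr_gt0// tail_point_gt0.
  apply: (@le_trans _ _ (\int[nu]_t ((tail_point * L)%:E +
      (b%:E * (\1_A t)%:E + (b^-1)%:E * (Y t ^+ 2)%:E)))%E).
    apply: ge0_le_integral => //.
    - by move=> t _; rewrite lee_fin le_max lexx orbT.
    - exact: mmax.
    - apply: emeasurable_funD => //; apply: emeasurable_funD; exact: measurable_funeM.
    move=> t _; rewrite -!EFinM -!EFinD lee_fin indicE.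
    have Yb : 0 <= b^-1 * Y t ^+ 2 by rewrite mulr_ge0// ?sqr_ge0// invr_ge0 ltW.
    rewrite ge_max; apply/andP; split; last first.
      by rewrite !addr_ge0// ?(ltW tL)// mulr_ge0// ltW.
    have [tA|tA] := leP (tail_point * L) (Y t); last first.
      by have : 0 <= b * (t \in A)%:R by [rewrite mulr_ge0// ltW]; lra.
    rewrite mem_set// mulr1.
    have [Yb'|Yb'] := leP (Y t) b; first by lra.
    suff : Y t <= b^-1 * Y t ^+ 2 by lra.
    rewrite mulrC ler_pdivlMr// expr2 ler_pM2l; lra.
  rewrite ge0_integralD//; last 3 first.
  - by move=> t _; rewrite lee_fin ltW.
  - by move=> t _; rewrite adde_ge0.
  - by apply: emeasurable_funD; exact: measurable_funeM.
  rewrite integral_probability_cst ge0_integralD//; last 2 first.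
  - exact: measurable_funeM.
  - exact: measurable_funeM.
  rewrite !ge0_integralZl_EFin//.
  - by rewrite integral_indic// setIT var.
  - by move=> t _; rewrite lee_fin sqr_ge0.
  - by rewrite invr_ge0 ltW.
  - exact: ltW.
(* Pointwise y^2 <= s L |y| + y^4 / (s L)^2, by comparing |y| with s L; centering turns E |Y| into m
   + m. *)
have h2 : ((L ^+ 2)%:E <= (s * L)%:E * (m + m) + (((s * L) ^+ 2)^-1)%:E * m4)%E.
  rewrite {2}/m mean -var.
  have sL : 0 < s * L by rewrite mulr_gt0.
  have mY4 : measurable_fun setT (fun t => (Y t ^+ 4)%:E).
    by apply/measurable_EFinP; exact: measurable_funX.
  have Y40 t : 0 <= Y t ^+ 4 by rewrite exprn_even_ge0.
  rewrite -ge0_integralD//; last 4 first.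
  - by move=> t _; rewrite lee_fin le_max lexx orbT.
  - exact: mmax.
  - by move=> t _; rewrite lee_fin le_max lexx orbT.
  - exact: mmax.
  have mD : measurable_fun setT (fun t => ((Num.max (Y t) 0)%:E + (Num.max (- Y t) 0)%:E)%E).
    by apply: emeasurable_funD; exact: mmax.
  have D0 t : (0 <= (Num.max (Y t) 0)%:E + (Num.max (- Y t) 0)%:E)%E.
    by rewrite adde_ge0// lee_fin le_max lexx orbT.
  rewrite -!ge0_integralZl_EFin//; last 2 first.
  - by rewrite invr_ge0 exprn_ge0// ltW.
  - exact: ltW.
  rewrite -ge0_integralD//; last 4 first.
  - by move=> t _; rewrite mule_ge0// lee_fin ltW.
  - exact: measurable_funeM.
  - by move=> t _; rewrite mule_ge0// lee_fin// invr_ge0 exprn_ge0// ltW.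
  - exact: measurable_funeM.
  apply: ge0_le_integral => //.
  - by move=> t _; rewrite lee_fin sqr_ge0.
  - by apply/measurable_EFinP; exact: measurable_funX.
  - by apply: emeasurable_funD; exact: measurable_funeM.
  move=> t _; rewrite -[(_ + (Num.max (- _) _)%:E)%E]EFinD -!EFinM -EFinD lee_fin.
  have -> : Num.max (Y t) 0 + Num.max (- Y t) 0 = `|Y t|.
    have [Yt|Yt] : 0 <= Y t \/ Y t <= 0 by case: (leP 0 (Y t)) => [|/ltW]; [left|right].
      by rewrite (ger0_norm Yt) (max_l Yt) max_r ?addr0//; lra.
    by rewrite (ler0_norm Yt) (max_r Yt) max_l ?add0r//; lra.
  have -> : Y t ^+ 4 = `|Y t| ^+ 4 by rewrite -normrX ger0_norm.
  have -> : Y t ^+ 2 = `|Y t| ^+ 2 by rewrite -normrX ger0_norm// sqr_ge0.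
  move: (normr_ge0 (Y t)); set y := `|Y t| => y0.
  have h4 : 0 <= ((s * L) ^+ 2)^-1 * y ^+ 4 by rewrite mulr_ge0 ?exprn_ge0// invr_ge0 exprn_ge0// ltW.
  have [ysL|ysL] := leP y (s * L); first by rewrite expr2; nra.
  suff : y ^+ 2 <= ((s * L) ^+ 2)^-1 * y ^+ 4.
    by have : 0 <= s * L * y by [rewrite mulr_ge0// ltW]; lra.
  rewrite mulrC ler_pdivlMr ?exprn_gt0// (_ : y ^+ 4 = y ^+ 2 * y ^+ 2); last by ring.
  by rewrite ler_wpM2l ?sqr_ge0// ler_pXn2r// ?nnegrE ?ltW.
  by move=> t _; rewrite lee_fin.
have m0 : (0 <= m)%E by apply: integral_ge0 => t _; rewrite lee_fin le_max lexx orbT.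
have mE : m = (fine m)%:E.
  rewrite fineK// ge0_fin_numE// (le_lt_trans h1)// pE -!EFinM -!EFinD ltry//.
move: h1; rewrite mE pE -!EFinM -!EFinD !lee_fin => h1.
have {}h2 : L ^+ 2 <= s * L * (fine m + fine m) + ((s * L) ^+ 2)^-1 * (24 * 14 * 8 ^+ 4 * L ^+ 4).
  rewrite -lee_fin; apply: le_trans h2 _; rewrite mE -!EFinD -!EFinM EFinD.
  by rewrite leeD2l// EFinM; apply: lee_wpmul2l => //; rewrite lee_fin invr_ge0 exprn_ge0// mulr_ge0// ltW.
move: h1 h2; set M := fine m; set q := fine p => h1 h2.
have L2 : 0 < L ^+ 2 by rewrite exprn_gt0.
have s16 : 0 < 16 * s by rewrite mulr_gt0.
have tpE : tail_point = (16 * s)^-1.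
  by rewrite /tail_point /s; congr (_^-1); rewrite (_ : 16 = 2 ^+ 4) -?exprD//; ring.
have tmE : tail_mass = (128 * s ^+ 2)^-1.
  by rewrite /tail_mass /s; congr (_^-1); rewrite (_ : 128 = 2 ^+ 7) -?exprM -?exprD//; ring.
have sE : s ^+ 2 = 1024 * 8 ^+ 4.
  rewrite /s (_ : 1024 = 2 ^+ 10); last by ring.
  by rewrite (_ : 8 = 2 ^+ 3) -?exprM -?exprD//; ring.
have h3 : L <= 4 * s * M.
  have e : ((s * L) ^+ 2)^-1 * (24 * 14 * 8 ^+ 4 * L ^+ 4) = (24 * 14 / 1024) * L ^+ 2.
    by rewrite exprMn sE; field; rewrite gt_eqF.
  rewrite -(ler_pM2l L0); move: h2; rewrite e expr2; lra.
have {}h1 : M <= 2 * ((16 * s)^-1 * L) + 16 * s * L * q.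
  move: h1; rewrite tpE (_ : (16 * s * L)^-1 * L ^+ 2 = (16 * s)^-1 * L); first lra.
  by field; rewrite !gt_eqF.
have h4 : L <= 4 * s * (2 * ((16 * s)^-1 * L) + 16 * s * L * q).
  by apply: le_trans h3 _; rewrite ler_pM2l// mulr_gt0.
have {}h4 : L * 1 <= L * (128 * s ^+ 2 * q).
  rewrite mulr1; move: h4.
  rewrite (_ : 4 * s * _ = 2^-1 * L + 2^-1 * (L * (128 * s ^+ 2 * q))); first lra.
  by field; rewrite gt_eqF.
rewrite ler_pM2l// in h4.
rewrite tmE -[_^-1]mul1r ler_pdivrMr ?mulr_gt0 ?exprn_gt0//.
by rewrite mulrC.
Qed.

(** In steps of 4t from -2t, a number of steps of order L / t fits below [tail_point * L], where the
    tail is still at least [tail_mass]. [log_concave_first_gap] bounds the initial drop, which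
    contains the mass of [-t, t]. For t beyond [tail_point * L / 4] the right-hand side is at least
    1. *)
Lemma small_ball Y L t : isotropic_marginal nu Y L -> 0 < t ->
  (nu [set w | `|Y w| <= t]%R <= (small_ball_constant * (t / L))%:E)%E.
Proof.
move=> iY t0; have [mY L0 _ _ _] := iY.
have tp0 := tail_point_gt0; have tm0 := tail_mass_gt0.
have nuE (A : set T) : measurable A -> (nu A = (fine (nu A))%:E)%E.
  by move=> mA; rewrite fineK// fin_num_measure.
pose F x := fine (nu [set w | x <= Y w]).
have FE x : (nu [set w | x <= Y w]%R = (F x)%:E)%E by rewrite nuE//; exact: measurable_tail.
have F1 x : F x <= 1 := tail_le1 nu x mY.
have mass : tail_mass <= F (tail_point * L) by rewrite -lee_fin -FE; exact: tail_lower_bound.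
(* A drop of the tail is the mass of a half-open interval; the interval from -2t included to 2t
   excluded contains the closed interval [-t, t]. *)
have sub : (nu [set w | `|Y w| <= t]%R <= (F (- (2 * t)) - F (2 * t))%:E)%E.
  have mt : measurable [set w | `|Y w| <= t]%R.
    by apply: measurable_ler_set => //; exact: measurableT_comp.
  rewrite (nuE _ mt) lee_fin lerBrDr -lee_fin EFinD -(nuE _ mt) -!FE -measureU//; last 2 first.
  - exact: measurable_tail.
  - apply/seteqP; split => // w /= [Yw Yw2]; have := ler_norm (Y w); lra.
  apply: le_measure; rewrite ?inE//.
  - by apply: measurableU => //; exact: measurable_tail.
  - exact: measurable_tail.
  move=> w /= [Yw|Yw]; last by lra.
  by have := ler_norm (- Y w); rewrite normrN; lra.
apply: le_trans sub _; rewrite lee_fin.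
have mass1 : tail_mass <= 1 by exact: le_trans mass _.
have [tL|tL] := leP t (tail_point * L / 4); last first.
  apply: le_trans (_ : 1 <= _).
    by rewrite lerBlDr (le_trans (F1 _))// lerDl tail_ge0.
  rewrite /small_ball_constant mulf_div ler_pdivlMr ?mulr_gt0// mul1r.
  have : tail_point * tail_mass * L <= tail_point * 1 * L by rewrite ler_pM2r// ler_pM2l.
  lra.
pose k := Num.truncn ((tail_point * L + 2 * t) / (4 * t)).
have t4 : 0 < 4 * t by lra.
have tpL : 0 < tail_point * L by rewrite mulr_gt0.
have /andP[k1 k2] : (k%:R <= (tail_point * L + 2 * t) / (4 * t) < k.+1%:R).
  by apply: truncn_itv; rewrite divr_ge0 ?(ltW t4)//; lra.
move: k1 k2; rewrite ler_pdivlMr// ltr_pdivrMr// -natr1 => k1 k2.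
pose a j := F (- (2 * t) + 4 * t * j%:R).
have am j : F (tail_point * L) <= a j \/ (k < j)%N.
  case: (leqP j k) => [jk|]; [left|by right].
  apply: le_tail => //; have : j%:R <= k%:R :> R by rewrite ler_nat.
  by move=> jk'; have := ler_wpM2l (ltW t4) jk'; lra.
have gap := @log_concave_first_gap _ a k.
have {}gap : k%:R * (a 0%N - a 1%N) * a k <= 1.
  apply: gap.
  - by case: (am 0%N) => // /(lt_le_trans (lt_le_trans tm0 mass)).
  - by move=> j; exact: tail_ge0.
  - by move=> j; apply: le_tail => //; rewrite lerD2l ler_pM2l// ler_nat.
  - move=> j; apply: le_trans (tail_log_concave _ _ iY) _.
    by rewrite (_ : 2^-1 * _ = - (2 * t) + 4 * t * j.+1%:R)// -!natr1; field.
  - exact: F1.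
have ak : tail_mass <= a k by apply: le_trans mass _; case: (am k) => //; rewrite ltnn.
move: gap; rewrite {1 2}/a mulr0 addr0 mulr1 (_ : - (2 * t) + 4 * t = 2 * t); last by ring.
set g := F (- (2 * t)) - F (2 * t) => gap.
have g0 : 0 <= g by rewrite subr_ge0 le_tail//; lra.
rewrite /small_ball_constant mulf_div ler_pdivlMr ?mulr_gt0//.
have h1 : k%:R * g * tail_mass <= 1 by apply: le_trans gap; rewrite ler_wpM2l// mulr_ge0.
(* Half of [tail_point * L] pays for the rounding in [k], whence 8t in place of 4t. *)
have h2 : tail_point * L <= 8 * t * k%:R by lra.
have h3 : tail_point * L * (g * tail_mass) <= 8 * t * k%:R * (g * tail_mass).
  by rewrite ler_wpM2r// mulr_ge0// ltW.
have h4 : 8 * t * (k%:R * g * tail_mass) <= 8 * t * 1 by rewrite ler_pM2l// mulr_gt0.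
lra.
Qed.
End isotropic_marginal_tails.

(** * The moment of order -1/2 of a marginal *)

Section inverse_sqrt_moment.
Context {R : realType}.

Lemma inv_sqrt_ge0 (y : R) : (0 <= inv_sqrt y)%E.
Proof. by rewrite /inv_sqrt; case: ifPn => // _; rewrite lee_fin invr_ge0 sqrtr_ge0. Qed.

Lemma measurable_inv_sqrt : measurable_fun setT (@inv_sqrt R).
Proof.
rewrite (_ : @inv_sqrt R = fun y : R => if y == 0 then +oo%E else (`|y| `^ (- 2^-1))%:E); last first.
  apply/funext => y; rewrite /inv_sqrt; case: ifPn => // y0.
  by rewrite powRN powR12_sqrt.
apply: measurable_fun_if => //; first exact: measurable_fun_eqr.
apply: measurable_funTS; apply/measurable_EFinP.
exact: (measurableT_comp (measurable_powR _)).
Qed.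

Lemma inv_sqrtM (a y : R) : a != 0 -> (inv_sqrt (a * y) = ((Num.sqrt `|a|)^-1)%:E * inv_sqrt y)%E.
Proof.
move=> a0; rewrite /inv_sqrt mulf_eq0 (negbTE a0)/=; case: ifPn => y0.
  by rewrite gt0_muley// lte_fin invr_gt0 sqrtr_gt0 normr_gt0.
by rewrite -EFinM normrM sqrtrM// invfM.
Qed.

(* Convexity enters as the tangent line 1 / z >= (5 - z^4) / 4, that is
   z^5 - 5 z + 4 = (z - 1)^2 (z^3 + 2 z^2 + 3 z + 4) >= 0. *)
Lemma inv_sqrt_jensen m (u : 'I_m.+1 -> R) :
  (inv_sqrt (Num.sqrt (\sum_i u i ^+ 2)) <=
   (((Num.sqrt (Num.sqrt m.+1%:R)) * m.+1%:R)^-1)%:E * \sum_i inv_sqrt (u i))%E.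
Proof.
have m0 : 0 < m.+1%:R :> R by rewrite ltr0n.
have sm0 : 0 < Num.sqrt (Num.sqrt m.+1%:R) :> R by rewrite !sqrtr_gt0.
have [[k uk]|u0] := pselect (exists k, u k = 0).
  have e : inv_sqrt (u k) = +oo%E by rewrite /inv_sqrt uk eqxx.
  rewrite [X in (_ <= _ * X)%E](bigD1 k)//= e addye; last first.
    by rewrite gt_eqF// (@lt_le_trans _ _ 0%E)// sume_ge0// => j _; exact: inv_sqrt_ge0.
  by rewrite gt0_muley ?leey// lte_fin invr_gt0 mulr_gt0.
have {}u0 k : u k != 0 by apply/eqP => uk; apply: u0; exists k.
pose N := \sum_i u i ^+ 2.
have N0 : 0 < N.
  rewrite /N (bigD1 ord0)//= ltr_wpDr//; last by rewrite lt_neqAle eq_sym sqrf_eq0 u0 sqr_ge0.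
  by apply: sumr_ge0 => j _; exact: sqr_ge0.
have sN0 : 0 < Num.sqrt (Num.sqrt N) by rewrite !sqrtr_gt0.
have -> : (\sum_i inv_sqrt (u i) = (\sum_i (Num.sqrt `|u i|)^-1)%:E)%E.
  by rewrite -sumEFin; apply: eq_bigr => k _; rewrite /inv_sqrt (negbTE (u0 k)).
rewrite -/N /inv_sqrt gt_eqF ?sqrtr_gt0// ger0_norm ?sqrtr_ge0// -EFinM lee_fin.
(* q^4 is the mean of the squares [u i ^+ 2], so the normalised values z = sqrt |u i| / q have
   fourth powers of mean 1, and the bounds (5 - z^4) / 4 add up to exactly m + 1. *)
pose q := Num.sqrt (Num.sqrt N) / Num.sqrt (Num.sqrt m.+1%:R).
have q0 : 0 < q by rewrite divr_gt0.
have pow4 (x : R) : 0 <= x -> Num.sqrt (Num.sqrt x) ^+ 4 = x.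
  by move=> x0; rewrite (exprM _ 2 2) !sqr_sqrtr ?sqrtr_ge0.
have q4 : q ^+ 4 = N / m.+1%:R by rewrite expr_div_n !pow4// ltW.
have key : m.+1%:R <= \sum_i q * (Num.sqrt `|u i|)^-1.
  have term i : (5 - u i ^+ 2 / q ^+ 4) / 4 <= q * (Num.sqrt `|u i|)^-1.
    pose z := Num.sqrt `|u i| / q.
    have z0 : 0 < z by rewrite divr_gt0// sqrtr_gt0 normr_gt0.
    have -> : q * (Num.sqrt `|u i|)^-1 = z^-1 by rewrite /z invf_div.
    have -> : u i ^+ 2 / q ^+ 4 = z ^+ 4.
      rewrite /z [RHS]expr_div_n; congr (_ / _).
      by rewrite [RHS](exprM _ 2 2) sqr_sqrtr// -normrX ger0_norm ?sqr_ge0.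
    rewrite -[leRHS]mul1r ler_pdivlMr//.
    have : 0 <= (z - 1) ^+ 2 * (z ^+ 3 + 2 * z ^+ 2 + 3 * z + 4).
      have z3 := exprn_ge0 3 (ltW z0); have z2 := sqr_ge0 z.
      by rewrite mulr_ge0 ?sqr_ge0//; lra.
    by rewrite !exprS expr0; nra.
  apply: le_trans (ler_sum _ (fun i _ => term i)).
  rewrite -mulr_suml sumrB sumr_const card_ord -mulr_suml -/N q4 invf_div mulrA [N * _]mulrC mulfK ?gt_eqF//.
  by rewrite -mulr_natl; lra.
rewrite -mulr_sumr in key.
rewrite mulrC ler_pdivlMr ?mulr_gt0// mulrC ler_pdivrMr//.
move: key; rewrite /q mulrAC ler_pdivlMr// => key.
by rewrite [leLHS]mulrC [leRHS]mulrC.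
Qed.

Definition inv_sqrt_constant : R := 1 + 4 * small_ball_constant.

Context d (T : measurableType d) (nu : probability T R).

(** For |Y| between 4^(-j-1) L and 4^(-j) L the function is at most 2^(j+1) / sqrt L, on an event of
    probability at most C 4^(-j) with C = [small_ball_constant]. The exponent 1/2 < 1 makes the
    series converge, with sum 4 C / sqrt L; the extra 1 in [inv_sqrt_constant] covers |Y| > L. *)
Lemma inv_sqrt_moment (Y : T -> R) (L : R) : isotropic_marginal nu Y L ->
  (\int[nu]_t inv_sqrt (Y t) <= (inv_sqrt_constant / Num.sqrt L)%:E)%E.
Proof.
move=> iY; have [mY L0 _ _ _] := iY.
have sL : 0 < Num.sqrt L by rewrite sqrtr_gt0.
have C0 : 0 <= small_ball_constant :> R.
  by rewrite divr_ge0// mulr_ge0// ltW// ?tail_point_gt0 ?tail_mass_gt0.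
pose c (k : nat) : R := if k is j.+1 then 2 ^+ k / Num.sqrt L else (Num.sqrt L)^-1.
pose b (k : nat) : R := if k is j.+1 then small_ball_constant * 4^-1 ^+ j else 1.
pose A (k : nat) : set T := if k is j.+1 then [set t | `|Y t| <= 4^-1 ^+ j * L] else setT.
have c0 k : 0 <= c k by case: k => [|k] /=; rewrite ?divr_ge0 ?invr_ge0 ?exprn_ge0// ltW.
apply: (@integral_le_series _ _ _ _ _ c b A) => //.
- by apply: measurableT_comp => //; exact: measurable_inv_sqrt.
- by move=> t; exact: inv_sqrt_ge0.
- by move=> [|k]//=; apply: measurable_ler_set => //; exact: measurableT_comp.
- move=> [|k] /=; first by rewrite probability_setT.
  have := @small_ball _ _ _ _ _ _ (4^-1 ^+ k * L) iY; rewrite mulfK ?gt_eqF//; apply.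
  by rewrite mulr_gt0// exprn_gt0.
- move=> [|N]; first by rewrite big_nil divr_ge0 ?(ltW sL)// addr_ge0// mulr_ge0.
  rewrite big_nat_recl//= mulr1.
  have -> : \sum_(0 <= i < N) 2 ^+ i.+1 / Num.sqrt L * (small_ball_constant * 4^-1 ^+ i) =
      (Num.sqrt L)^-1 * (4 * small_ball_constant * (1 - (2^-1) ^+ N)) :> R.
    elim: N => [|N IH]; first by rewrite big_nil expr0 subrr !mulr0.
    rewrite big_nat_recr//= IH !exprS (_ : 4^-1 = 2^-1 * 2^-1); last by field.
    rewrite exprMn (_ : 2 * 2 ^+ N / Num.sqrt L * _ = (Num.sqrt L)^-1 * (2 * small_ball_constant * (2 ^+ N * 2^-1 ^+ N) * 2^-1 ^+ N)); last by ring.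
    by rewrite -exprMn divff// expr1n; field; rewrite gt_eqF.
  rewrite /inv_sqrt_constant -[X in X + _]mulr1 -mulrDr mulrC ler_pM2r ?invr_gt0//.
  have h : 0 <= 2^-1 ^+ N :> R by rewrite exprn_ge0.
  by have := mulr_ge0 C0 h; lra.
move=> t; rewrite /inv_sqrt; case: ifPn => [/eqP Yt|Yt].
  (* At Y = 0 every layer is active, so the dominating series is infinite, as is [inv_sqrt]. *)
  have ct N : ((c N)%:E <= \sum_(0 <= k <oo) (c k * \1_(A k) t)%:E)%E.
    apply: term_le_series => //; case: N => //= k.
    by rewrite Yt normr0 mulr_ge0// ?(ltW L0)// exprn_ge0.
  rewrite leye_eq; apply/eqP/eq_infty => r.
  pose N := (Num.truncn (`|r| * Num.sqrt L)).
  apply: le_trans (ct N.+1); rewrite lee_fin /= ler_pdivlMr//.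
  have h : `|r| * Num.sqrt L < N.+1%:R by rewrite truncnS_gt.
  apply: le_trans (_ : `|r| * Num.sqrt L <= _); first by rewrite ler_pM2r// ler_norm.
  apply: le_trans (ltW h) _; rewrite -natrX ler_nat ltnW//; exact: ltn_expl.
have Yp : 0 < `|Y t| by rewrite normr_gt0.
have [YL|YL] := ltP L `|Y t|.
  apply: le_trans (_ : (c 0%N)%:E <= _)%E; last exact: term_le_series.
  by rewrite lee_fin /= lef_pV2 ?posrE ?sqrtr_gt0// ler_wsqrtr// ltW.
have ex : exists n, 4^-1 ^+ n * L < `|Y t|.
  pose N := (Num.truncn (L / `|Y t|)); exists N.+1.
  rewrite exprVn mulrC ltr_pdivrMr ?exprn_gt0// -ltr_pdivrMl// mulrC.
  have h : L / `|Y t| < N.+1%:R by rewrite truncnS_gt.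
  by apply: lt_le_trans h _; rewrite -natrX ler_nat ltnW//; exact: ltn_expl.
(* The least n with 4^(-n) L < |Y| locates the layer; it is positive because |Y| <= L. *)
case: (ex_minnP ex) => -[|k] hk hmin; first by move: hk; rewrite expr0 mul1r ltNge YL.
apply: le_trans (_ : (c k.+1)%:E <= _)%E; last first.
  by apply: term_le_series => //=; rewrite leNgt; apply/negP => /hmin; rewrite ltnn.
rewrite lee_fin /= -[_ / _]invrK lef_pV2 ?posrE ?sqrtr_gt0 ?invr_gt0 ?divr_gt0 ?exprn_gt0//.
rewrite invfM invrK -[leLHS]ger0_norm; last by rewrite mulr_ge0 ?(ltW sL)// invr_ge0 exprn_ge0.
rewrite -sqrtr_sqr ler_wsqrtr// exprMn sqr_sqrtr ?(ltW L0)//.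
by rewrite exprVn -exprM mulnC exprM (_ : 2 ^+ 2 = 4) -?exprVn ?(ltW hk)//; ring.
Qed.
End inverse_sqrt_moment.

(** * The determinant of independent rows *)

Section independence.
Context d (Omega : measurableType d) (R : realType) (P : probability Omega R).
Local Open Scope ereal_scope.

(** Independence identifies the joint law with the product of the two laws, and Tonelli applies. *)
Lemma integral_independent_pair d1 d2 (T1 : measurableType d1) (T2 : measurableType d2)
    (Z : {RV P >-> T1}) (W : {RV P >-> T2}) (g : T1 * T2 -> \bar R) :
  (forall A B, measurable A -> measurable B ->
    P (Z @^-1` A `&` W @^-1` B) = P (Z @^-1` A) * P (W @^-1` B)) ->
  measurable_fun setT g -> (forall z, 0 <= g z) ->
  \int[P]_w g (Z w, W w) = \int[P]_w \int[distribution P W]_x g (Z w, x).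
Proof.
move=> indep mg g0.
have mZW : measurable_fun setT (fun w => (Z w, W w)) by exact: measurable_fun_pair.
transitivity (\int[image_measure P mZW]_z g z).
  by rewrite (ge0_integral_pushforward mZW).
transitivity (\int[(distribution P Z \x distribution P W)%E]_z g z).
  apply: eq_measure_integral => A mA _; apply/esym.
  by apply: product_measure_unique => // B C mB mC; rewrite [LHS]indep.
rewrite fubini_tonelli1// ge0_integral_distribution//.
  exact: measurable_fun_fubini_tonelli_F.
by move=> y; apply: integral_ge0.
Qed.

Variables (d' : measure_display) (T : measurableType d') (n : nat) (X : 'I_n -> {RV P >-> T}).
Hypothesis indX : independent_RVs X.

(* The family X with its i-th member replaced by a constant, so that all indices
   keep the same type and the result is independent of X i. *)
Let masked (t0 : T) (i : 'I_n) (w : Omega) : n.-tuple T :=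
  [tuple if j == i then t0 else X j w | j < n].

Lemma measurable_masked t0 i : measurable_fun setT (masked t0 i).
Proof.
apply/measurable_fun_tnthP => j; rewrite /masked.
apply: (eq_measurable_fun (fun w => if j == i then t0 else X j w)).
  by move=> w _ /=; rewrite (tnth_mktuple (fun j => if j == i then t0 else X j w)).
by case: (j == i).
Qed.

(** Both sides are finite measures in [A], so boxes, a generating pi-system, suffice. On a box the
    constraint at [i] concerns only the constant [t0]; independence over all indices and over all
    but [i] gives the product formula. *)
Lemma independent_masked t0 i A B : measurable A -> measurable B ->
  P (masked t0 i @^-1` A `&` X i @^-1` B) = P (masked t0 i @^-1` A) * P (X i @^-1` B).
Proof.
move=> mA mB.
have mXB : measurable (X i @^-1` B) by rewrite -[X in measurable X]setTI; exact: measurable_funP.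
pose m1 := image_measure (mrestr P mXB) (measurable_masked t0 i).
pose p := P (X i @^-1` B).
have pE : p = (fine p)%:E by rewrite fineK// fin_num_measure.
have p0 : (0 <= fine p)%R by apply: fine_ge0; exact: measure_ge0.
pose m2 := mscale (NngNum p0) (image_measure P (measurable_masked t0 i)).
suff : m1 A = m2 A.
  by rewrite /m1 /m2 /= /mscale /= /pushforward /mrestr /= -pE muleC.
pose G : set (set (n.-tuple T)) := [set C | exists2 B : 'I_n -> set T,
  forall j, measurable (B j) & C = [set z | forall j, B j (tnth z j)]].
apply: (measure_unique G (fun=> setT)) => //.
- apply/seteqP; split; last first.
    apply: smallest_sub; first exact: sigma_algebra_measurable.
    move=> _ [C mC ->].
    rewrite (_ : [set z | _] = \bigcap_(j in [set: 'I_n]) ((fun z => tnth z j) @^-1` C j)).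
      apply: fin_bigcap_measurable => // j _.
      by rewrite -[X in measurable X]setTI; exact: measurable_tnth.
    by apply/seteqP; split=> [z h j _|z h j]; [exact: h|exact: (h j I)].
  apply: smallest_sub; first exact: smallest_sigma_algebra.
  rewrite -bigcup_seq => _ [j _ [C mC <-]]; apply: sub_sigma_algebra.
  exists (fun k => if k == j then C else setT) => [k|]; first by case: ifPn.
  rewrite setTI; apply/seteqP; split=> z /=.
    by move=> zC k; case: eqVneq => [->|].
  by move=> /(_ j); rewrite eqxx.
- move=> _ _ [B1 mB1 ->] [B2 mB2 ->]; exists (fun j => B1 j `&` B2 j).
    by move=> j; exact: measurableI.
  apply/seteqP; split=> z /=; first by move=> [z1 z2] j; split; [exact: z1|exact: z2].
  by move=> z12; split=> j; case: (z12 j).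
- by move=> _; exists (fun=> setT) => //; apply/seteqP; split.
- by apply/seteqP; split=> z // _; exists 0%N.
- move=> _ [C mC ->].
  have maskE j w : tnth (masked t0 i w) j = if j == i then t0 else X j w.
    by rewrite (tnth_mktuple (fun j => if j == i then t0 else X j w)).
  have preE : masked t0 i @^-1` [set z | forall j, C j (tnth z j)] =
      [set w | C i t0 /\ forall j, j != i -> C j (X j w)].
    apply/seteqP; split=> w /=.
      move=> h; split; first by have := h i; rewrite maskE eqxx.
      by move=> j ji; have := h j; rewrite maskE (negbTE ji).
    by move=> [h1 h2] j; rewrite maskE; case: eqVneq => [->|/h2].
  rewrite /m1 /m2 /= /mscale /= /pushforward /mrestr /= -pE preE.
  have [Ci|nCi] := pselect (C i t0); last first.
    rewrite (_ : [set w | _] = set0) ?set0I ?measure0 ?mule0//.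
    by apply/seteqP; split=> w //= -[].
  (* Placing [B] in the slot freed at [i] expresses both events through one family of sets. *)
  pose C' j := if j == i then B else C j.
  have mC' j : measurable (C' j) by rewrite /C'; case: ifPn.
  have h1 : [set w | C i t0 /\ (forall j, j != i -> C j (X j w))] =
      \bigcap_(j in [set` (~: [set i])%SET]) (X j @^-1` C' j).
    apply/seteqP; split=> w /=.
      by move=> [_ h] j; rewrite /= !inE => ji; rewrite /C' (negbTE ji); exact: h.
    move=> h; split=> // j ji; have := h j; rewrite /= !inE /C' (negbTE ji).
    by apply.
  have h2 : \bigcap_(j in [set` (~: [set i])%SET]) (X j @^-1` C' j) `&` X i @^-1` B =
      \bigcap_(j in [set` [set: 'I_n]%SET]) (X j @^-1` C' j).
    apply/seteqP; split=> w /=.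
      move=> [h hB] j _; have [ji|ji] := eqVneq j i; first by rewrite ji /C' eqxx.
      by have := h j; rewrite /= !inE; apply.
    move=> h; split; first by move=> j _; apply: h; rewrite /= inE.
    by have := h i; rewrite /= /C' eqxx inE; apply.
  rewrite h1 h2 !indX// (bigD1 i) ?inE//= {1}/C' eqxx; congr *%E.
  by apply: eq_bigl => j; rewrite !inE.
- move=> k; rewrite /m1 /= /pushforward /mrestr /= preimage_setT setTI -/p pE ltry//.
Qed.

(** The conditioning step of both the determinant and the sum estimates: X i is integrated out with
    the other vectors frozen. *)
Lemma integral_masked t0 i (g : n.-tuple T * T -> \bar R) :
  measurable_fun setT g -> (forall z, 0 <= g z) ->
  \int[P]_w g (masked t0 i w, X i w) =
  \int[P]_w \int[distribution P (X i)]_x g (masked t0 i w, x).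
Proof.
move=> mg g0.
pose Z : {mfun Omega >-> n.-tuple T} := HB.pack (masked t0 i) (isMeasurableFun.Build _ _ _ _ _ (measurable_masked t0 i)).
apply: (@integral_independent_pair _ _ _ _ Z (X i)) => //.
exact: independent_masked.
Qed.
End independence.

Lemma measurable_det d (T : measurableType d) (R : realType) m (M : T -> 'M[R]_m) :
  (forall i j, measurable_fun setT (fun t => M t i j)) ->
  measurable_fun setT (fun t => \det (M t)).
Proof.
move=> mM; rewrite /determinant; apply: measurable_sum => s.
apply: measurable_funM => //.
by apply: measurable_prod => i _; exact: mM.
Qed.

Section dotp.
Context {R : realType} {n : nat}.
Implicit Types (x y u : 'rV[R]_n).

Lemma dotpC x y : dotp x y = dotp y x.
Proof. by apply: eq_bigr => i _; rewrite mulrC. Qed.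

Lemma dotpZl (a : R) x y : dotp (a *: x) y = a * dotp x y.
Proof. by rewrite /dotp mulr_sumr; apply: eq_bigr => i _; rewrite mxE mulrA. Qed.

Lemma dotpZr (a : R) x y : dotp x (a *: y) = a * dotp x y.
Proof. by rewrite dotpC dotpZl dotpC. Qed.

Lemma dotpDl x y z : dotp (x + y) z = dotp x z + dotp y z.
Proof. by rewrite /dotp -big_split; apply: eq_bigr => i _; rewrite mxE mulrDl. Qed.

Lemma dotpDr x y z : dotp x (y + z) = dotp x y + dotp x z.
Proof. by rewrite dotpC dotpDl !(dotpC x). Qed.

Lemma dotpNl x y : dotp (- x) y = - dotp x y.
Proof. by rewrite -scaleN1r dotpZl mulN1r. Qed.

Lemma dotpNr x y : dotp x (- y) = - dotp x y.
Proof. by rewrite dotpC dotpNl dotpC. Qed.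

Lemma dotp_ge0 x : 0 <= dotp x x.
Proof. by apply: sumr_ge0 => i _; rewrite -expr2 sqr_ge0. Qed.

Lemma dotp_eq0 x : (dotp x x == 0) = (x == 0).
Proof.
apply/idP/eqP => [|->]; last first.
  by rewrite /dotp big1// => i _; rewrite mxE mul0r.
rewrite psumr_eq0; last by move=> i _; rewrite -expr2 sqr_ge0.
move=> /allP x0; apply: eq_rV => i; have := x0 i; rewrite mem_index_enum => /(_ isT) /=.
by rewrite -expr2 sqrf_eq0 mxE => /eqP.
Qed.

Lemma measurable_dotp u : measurable_fun setT (fun x => dotp x u).
Proof.
apply: measurable_sum => i; apply: measurable_funM => //.
exact: measurable_coord_rV.
Qed.

Lemma unit_dotp u : u != 0 -> dotp ((Num.sqrt (dotp u u))^-1 *: u) ((Num.sqrt (dotp u u))^-1 *: u) = 1.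
Proof.
move=> u0; rewrite dotpZl dotpZr mulrA -invfM -expr2 sqr_sqrtr ?dotp_ge0// mulVf//.
by rewrite dotp_eq0.
Qed.
End dotp.

(** * The moment of order -1/2 of a minor *)

Section determinant_moment.
Context d (Omega : measurableType d) (R : realType) (P : probability Omega R).
Context (n : nat) (X : 'I_n -> {RV P >-> 'rV[R]_n}).
Hypothesis indX : independent_RVs X.
Variable A : R.
Hypothesis A0 : 0 < A.
Hypothesis smallX : forall i theta, dotp theta theta = 1 ->
  (\int[distribution P (X i)]_x inv_sqrt (dotp x theta) <= A%:E)%E.

Lemma inv_sqrt_norm (y : R) : inv_sqrt `|y| = inv_sqrt y.
Proof. by rewrite /inv_sqrt normr_eq0 normr_id. Qed.

(** Homogeneity of degree -1/2 extends the hypothesis from unit vectors to all [u]; at u = 0 the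
    bound is infinite. *)
Lemma integral_inv_sqrt_dotp i u :
  (\int[distribution P (X i)]_x inv_sqrt (dotp x u) <= A%:E * inv_sqrt (Num.sqrt (dotp u u)))%E.
Proof.
have [->|u0] := eqVneq u 0.
  have -> : dotp (0 : 'rV[R]_n) 0 = 0 by apply/eqP; rewrite dotp_eq0.
  have -> : inv_sqrt (Num.sqrt 0) = +oo%E :> \bar R by rewrite sqrtr0 /inv_sqrt eqxx.
  by rewrite gt0_muley ?leey// lte_fin.
pose r := Num.sqrt (dotp u u).
have r0 : 0 < r by rewrite sqrtr_gt0 lt_neqAle eq_sym dotp_eq0 u0 dotp_ge0.
have uE : u = r *: (r^-1 *: u) by rewrite scalerA divff ?scale1r// gt_eqF.
have -> : (\int[distribution P (X i)]_x inv_sqrt (dotp x u) =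
    \int[distribution P (X i)]_x (((Num.sqrt `|r|)^-1)%:E * inv_sqrt (dotp x (r^-1 *: u))))%E.
  by apply: eq_integral => x _; rewrite {1}uE dotpZr inv_sqrtM ?gt_eqF.
rewrite -/r.
rewrite ge0_integralZl//; last 2 first.
- by apply: (measurableT_comp measurable_inv_sqrt); exact: measurable_dotp.
- by move=> x _; exact: inv_sqrt_ge0.
have -> : inv_sqrt r = ((Num.sqrt `|r|)^-1)%:E by rewrite /inv_sqrt gt_eqF.
rewrite muleC; apply: lee_wpmul2r.
  by rewrite lee_fin invr_ge0 sqrtr_ge0.
by apply: smallX; exact: unit_dotp.
Qed.

(** Stated for minors picked by injections [r] and [c], since expansion along a row produces smaller
    minors of the same kind. The factors (m+1)^(-1/4), one per row, accumulate to (m!)^(-1/4). *)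
Lemma determinant_moment m (r c : 'I_m -> 'I_n) : injective r -> injective c ->
  (\int[P]_w inv_sqrt (\det (\matrix_(a < m, b < m) X (r a) w ord0 (c b))) <=
   (A ^+ m / Num.sqrt (Num.sqrt (m`!)%:R))%:E)%E.
Proof.
have mXc i k : measurable_fun setT (fun w => X i w ord0 k).
  by apply: (measurableT_comp (measurable_coord_rV k)).
elim: m r c => [|m IH] r c rI cI.
  under eq_integral => w _ do rewrite det_mx00 /inv_sqrt oner_eq0 normr1 sqrtr1 invr1.
  by rewrite integral_probability_cst expr0 fact0 !sqrtr1 divr1.
pose i := r ord0.
pose Mz (z : n.-tuple 'rV[R]_n) (x : 'rV[R]_n) : 'M[R]_m.+1 :=
  \matrix_(a, b) (if r a == i then x else tnth z (r a)) ord0 (c b).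
pose G (p : n.-tuple 'rV[R]_n * 'rV[R]_n) := inv_sqrt (\det (Mz p.1 p.2)).
have mG : measurable_fun setT G.
  apply: (measurableT_comp measurable_inv_sqrt).
  apply: measurable_det => a b; under eq_fun => p do rewrite mxE.
  case: (r a == i).
    by apply: (measurableT_comp (measurable_coord_rV (c b))).
  apply: (measurableT_comp (measurable_coord_rV (c b))).
  by apply: (measurableT_comp (measurable_tnth (r a))).
have G0 p : (0 <= G p)%E by exact: inv_sqrt_ge0.
pose mask w : n.-tuple 'rV[R]_n := [tuple if j == i then 0 else X j w | j < n].
have maskE w j : tnth (mask w) j = if j == i then 0 else X j w.
  by rewrite (tnth_mktuple (fun j => if j == i then 0 else X j w)).
have -> : (\int[P]_w inv_sqrt (\det (\matrix_(a, b) X (r a) w ord0 (c b))) =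
    \int[P]_w G (mask w, X i w))%E.
  apply: eq_integral => w _; congr (inv_sqrt (\det _)); apply/matrixP => a b.
  by rewrite !mxE /= maskE; case: eqVneq => // ->.
rewrite (integral_masked indX 0 i mG G0) -/(mask _).
pose minor w (b : 'I_m.+1) := \det (\matrix_(a < m, b' < m) X (r (lift ord0 a)) w ord0 (c (lift b b'))).
have inner w : (\int[distribution P (X i)]_x G (mask w, x) <=
   (A / (Num.sqrt (Num.sqrt m.+1%:R) * m.+1%:R))%:E * \sum_b inv_sqrt (minor w b))%E.
  pose cof (b : 'I_m.+1) : R := (-1) ^+ ((ord0 : 'I_m.+1) + b) * minor w b.
  (* The cofactors, extended by zero to the columns not selected: the determinant is the scalar
     product of [u] with the free row. *)
  pose u : 'rV[R]_n := \row_k \sum_b (if c b == k then cof b else 0).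
  have uc b : u ord0 (c b) = cof b.
    rewrite mxE (bigD1 b)//= eqxx big1 ?addr0// => b' b'b.
    by rewrite (inj_eq cI) (negbTE b'b).
  have dotu x : dotp x u = \sum_b x ord0 (c b) * cof b.
    rewrite /dotp; under eq_bigr => k _ do rewrite mxE mulr_sumr.
    rewrite exchange_big; apply: eq_bigr => b _.
    by rewrite (bigD1 (c b))//= eqxx big1 ?addr0// => k /negbTE; rewrite eq_sym => ->; rewrite mulr0.
  have detE x : \det (Mz (mask w) x) = dotp x u.
    rewrite dotu (expand_det_row _ ord0); apply: eq_bigr => b _.
    rewrite mxE eqxx; congr (_ * _); rewrite /cofactor /cof; congr (_ * \det _).
    apply/matrixP => a b'; rewrite !mxE maskE.
    by rewrite (inj_eq rI) eq_sym (negbTE (neq_lift _ _)).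
  under eq_integral => x _ do rewrite /G /= detE.
  apply: le_trans (integral_inv_sqrt_dotp i u) _.
  rewrite dotu (eq_bigr (fun b => cof b ^+ 2)); last by move=> b _; rewrite uc expr2.
  rewrite EFinM -muleA; apply: lee_wpmul2l; first by rewrite lee_fin ltW.
  apply: le_trans (inv_sqrt_jensen cof) _; apply: lee_wpmul2l.
    by rewrite lee_fin invr_ge0 mulr_ge0// sqrtr_ge0.
  apply: lee_sum => b _.
  by rewrite -[leLHS]inv_sqrt_norm /cof normrM normrX normrN1 expr1n mul1r inv_sqrt_norm.
have mminor b : measurable_fun setT (fun w => inv_sqrt (minor w b)).
  apply: (measurableT_comp measurable_inv_sqrt).
  apply: measurable_det => a b'; under eq_fun => p do rewrite mxE.
  exact: mXc.
apply: (@le_trans _ _ (\int[P]_w ((A / (Num.sqrt (Num.sqrt m.+1%:R) * m.+1%:R))%:E *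
    \sum_b inv_sqrt (minor w b)))%E).
  apply: ge0_le_integral => //.
  - by move=> w _; apply: integral_ge0.
  - apply: (measurableT_comp (measurable_fun_fubini_tonelli_F G mG G0)).
    exact: measurable_masked.
  - by apply: measurable_funeM; apply: emeasurable_sum.
  - by move=> w _; exact: inner.
have K0 : 0 <= A / (Num.sqrt (Num.sqrt m.+1%:R) * m.+1%:R).
  by rewrite divr_ge0 ?(ltW A0)// mulr_ge0// sqrtr_ge0.
rewrite ge0_integralZl//; last 2 first.
- by apply: emeasurable_sum.
- by move=> w _; apply: sume_ge0 => b _; exact: inv_sqrt_ge0.
rewrite ge0_integral_sum//; last by move=> b w _; exact: inv_sqrt_ge0.
apply: (@le_trans _ _ ((A / (Num.sqrt (Num.sqrt m.+1%:R) * m.+1%:R))%:E *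
    \sum_(b < m.+1) (A ^+ m / Num.sqrt (Num.sqrt (m`!)%:R))%:E)%E).
  apply: lee_wpmul2l => //; apply: lee_sum => b _; apply: IH.
    by move=> a a' /rI /lift_inj.
  by move=> a a' /cI /lift_inj.
rewrite sumEFin -EFinM lee_fin sumr_const card_ord factS natrM !sqrtrM ?sqrtr_ge0//.
rewrite exprS -[_ *+ m.+1]mulr_natr le_eqVlt; apply/orP; left; apply/eqP; field.
by rewrite !gt_eqF// ?sqrtr_gt0 ?ltr0n ?fact_gt0.
Qed.
End determinant_moment.

(** * Uniform distributions on isotropic bodies *)

Section borel_rV.
Context {R : realType} {n : nat}.
Implicit Types (K U : set 'rV[R]_n).

(** The sigma-algebra is generated by the coordinates, so an open set is written as the countable
    union of the cubes it contains with rational centre and radius 1 / (k+1). *)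
Lemma open_measurable_rV U : open U -> measurable U.
Proof.
move=> oU.
pose C (p : 'rV[rat]_n * nat) :=
  [set x : 'rV[R]_n | forall j, `|x ord0 j - ratr (p.1 ord0 j)| < p.2.+1%:R^-1].
have mC p : measurable (C p).
  rewrite (_ : C p = \bigcap_(j in [set: 'I_n])
      [set x | `|x ord0 j - ratr (p.1 ord0 j)| < p.2.+1%:R^-1]).
    apply: fin_bigcap_measurable => // j _.
    apply: measurable_ltr_set => //; apply: measurableT_comp => //.
    by apply: measurable_funB => //; exact: measurable_coord_rV.
  by apply/seteqP; split=> [x h j _|x h j]; [exact: h|exact: (h j I)].
pose F i := if unpickle i is Some p then (if `[< C p `<=` U >] then C p else set0) else set0.
have -> : U = \bigcup_i F i.
  apply/seteqP; split=> [x Ux|x [i _]]; last first.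
    by rewrite /F; case: unpickle => // p; case: ifPn => // /asboolP; apply.
  have /nbhs_ballP[e /= e0 xeU] : nbhs x U by exact: open_nbhs_nbhs.
  pose k := Num.truncn (2 / e).
  have ke : 2 * k.+1%:R^-1 < e.
    by rewrite ltr_pdivrMr// mulrC -ltr_pdivrMr// truncnS_gt.
  have k0 : 0 < k.+1%:R^-1 :> R by rewrite invr_gt0.
  have /choice[q hq] (j : 'I_n) : exists q : rat, `|x ord0 j - ratr q| < k.+1%:R^-1.
    have xk : x ord0 j - k.+1%:R^-1 < x ord0 j + k.+1%:R^-1.
      by rewrite ltrBlDr -addrA ltrDl addr_gt0.
    have [q] := rat_in_itvoo xk.
    rewrite in_itv/= => /andP[q1 q2]; exists q; move: q1 q2; set ee := k.+1%:R^-1 => q1 q2.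
    by rewrite ltr_norml; apply/andP; split; lra.
  pose p : 'rV[rat]_n * nat := (\row_j q j, k).
  exists (pickle p) => //; rewrite /F pickleK asboolT.
    by move=> j /=; rewrite mxE.
  move=> y Cy; apply: xeU; split=> // i j; rewrite !ord1.
  have := Cy j; rewrite /= mxE => h1; have h2 := hq j.
  rewrite /ball /=; apply: le_lt_trans ke.
  rewrite (_ : x 0 j - y 0 j = (x 0 j - ratr (q j)) - (y 0 j - ratr (q j))); last by ring.
  by apply: le_trans (ler_normB _ _) _; rewrite mulr2n mulrDl mul1r; apply: lerD; exact: ltW.
apply: bigcupT_measurable => i; rewrite /F.
by case: unpickle => // p; case: ifPn.
Qed.

Lemma compact_measurable_rV K : compact K -> measurable K.
Proof.
move=> cK; rewrite -[K]setCK; apply: measurableC; apply: open_measurable_rV.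
by apply: closed_openC; apply: compact_closed => //; exact: norm_hausdorff.
Qed.

Lemma compact_bounded_coord K : compact K ->
  exists2 M : R, 0 < M & forall x, K x -> forall i, `|x ord0 i| <= M.
Proof.
move=> cK; have [M [Mr hM]] := compact_bounded cK.
exists (`|M| + 1); first by rewrite ltr_wpDl.
move=> x Kx i; apply: le_trans (hM (`|M| + 1) _ x Kx).
  rewrite -[`|x|]/(mx_norm x) mx_normrE.
  exact: (le_bigmax 0 (fun ij : 'I_1 * 'I_n => `|x ij.1 ij.2|) (ord0, i)).
by rewrite (le_lt_trans (ler_norm _))// ltrDl.
Qed.

Lemma convex_setE K x y (t : R) : convex_set K -> K x -> K y -> 0 <= t <= 1 ->
  K ((1 - t) *: x + t *: y).
Proof.
move=> cK Kx Ky t01.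
have [t0 t1] := andP t01.
have := cK y x (Itv01 t0 t1) (mem_set Ky) (mem_set Kx).
by rewrite inE addrC.
Qed.
End borel_rV.

Lemma brunn_minkowski_midpoint (R : realType) n (A B C : set 'rV[R]_n) :
  measurable A -> measurable B -> measurable C ->
  (forall a b, A a -> B b -> C (2^-1 *: (a + b))) ->
  (lebesgue_rV R n A * lebesgue_rV R n B <= lebesgue_rV R n C * lebesgue_rV R n C)%E.
Proof.
move=> mA mB mC ABC.
have volE (S : set 'rV[R]_n) : measurable S ->
    (lebesgue_rV R n S = \int[lebesgue_rV R n]_x (\1_S x)%:E)%E.
  by move=> mS; rewrite integral_indic// setIT.
have mind (S : set 'rV[R]_n) : measurable S -> measurable_fun setT (fun x => (\1_S x)%:E : \bar R).
  by move=> mS; apply/measurable_EFinP; exact: measurable_indic.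
rewrite !volE//; apply: prekopa_leindler; [exact: mind|exact: mind|exact: mind|by []..|].
move=> a b; rewrite -!EFinM lee_fin !indicE.
have [Aa|nAa] := pselect (A a); last by rewrite memNset// mul0r mulr_ge0.
have [Bb|nBb] := pselect (B b); last by rewrite [_ \in B]memNset// mulr0 mulr_ge0.
by rewrite !mem_set//; exact: ABC.
Qed.

Section uniform_on_isotropic.
Context {R : realType} {n : nat} (K : set 'rV[R]_n) (L : R) (nu : probability 'rV[R]_n R).
Hypothesis isoK : isotropic K L.
Hypothesis nuE : forall A, measurable A -> nu A = lebesgue_rV R n (A `&` K).
Local Notation vol := (lebesgue_rV R n).

Let cK : compact K. Proof. by case: isoK => -[]. Qed.
Let mK : measurable K. Proof. exact: compact_measurable_rV. Qed.
Let convK : convex_set K. Proof. by case: isoK => -[]. Qed.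

Lemma ge0_integral_uniform (f : 'rV[R]_n -> \bar R) : measurable_fun setT f ->
  (forall x, 0 <= f x)%E -> (\int[nu]_x f x = \int[vol]_(x in K) f x)%E.
Proof.
move=> mf f0.
rewrite (@ge0_negligible_integral _ _ _ _ setT (~` K))//; last 2 first.
- exact: measurableC.
- by apply: etrans (nuE (measurableC mK)) _; rewrite setICl measure0.
rewrite setTD setCK; apply: eq_measure_integral => A mA AK.
by apply: etrans (nuE mA) _; rewrite (setIidl AK).
Qed.

(** Midpoints of points of [K] at heights at least s and t lie in [K] at height at least (s + t) /
    2, so Brunn-Minkowski applies to the pieces cut from [K] by half-spaces. *)
Lemma uniform_log_concave_tails theta :
  log_concave_tails nu (fun x => dotp x theta).
Proof.
move=> s t; have mt r : measurable [set x : 'rV[R]_n | r <= dotp x theta].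
  by apply: measurable_ler_set => //; exact: measurable_dotp.
rewrite !nuE//; apply: brunn_minkowski_midpoint; try exact: measurableI.
move=> a b /= [sa Ka] [tb Kb]; split.
  by rewrite dotpZl dotpDl ler_pM2l ?invr_gt0// lerD.
have := convex_setE convK Ka Kb (t := 2^-1) ltac:(lra).
by rewrite (_ : 1 - 2^-1 = 2^-1) -?scalerDr//; field.
Qed.

Lemma integrable_dotp_coord i : vol.-integrable K (EFin \o (fun x : 'rV[R]_n => x ord0 i)).
Proof.
have [M M0 KM] := compact_bounded_coord cK.
apply: measurable_bounded_integrable => //.
- by have [_ vK _ _ _] := isoK; rewrite [X in (X < _)%E]vK ltry.
- by apply: measurable_funTS; exact: measurable_coord_rV.
exists M; split; first exact: num_real.
by move=> x Mx y Ky /=; apply: le_trans (ltW Mx); exact: KM.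
Qed.

Lemma integral_dotp_uniform theta : (\int[vol]_(x in K) (dotp x theta)%:E = 0)%E.
Proof.
have vol0 i : (\int[vol]_(x in K) (x ord0 i)%:E = 0)%E.
  have [_ _ v0 _ _] := isoK.
  have : vec_integral K ord0 i = 0 by rewrite v0 mxE.
  rewrite mxE /Rintegral => h.
  rewrite -[LHS]fineK; first by rewrite h.
  exact: integrable_fin_num (integrable_dotp_coord i).
rewrite /dotp; under eq_integral => x _ do rewrite -sumEFin.
rewrite integral_sum//; last first.
  move=> i; under eq_fun do rewrite EFinM muleC.
  exact: integrableZl (integrable_dotp_coord i).
rewrite big1// => i _.
under eq_integral => x _ do rewrite EFinM muleC.
rewrite integralZl//; first by rewrite vol0 mule0.
exact: integrable_dotp_coord.
Qed.

Lemma uniform_isotropic_marginal theta : dotp theta theta = 1 ->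
  isotropic_marginal nu (fun x => dotp x theta) L.
Proof.
move=> th1; have [_ _ _ L0 var] := isoK.
have mY : measurable_fun setT (fun x : 'rV[R]_n => dotp x theta) by exact: measurable_dotp.
have bounded_int (f : 'rV[R]_n -> R) (M : R) : measurable_fun setT f ->
    (forall x, K x -> `|f x| <= M) -> vol.-integrable K (EFin \o f).
  move=> mf fM; apply: measurable_bounded_integrable => //.
  - by have [_ vK _ _ _] := isoK; rewrite [X in (X < _)%E]vK ltry.
  - exact: measurable_funTS.
  exists M; split; first exact: num_real.
  by move=> x Mx y Ky /=; apply: le_trans (ltW Mx); exact: fM.
have [M M0 KM] := compact_bounded_coord cK.
have YM x : K x -> `|dotp x theta| <= \sum_i M * `|theta ord0 i|.
  move=> Kx; apply: le_trans (ler_norm_sum _ _ _) _; apply: ler_sum => i _.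
  by rewrite normrM ler_wpM2r// KM.
split => //.
- rewrite !ge0_integral_uniform; last 4 first.
  + by apply/measurable_EFinP; apply: measurable_maxr => //; exact: measurable_funN.
  + by move=> x; rewrite lee_fin le_max lexx orbT.
  + by apply/measurable_EFinP; exact: measurable_maxr.
  + by move=> x; rewrite lee_fin le_max lexx orbT.
  have h := integral_dotp_uniform theta; move: h; rewrite integralE.
  have Yint : vol.-integrable K (EFin \o (fun x => dotp x theta)) by exact: bounded_int YM.
  have hp := integrable_pos_fin_num mK Yint; have hn := integrable_neg_fin_num mK Yint.
  move=> h; transitivity (\int[vol]_(x in K) ((EFin \o (fun x => dotp x theta))^\+ x))%E.
    by apply: eq_integral => x _; rewrite funeposE /= EFin_max.
  rewrite -[LHS](subeK _ hn) h add0e.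
  by apply: eq_integral => x _; rewrite funenegE /= EFin_max EFinN.
- rewrite ge0_integral_uniform; last 2 first.
  + by apply/measurable_EFinP; exact: measurable_funX.
  + by move=> x; rewrite lee_fin sqr_ge0.
  rewrite -(var theta th1) /Rintegral fineK//.
  apply: integrable_fin_num => //.
  apply: (bounded_int (fun x => dotp x theta ^+ 2) ((\sum_i M * `|theta ord0 i|) ^+ 2)).
    exact: measurable_funX.
  move=> x Kx; rewrite normrX ler_pXn2r ?nnegrE//; first exact: YM.
  exact: le_trans (YM x Kx).
split; first exact: uniform_log_concave_tails.
rewrite (_ : (fun x => - dotp x theta) = (fun x => dotp x (- theta))).
  exact: uniform_log_concave_tails.
by apply/funext => x; rewrite dotpNr.
Qed.
End uniform_on_isotropic.

(** * Separation and the ball inside an isotropic body *)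

Lemma cauchy_schwarz_dotp (R : realType) n (x y : 'rV[R]_n) :
  dotp x y ^+ 2 <= dotp x x * dotp y y.
Proof.
have [->|y0] := eqVneq y 0.
  by rewrite -(scale0r (0 : 'rV[R]_n)) !dotpZr !mul0r expr2 mulr0 mulr0.
have yy : 0 < dotp y y by rewrite lt_neqAle eq_sym dotp_eq0 y0 dotp_ge0.
have := dotp_ge0 (dotp y y *: x - dotp x y *: y).
rewrite (_ : dotp _ _ = dotp y y * (dotp x x * dotp y y - dotp x y ^+ 2)); last first.
  by rewrite !(dotpDl, dotpDr, dotpNl, dotpNr, dotpZl, dotpZr) (dotpC y x); ring.
by rewrite pmulr_rge0// subr_ge0.
Qed.

(** Compactness provides a point [q] of [K] nearest to [p], and theta is the normalised p - q; by
    convexity no point of [K] is seen from [q] at an acute angle with p - q. *)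
Lemma compact_convex_separation (R : realType) n (K : set 'rV[R]_n) (p : 'rV[R]_n) :
  compact K -> convex_set K -> K !=set0 -> ~ K p ->
  exists2 theta, dotp theta theta = 1 & forall x, K x -> dotp x theta < dotp p theta.
Proof.
move=> cK convK K0 nKp.
have cont : {within K, continuous (fun x : 'rV[R]_n => dotp (x - p) (x - p))}.
  apply: continuous_subspaceT; apply: continuous_big => [|i _]; first exact: add_continuous.
  have ci : continuous (fun x : 'rV[R]_n => (x - p) ord0 i).
    rewrite (_ : (fun x => _) = (fun x : 'rV[R]_n => x ord0 i - p ord0 i)); last first.
      by apply/funext => x; rewrite !mxE.
    move=> x; apply: cvgB; [exact: nbhs_filter|exact: coord_continuous|].
    by apply: cvg_cst; exact: nbhs_filter.
  move=> x; apply: cvgM; [exact: nbhs_filter|exact: ci|exact: ci].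
have [q /set_mem Kq qmin] := EVT_min_rV K0 cK cont.
have [v vE] : {v | v = p - q} by exists (p - q).
have v0 : v != 0 by rewrite vE; apply/eqP => /subr0_eq pq; apply: nKp; rewrite pq.
have vv : 0 < dotp v v by rewrite lt_neqAle eq_sym dotp_eq0 v0 dotp_ge0.
have key x : K x -> dotp (x - q) v <= 0.
  move=> Kx; rewrite leNgt; apply/negP => xq.
  have [w wE] : {w | w = x - q} by exists (x - q).
  rewrite -wE in xq.
  have ineq t : 0 <= t <= 1 -> 2 * t * dotp w v <= t ^+ 2 * dotp w w.
    move=> t01; have := qmin _ (mem_set (convex_setE convK Kq Kx t01)).
    rewrite (_ : (1 - t) *: q + t *: x - p = t *: w - v); last first.
      by rewrite wE vE; apply/rowP => i; rewrite !mxE; ring.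
    rewrite (_ : q - p = - v); last by rewrite vE opprB.
    rewrite !(dotpDl, dotpDr, dotpNl, dotpNr, dotpZl, dotpZr) (dotpC v w); lra.
  have ww : 0 <= dotp w w := dotp_ge0 w.
  (* The denominator keeps t in (0, 1] and makes t |w|^2 <= <w, v>, so that q + t w would be
     strictly closer to p than q is. *)
  pose t := dotp w v / (dotp w w + dotp w v).
  have D0 : 0 < dotp w w + dotp w v by rewrite ltr_wpDl.
  have t0 : 0 < t by rewrite divr_gt0.
  have t1 : t <= 1 by rewrite ler_pdivrMr// mul1r lerDr.
  have := ineq t; rewrite (ltW t0) t1 => /(_ isT).
  move=> h; have {}h : 2 * dotp w v <= t * dotp w w.
    by rewrite -(ler_pM2l t0); move: h; rewrite expr2; lra.
  have : t * dotp w w <= dotp w v.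
    rewrite /t mulrAC ler_pdivrMr// ler_pM2l//; first by rewrite lerDl ltW.
  by move: xq; lra.
pose r := Num.sqrt (dotp v v).
exists (r^-1 *: v); first exact: unit_dotp.
move=> x Kx; rewrite !dotpZr ltr_pM2l ?invr_gt0 ?sqrtr_gt0//.
have := key x Kx; have : dotp v v = dotp p v - dotp q v by rewrite {1}vE dotpDl dotpNl.
by rewrite dotpDl dotpNl; lra.
Qed.

(** If p is short and outside [K], a separating half-space has [K] below height [tail_point * L] in
    some direction, against the positive mass every marginal has from that height on. *)
Lemma isotropic_contains_ball (R : realType) n (K : set 'rV[R]_n) (L : R)
    (nu : probability 'rV[R]_n R) (p : 'rV[R]_n) :
  isotropic K L -> (forall A, measurable A -> nu A = lebesgue_rV R n (A `&` K)) ->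
  dotp p p <= (tail_point * L) ^+ 2 -> K p.
Proof.
move=> isoK nuE pL; apply: contrapT => nKp.
have [[cK convK [x0 /interior_subset Kx0]] _ _ L0 _] := isoK.
have [theta th1 sep] := compact_convex_separation cK convK (ex_intro _ x0 Kx0) nKp.
have tp : dotp p theta <= tail_point * L.
  have := cauchy_schwarz_dotp p theta; rewrite th1 mulr1 => h.
  have tL : 0 <= tail_point * L by rewrite mulr_ge0 ?ltW// tail_point_gt0.
  have [|pth] := leP (dotp p theta) 0; first by move=> h0; exact: le_trans tL.
  by rewrite -(@ler_pXn2r _ 2)// ?nnegrE ?(ltW pth)//; exact: le_trans pL.
have := tail_lower_bound (uniform_isotropic_marginal isoK nuE th1).
rewrite nuE; last by apply: measurable_ler_set => //; exact: measurable_dotp.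
rewrite (_ : _ `&` K = set0).
  by rewrite measure0 lee_fin leNgt tail_mass_gt0.
apply/seteqP; split=> // x /= [h Kx]; have := sep x Kx.
by rewrite ltNge (le_trans tp h).
Qed.

(** * The norm of the sum *)

Section sphere_net.
Context {R : realType} (n : nat).
Hypothesis n0 : (0 < n)%N.
Local Notation index := {ffun 'I_n -> 'I_(2 * n).+1 * bool}.
Implicit Types z : index.

(* z encodes an integer vector with entries (-1)^(z i).2 (z i).1. *)
Definition net_point z : 'rV[R]_n :=
  \row_i ((-1) ^+ (z i).2 * ((z i).1%:R / (2 * Num.sqrt n%:R))).

(** After scaling by 1 / (2 sqrt n) this is length at most 1. A zero entry carries a sign bit too
    and is coded twice, harmless in an upper bound on the number of codes. *)
Definition net_index z := (\sum_i (z i).1 ^ 2 <= 4 * n)%N.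

Let sn0 : 0 < Num.sqrt n%:R :> R. Proof. by rewrite sqrtr_gt0 ltr0n. Qed.

Lemma net_point_norm z : net_index z -> dotp (net_point z) (net_point z) <= 1.
Proof.
move=> zok; rewrite /dotp.
have -> : \sum_i net_point z ord0 i * net_point z ord0 i =
    (\sum_i (z i).1 ^ 2)%N%:R / (4 * n%:R).
  rewrite natr_sum mulr_suml; apply: eq_bigr => i _.
  rewrite mxE -expr2 exprMn -exprM mulnC exprM sqrrN expr1n expr1n mul1r.
  rewrite expr_div_n exprMn sqr_sqrtr// natrX; congr (_ / (_ * _)); ring.
rewrite ler_pdivrMr ?mulr_gt0 ?ltr0n// mul1r.
by rewrite -natrM ler_nat.
Qed.

(* The generating function sum_z prod_i 2^(- z i) <= 4^n, with 2^(4 n) as the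
   weight of the constraint sum_i (z i) <= 4 n, replaces a volumetric count. *)
Lemma net_card : \sum_(z | net_index z) (1 : R) <= 64 ^+ n.
Proof.
pose F (p : 'I_(2 * n).+1 * bool) : R := 2^-1 ^+ p.1.
have F0 p : 0 <= F p by rewrite exprn_ge0.
have one z : net_index z -> 1 <= 16 ^+ n * \prod_i F (z i).
  move=> zok; rewrite /F prodrXr.
  have h : (\sum_i (z i).1 <= 4 * n)%N.
    apply: leq_trans zok; apply: leq_sum => i _.
    by case: ((z i).1 : nat) => // k; rewrite expnS leq_pmulr// expn1.
  rewrite (_ : 16 = 2 ^+ 4); last by ring.
  rewrite -exprM exprVn -[X in X <= _](@divff _ (2 ^+ \sum_i (z i).1)) ?expf_neq0//.
  by rewrite ler_pM2r ?invr_gt0 ?exprn_gt0// ler_eXn2l// ltr1n.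
pose S : R := 16 ^+ n * \sum_(z : index) \prod_i F (z i).
apply: (@le_trans _ _ S); rewrite /S.
  rewrite mulr_sumr [leRHS](bigID net_index)/= -[leLHS]addr0; apply: lerD.
    exact: ler_sum.
  by apply: sumr_ge0 => z _; rewrite mulr_ge0 ?exprn_ge0// prodr_ge0.
rewrite -(bigA_distr_bigA (fun _ p => F p))/= prodr_const card_ord -exprMn.
apply: lerXn2r; rewrite ?nnegrE ?mulr_ge0 ?sumr_ge0//.
rewrite (_ : 64 = 16 * 4); last by ring.
rewrite ler_pM2l// -(pair_bigA _ (fun (k : 'I_(2 * n).+1) (b : bool) => F (k, b)))/=.
under eq_bigr => k _ do rewrite big_bool /F /=.
rewrite (_ : \sum_(k < (2 * n).+1) _ = 4 * (1 - 2^-1 ^+ (2 * n).+1)); last first.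
  elim: (2 * n).+1 => [|m IH]; first by rewrite big_ord0 expr0 subrr mulr0.
  by rewrite big_ord_recr/= IH exprS; field.
have : 0 <= 2^-1 ^+ (2 * n).+1 :> R by rewrite exprn_ge0.
lra.
Qed.

(* Round every |w i| down to a multiple of 1 / (2 sqrt n). *)
Lemma net_dense w : dotp w w = 1 -> exists2 z, net_index z & 3 / 8 <= dotp w (net_point z).
Proof.
move=> w1.
pose s : R := 2 * Num.sqrt n%:R; have s0 : 0 < s by rewrite mulr_gt0.
have ss : s ^+ 2 = 4 * n%:R by rewrite exprMn sqr_sqrtr//; ring.
pose k (i : 'I_n) := Num.truncn (s * `|w ord0 i|).
have kb i : (k i)%:R <= s * `|w ord0 i| < (k i).+1%:R.
  by apply: truncn_itv; rewrite mulr_ge0// ltW.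
have wi (i : 'I_n) : `|w ord0 i| ^+ 2 <= 1.
  rewrite -w1 /dotp (bigD1 i)//= -normrX ger0_norm ?sqr_ge0// expr2 lerDl.
  by apply: sumr_ge0 => j _; rewrite -expr2 sqr_ge0.
have kn i : (k i < (2 * n).+1)%N.
  rewrite ltnS -(ler_nat R); have /andP[+ _] := kb i; move=> /le_trans; apply.
  apply: (@le_trans _ _ s).
    by rewrite ler_piMr ?(ltW s0)// -(@expr_le1 _ 2).
  rewrite natrM ler_pM2l// -[leRHS]ger0_norm// -sqrtr_sqr ler_wsqrtr//.
  by rewrite -natrX ler_nat expnS expn1 leq_pmulr.
pose z : index := [ffun i => (Ordinal (kn i), w ord0 i < 0)].
exists z.
  rewrite /net_index -(ler_nat R) natr_sum natrM -ss -[leRHS]mulr1 -[X in _ <= _ * X]w1 /dotp mulr_sumr.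
  apply: ler_sum => i _; rewrite natrX ffunE /= -expr2 -exprMn -[leRHS]ger0_norm ?sqr_ge0//.
  rewrite normrX normrM (ger0_norm (ltW s0)) lerXn2r ?nnegrE ?mulr_ge0 ?(ltW s0)//.
  by case/andP: (kb i).
(* With a = |w i| and b its rounding, (a - b)^2 <= s^(-2) gives a b >= (a^2 - s^(-2)) / 2; summed
   over i, s^2 = 4 n leaves (1 - 1/4) / 2 = 3/8. *)
have term i : 2^-1 * (w ord0 i ^+ 2 - (s ^+ 2)^-1) <= w ord0 i * net_point z ord0 i.
  rewrite mxE ffunE /= -/s.
  have -> : w ord0 i * ((-1) ^+ (w ord0 i < 0)%R * ((k i)%:R / s)) = `|w ord0 i| * ((k i)%:R / s).
    rewrite mulrA; congr (_ * _); have [wi0|wi0] := ltP (w ord0 i) 0.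
      by rewrite expr1 mulrN1 ltr0_norm.
    by rewrite expr0 mulr1 ger0_norm.
  have -> : w ord0 i ^+ 2 = `|w ord0 i| ^+ 2 by rewrite -normrX ger0_norm ?sqr_ge0.
  have /andP[k1 k2] := kb i; set a := `|w ord0 i| in k1 k2 *; set b := (k i)%:R / s.
  have b1 : b <= a by rewrite ler_pdivrMr// mulrC.
  have b2 : a - b <= s^-1.
    rewrite lerBlDr -(ler_pM2r s0) mulrDl mulVf ?gt_eqF// divfK ?gt_eqF// mulrC.
    by move: k2; rewrite -natr1; lra.
  have b0 : 0 <= b by rewrite divr_ge0// ltW.
  have : (a - b) ^+ 2 <= (s^-1) ^+ 2 by rewrite lerXn2r ?nnegrE ?subr_ge0// invr_ge0 ltW.
  by rewrite exprVn; nra.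
apply: le_trans (ler_sum _ (fun i _ => term i)).
rewrite -mulr_sumr sumrB sumr_const card_ord ss -[_ *+ n]mulr_natr invfM -mulrA mulVf ?mulr1; last first.
  by rewrite pnatr_eq0 -lt0n.
rewrite (_ : \sum_i _ = 1); first lra.
by rewrite -w1; apply: eq_bigr => i _; rewrite expr2.
Qed.
End sphere_net.

Lemma measurable_prod_in d (T : measurableType d) (R : realType) (I : finType) (J : {set I})
    (h : I -> T -> R) : (forall i, measurable_fun setT (h i)) ->
  measurable_fun setT (fun t => \prod_(i in J) h i t).
Proof.
move=> mh; under eq_fun => t do rewrite big_mkcond.
by apply: measurable_prod => i _; case: (i \in J).
Qed.

(** 289 exceeds 13 * 64 / 3, so a sum of norm at least 289 n L has scalar product at least 13 n * 8
    L with a net point that realises 3/8 of its length. *)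
Definition sum_ratio {R : realType} : R := 17 ^+ 2.

Lemma sum_ratio_gt0 {R : realType} : 0 < sum_ratio :> R.
Proof. by rewrite exprn_gt0. Qed.

Section sum_tail.
Context d (Omega : measurableType d) (R : realType) (P : probability Omega R).
Context (n : nat) (X : 'I_n -> {RV P >-> 'rV[R]_n}) (L : R).
Hypothesis n0 : (0 < n)%N.
Hypothesis L0 : 0 < L.
Hypothesis indX : independent_RVs X.
Hypothesis expX : forall i theta, dotp theta theta = 1 ->
  (\int[distribution P (X i)]_x (expR (dotp x theta / (8 * L)))%:E <= 7%:E)%E.

Let g theta (x : 'rV[R]_n) : R := expR (dotp x theta / (8 * L)).

Let mg theta : measurable_fun setT (g theta).
Proof.
apply: measurableT_comp => //; apply: measurable_funM => //.
exact: measurable_dotp.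
Qed.

(** Net points lie in the ball, not on the sphere; for 0 <= r <= 1 the bound e^(r y) <= e^y + 1
    reduces to a unit vector and costs 7 + 1 = 8. *)
Lemma exponential_moment_short i theta : dotp theta theta <= 1 ->
  (\int[distribution P (X i)]_x (g theta x)%:E <= 8%:E)%E.
Proof.
move=> th1; have [->|th0] := eqVneq theta 0.
  under eq_integral => x _ do
    rewrite /g -(scale0r (0 : 'rV[R]_n)) dotpZr mul0r mul0r expR0.
  by rewrite integral_probability_cst lee_fin ler1n.
pose r := Num.sqrt (dotp theta theta).
have r0 : 0 < r by rewrite sqrtr_gt0 lt_neqAle eq_sym dotp_eq0 th0 dotp_ge0.
have r1 : r <= 1 by rewrite -[leRHS]sqrtr1 ler_wsqrtr.
pose e := r^-1 *: theta.
apply: (@le_trans _ _ (\int[distribution P (X i)]_x ((g e x)%:E + 1%:E))%E).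
  apply: ge0_le_integral => //.
  - by move=> x _; rewrite lee_fin expR_ge0.
  - exact/measurable_EFinP.
  - by apply: emeasurable_funD => //; exact/measurable_EFinP.
  move=> x _; rewrite -EFinD lee_fin /g.
  have -> : dotp x theta / (8 * L) = r * (dotp x e / (8 * L)).
    by rewrite /e dotpZr !mulrA divff ?mul1r// gt_eqF.
  set y := dotp x e / (8 * L); have [y0|y0] := leP 0 y.
    have : expR (r * y) <= expR y by rewrite ler_expR ler_piMl.
    by lra.
  have : expR (r * y) <= expR 0 by rewrite ler_expR nmulr_lle0// ltW.
  by rewrite expR0; have := expR_ge0 y; lra.
rewrite ge0_integralD//; last 2 first.
- by move=> x _; rewrite lee_fin expR_ge0.
- exact/measurable_EFinP.
rewrite integral_probability_cst.
apply: le_trans (leeD (expX i (unit_dotp th0)) (lexx _)) _.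
by rewrite -EFinD lee_fin; lra.
Qed.

Lemma exponential_moment_prod theta (J : {set 'I_n}) : dotp theta theta <= 1 ->
  (\int[P]_w (\prod_(i in J) g theta (X i w))%:E <= (8 ^+ #|J|)%:E)%E.
Proof.
move=> th1; have [m] := ubnP #|J|; elim: m J => // m IH J Jm.
have [->|[i iJ]] := set_0Vmem J.
  under eq_integral => w _ do rewrite big_set0.
  by rewrite integral_probability_cst cards0 expr0.
pose J' := J :\ i.
have J'm : (#|J'| < m)%N by move: Jm; rewrite (cardsD1 i) iJ.
pose G (p : n.-tuple 'rV[R]_n * 'rV[R]_n) : \bar R :=
  (g theta p.2 * \prod_(j in J') g theta (tnth p.1 j))%:E.
have mprod : measurable_fun setT (fun z : n.-tuple 'rV[R]_n => \prod_(j in J') g theta (tnth z j)).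
  by apply: measurable_prod_in => j; apply: measurableT_comp => //; exact: measurable_tnth.
have mG : measurable_fun setT G.
  apply/measurable_EFinP; apply: measurable_funM; first exact: measurableT_comp.
  exact: (measurableT_comp mprod).
have prod0 (z : n.-tuple 'rV[R]_n) : 0 <= \prod_(j in J') g theta (tnth z j).
  by apply: prodr_ge0 => j _; exact: expR_ge0.
have G0 p : (0 <= G p)%E by rewrite lee_fin mulr_ge0// expR_ge0.
pose mask w : n.-tuple 'rV[R]_n := [tuple if j == i then 0 else X j w | j < n].
have maskE w j : tnth (mask w) j = if j == i then 0 else X j w.
  by rewrite (tnth_mktuple (fun j => if j == i then 0 else X j w)).
have prodE w : \prod_(j in J') g theta (tnth (mask w) j) = \prod_(j in J') g theta (X j w).
  by apply: eq_bigr => j; rewrite maskE !inE => /andP[/negbTE -> _].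
have -> : (\int[P]_w (\prod_(i in J) g theta (X i w))%:E = \int[P]_w G (mask w, X i w))%E.
  apply: eq_integral => w _; rewrite /G /= prodE (big_setD1 i)//.
rewrite (integral_masked indX 0 i mG G0) -/(mask _).
have inner w : (\int[distribution P (X i)]_x G (mask w, x) <=
    8%:E * (\prod_(j in J') g theta (X j w))%:E)%E.
  rewrite /G /= prodE; under eq_integral => x _ do rewrite EFinM muleC.
  rewrite ge0_integralZl//; last 3 first.
  - exact/measurable_EFinP.
  - by move=> x _; rewrite lee_fin expR_ge0.
  - by rewrite lee_fin -prodE.
  rewrite muleC; apply: lee_wpmul2r; first by rewrite lee_fin -prodE.
  exact: exponential_moment_short.
have mprodX : measurable_fun setT (fun w => (\prod_(j in J') g theta (X j w))%:E).
  by apply/measurable_EFinP; apply: measurable_prod_in => j; exact: measurableT_comp.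
apply: (@le_trans _ _ (\int[P]_w (8%:E * (\prod_(j in J') g theta (X j w))%:E))%E).
  apply: ge0_le_integral => //.
  - by move=> w _; apply: integral_ge0.
  - apply: (measurableT_comp (measurable_fun_fubini_tonelli_F G mG G0)).
    exact: measurable_masked.
  - exact: measurable_funeM.
  - by move=> w _; exact: inner.
rewrite ge0_integralZl//; last by move=> w _; rewrite lee_fin -prodE.
rewrite (cardsD1 i) iJ add1n exprS EFinM; apply: lee_wpmul2l => //.
exact: IH.
Qed.

Lemma measurable_norm_sum :
  measurable_fun setT (fun w => dotp (\sum_i X i w) (\sum_i X i w)).
Proof.
have mi k : measurable_fun setT (fun w => (\sum_i X i w) ord0 k).
  under eq_fun => w do rewrite summxE.
  apply: measurable_sum => i.
  by apply: (measurableT_comp (measurable_coord_rV k)).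
by apply: measurable_sum => k; apply: measurable_funM.
Qed.

(** A union bound over the net, as Markov's inequality for the sum [Phi] of all the exponentials:
    its mean is at most (8 * 64)^n, while on the event a single term already reaches e^(13 n). *)
Lemma norm_sum_tail :
  (P [set w | (sum_ratio * n%:R * L) ^+ 2 <= dotp (\sum_i X i w) (\sum_i X i w)]%R
   <= (4^-1 * expR (- n%:R))%:E)%E.
Proof.
set A := [set w | _].
pose S w := \sum_i X i w.
pose zs := [seq z <- index_enum {ffun 'I_n -> 'I_(2 * n).+1 * bool} | net_index z].
pose Phi w : \bar R := (\sum_(z <- zs)
  (\prod_(i in [set: 'I_n]%SET) g (net_point z) (X i w))%:E)%E.
have PhiE w z : \prod_(i in [set: 'I_n]%SET) g (net_point z) (X i w) = expR (dotp (S w) (net_point z) / (8 * L)).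
  rewrite (eq_bigl xpredT); last by move=> i; rewrite inE.
  rewrite -expR_sum; congr expR; rewrite -mulr_suml; congr (_ / _).
  by rewrite /S; elim/big_rec2 : _ => [|i a b _ ->]; rewrite ?dotpDl// -(scale0r (0 : 'rV_n)) dotpZl mul0r.
have mterm z : measurable_fun setT (fun w => (\prod_(i in [set: 'I_n]%SET) g (net_point z) (X i w))%:E).
  by apply/measurable_EFinP; apply: measurable_prod_in => j; exact: measurableT_comp.
have term0 z w : (0 <= (\prod_(i in [set: 'I_n]%SET) g (net_point z) (X i w))%:E)%E.
  by rewrite PhiE lee_fin expR_ge0.
have mPhi : measurable_fun setT Phi by apply: emeasurable_sum.
have Phi0 w : (0 <= Phi w)%E by apply: sume_ge0.
have intPhi : (\int[P]_w Phi w <= ((8 * 64) ^+ n)%:E)%E.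
  rewrite /Phi ge0_integral_sum//.
  apply: (@le_trans _ _ (\sum_(z <- zs) (8 ^+ n)%:E)%E).
    rewrite !big_filter; apply: lee_sum => z zok.
    rewrite -[X in (8 ^+ X)%:E](card_ord n) -cardsT.
    exact/exponential_moment_prod/net_point_norm.
  rewrite big_filter sumEFin lee_fin -[X in \sum_(_ | _) X]mulr1 -mulr_sumr.
  by rewrite exprMn; apply: ler_wpM2l; [rewrite exprn_ge0|exact: net_card].
have mA : measurable A by apply: measurable_ler_set => //; exact: measurable_norm_sum.
have AP w : A w -> ((expR (13 * n%:R))%:E <= Phi w)%E.
  rewrite /A /= -/(S w) => Aw.
  have nL : 0 < sum_ratio * n%:R * L by rewrite !mulr_gt0 ?sum_ratio_gt0 ?ltr0n.
  have SS : 0 < dotp (S w) (S w) by apply: lt_le_trans Aw; rewrite exprn_gt0.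
  have S0 : S w != 0 by rewrite -dotp_eq0 gt_eqF.
  pose r := Num.sqrt (dotp (S w) (S w)); have r0 : 0 < r by rewrite sqrtr_gt0.
  have rL : sum_ratio * n%:R * L <= r.
    by rewrite -[leLHS]ger0_norm ?(ltW nL)// -sqrtr_sqr ler_wsqrtr.
  have [z zok zd] := net_dense n0 (unit_dotp S0).
  rewrite /Phi big_filter (bigD1 z)//= PhiE.
  apply: (@le_trans _ _ (expR (dotp (S w) (net_point z) / (8 * L)))%:E); last first.
    by rewrite leeDl// sume_ge0.
  rewrite lee_fin ler_expR ler_pdivlMr ?mulr_gt0//.
  move: zd; rewrite -/r dotpZl => zd.
  have {}zd : r * (3 / 8) <= dotp (S w) (net_point z).
    by have := ler_wpM2l (ltW r0) zd; rewrite mulVKf// gt_eqF.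
  apply: le_trans zd; have : 0 <= n%:R * L by rewrite mulr_ge0// ltW.
  by move: rL; rewrite /sum_ratio; lra.
have key : ((expR (13 * n%:R))%:E * P A <= ((8 * 64) ^+ n)%:E)%E.
  have a0 : (0 <= (expR (13 * n%:R : R))%:E)%E by rewrite lee_fin expR_ge0.
  apply: le_trans intPhi; apply: le_trans (markov_ge0 P mPhi Phi0 a0).
  apply: lee_wpmul2l => //.
  apply: le_measure; rewrite ?inE//.
  by have := emeasurable_fun_c_infty measurableT mPhi (expR (13 * n%:R))%:E; rewrite setTI.
have e13 := expR_gt0 (13 * n%:R : R).
rewrite -(@lee_pmul2l _ (expR (13 * n%:R))%:E)//.
apply: le_trans key _; rewrite -EFinM lee_fin mulrCA -expRD.
rewrite (_ : 13 * n%:R - n%:R = n%:R * 12); last by ring.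
rewrite expRM_natl.
have e2 : 2 <= expR 1 :> R by have := expR_ge1Dx (1 : R); lra.
(* Of the exponent 13, twelve units absorb the net, the moments and the factor 4, as 4 * 512 = 2^11;
   one unit remains as e^(-n). *)
have h : 4 * (8 * 64) <= expR 12 :> R.
  rewrite -[12]mulr1 expRM_natl (_ : 4 * (8 * 64) = 2 ^+ 11); last by ring.
  apply: le_trans (_ : 2 ^+ 12 <= _); first by rewrite ler_eXn2l// ltr1n.
  by apply: lerXn2r; rewrite ?nnegrE// expR_ge0.
have h4 : 4 * (8 * 64) ^+ n <= (4 * (8 * 64)) ^+ n :> R.
  rewrite [leRHS]exprMn ler_pM2r ?exprn_gt0 ?mulr_gt0//; case: n n0 => // k _.
  by rewrite exprS ler_peMr// exprn_ege1// ler1n.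
rewrite -(@ler_pM2l _ 4)// mulrA divff// mul1r (le_trans h4)//.
by apply: lerXn2r => //; rewrite nnegrE ?expR_ge0// !mulr_ge0.
Qed.
End sum_tail.

(** * Simplices *)

Section simplices.
Context {R : realType} {n : nat}.
Local Notation vol := (lebesgue_rV R n).
Implicit Types (v : 'I_n.+1 -> 'rV[R]_n) (M : 'M[R]_n) (p t x : 'rV[R]_n).

Definition simplex_vertex M p (i : 'I_n.+1) : 'rV[R]_n :=
  if unlift ord0 i is Some j then p + row j M else p.

Definition standard_simplex : set 'rV[R]_n :=
  [set t | (forall i, 0 <= t ord0 i) /\ \sum_i t ord0 i <= 1].

Lemma simplex_vertex0 M p : simplex_vertex M p ord0 = p.
Proof. by rewrite /simplex_vertex unlift_none. Qed.

Lemma simplex_vertexS M p j : simplex_vertex M p (lift ord0 j) = p + row j M.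
Proof. by rewrite /simplex_vertex liftK. Qed.

Lemma simplex_vertex_comb M p (w : 'I_n.+1 -> R) :
  \sum_i w i *: simplex_vertex M p i =
  (\sum_i w i) *: p + (\row_j w (lift ord0 j)) *m M.
Proof.
rewrite !big_ord_recl simplex_vertex0 scalerDl -addrA; congr (_ + _).
rewrite mulmx_sum_row scaler_suml -big_split; apply: eq_bigr => j _ /=.
by rewrite simplex_vertexS mxE scalerDr.
Qed.

Lemma simplex_vertex_independent M p : \det M != 0 ->
  affinely_independent (simplex_vertex M p).
Proof.
move=> detM w w0; rewrite simplex_vertex_comb w0 scale0r add0r => wM.
have uM : M \in unitmx by rewrite unitmxE unitfE.
have wl j : w (lift ord0 j) = 0.
  have /rowP/(_ j) : (\row_j w (lift ord0 j)) = 0 :> 'rV[R]_n.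
    by rewrite -[LHS](mulmxK uM) wM mul0mx.
  by rewrite !mxE.
move: w0; rewrite big_ord_recl (eq_bigr (fun=> 0)) ?big1_eq ?addr0//.
by move=> w0 i; case: (unliftP ord0 i) => [j|] ->.
Qed.

Lemma conv_simplexE M p t : \det M != 0 ->
  conv_hull (simplex_vertex M p) (t *m M + p) <-> standard_simplex t.
Proof.
move=> detM; have uM : M \in unitmx by rewrite unitmxE unitfE.
split.
  move=> [w [w0 w1]]; rewrite simplex_vertex_comb w1 scale1r addrC => /addrI.
  move=> /(can_inj (mulmxK uM)) ->; split=> [i|]; first by rewrite mxE.
  under eq_bigr do rewrite mxE.
  by move: w1; rewrite big_ord_recl => <-; rewrite lerDr.
move=> [t0 t1]; pose w i := if unlift ord0 i is Some j then t ord0 j else 1 - \sum_i t ord0 i.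
have wl j : w (lift ord0 j) = t ord0 j by rewrite /w liftK.
have w1 : \sum_i w i = 1.
  rewrite big_ord_recl (eq_bigr _ (fun j _ => wl j)) /w unlift_none subrK//.
exists w; split=> //.
  by move=> i; rewrite /w; case: unliftP => [j _|_]; rewrite ?subr_ge0.
rewrite simplex_vertex_comb w1 scale1r addrC; congr (_ + _ *m _).
by apply: eq_rV => j; rewrite mxE wl.
Qed.

Lemma measurable_standard_simplex : measurable standard_simplex.
Proof.
rewrite (_ : standard_simplex = (\bigcap_(i in [set: 'I_n]) [set t : 'rV[R]_n | 0 <= t ord0 i])
    `&` [set t | \sum_i t ord0 i <= 1]); last first.
  apply/seteqP; split=> x [x0 x1]; split=> //; first by move=> i _; exact: x0.
  by move=> i; exact: (x0 i I).
apply: measurableI.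
  apply: fin_bigcap_measurable => // i _; apply: measurable_ler_set => //.
  exact: measurable_coord_rV.
apply: measurable_ler_set => //; apply: measurable_sum => i.
exact: measurable_coord_rV.
Qed.

Lemma measurable_simplex M p : \det M != 0 ->
  measurable (conv_hull (simplex_vertex M p)).
Proof.
move=> detM; have uM : M \in unitmx by rewrite unitmxE unitfE.
rewrite (_ : conv_hull _ =
    (fun x => x *m invmx M + - (p *m invmx M)) @^-1` standard_simplex).
  rewrite -[X in measurable X]setTI.
  by apply: measurable_affine_rV => //; exact: measurable_standard_simplex.
apply/seteqP; split=> x /=; rewrite -mulmxBl -(conv_simplexE p _ detM) -mulmxA mulVmx// mulmx1 subrK//.
Qed.

Lemma volume_simplex M p : \det M != 0 ->
  (vol (conv_hull (simplex_vertex M p)) = `|\det M|%:E * vol standard_simplex)%E.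
Proof.
move=> detM.
have indE (S : set 'rV[R]_n) : measurable S -> (vol S = \int[vol]_x (\1_S x)%:E)%E.
  by move=> mS; rewrite integral_indic// setIT.
rewrite indE ?indE; [|exact: measurable_standard_simplex|exact: measurable_simplex].
rewrite -(change_of_variables_unit detM p (f := fun x => (\1_(conv_hull (simplex_vertex M p)) x)%:E))//.
  congr (_ * _)%E; apply: eq_integral => x _; rewrite !indicE; congr ((nat_of_bool _)%:R%:E).
  by apply/idP/idP; rewrite !inE => /conv_simplexE; apply.
by apply/measurable_EFinP; apply: measurable_indic; exact: measurable_simplex.
Qed.

Lemma measurable_box (A : 'I_n -> set R) : (forall i, measurable (A i)) ->
  measurable [set x : 'rV[R]_n | forall i, A i (x ord0 i)].
Proof.
move=> mA; rewrite (_ : [set x | _] = \bigcap_(i in [set: 'I_n]) ((fun x => x ord0 i) @^-1` A i)).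
  apply: fin_bigcap_measurable => // i _; rewrite -[X in measurable X]setTI.
  exact: measurable_coord_rV.
by apply/seteqP; split=> [x h j _|x h j]; [exact: h|exact: (h j I)].
Qed.

(** The cube [0, 1/n]^n lies inside; n^(-n) falls short of the exact 1 / n! by at most a factor e^n,
    which the absolute constant absorbs. *)
Lemma volume_standard_simplex_ge : (0 < n)%N ->
  ((n%:R^-1 ^+ n)%:E <= vol standard_simplex)%E.
Proof.
move=> n0; pose A (i : 'I_n) : set R := `[0, n%:R^-1]%classic.
have nR : 0 < n%:R :> R by rewrite ltr0n.
have <- : vol [set x : 'rV[R]_n | forall i, A i (x ord0 i)] = (n%:R^-1 ^+ n)%:E.
  rewrite lebesgue_rV_box; last by move=> i; exact: measurable_itv.
  under eq_bigr do rewrite lebesgue_measure_itv/= lte_fin invr_gt0 nR sube0.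
  by rewrite prodEFin prodr_const card_ord.
apply: le_measure; rewrite ?inE; [|exact: measurable_standard_simplex|].
  by apply: measurable_box => i; exact: measurable_itv.
move=> x Ax; split=> [i|].
  by have := Ax i; rewrite /A /= in_itv/= => /andP[].
apply: (@le_trans _ _ (\sum_(i < n) n%:R^-1)).
  by apply: ler_sum => i _; have := Ax i; rewrite /A /= in_itv/= => /andP[].
by rewrite sumr_const card_ord -[_ *+ n]mulr_natl divff// gt_eqF.
Qed.

Lemma volume_standard_simplex_fin : (vol standard_simplex < +oo)%E.
Proof.
pose A (i : 'I_n) : set R := `[0, 1]%classic.
apply: (@le_lt_trans _ _ (vol [set x : 'rV[R]_n | forall i, A i (x ord0 i)])).
  apply: le_measure; rewrite ?inE; [exact: measurable_standard_simplex| |].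
    by apply: measurable_box => i; exact: measurable_itv.
  move=> x [x0 x1] i; rewrite /A /= in_itv/= x0/=; apply: le_trans x1.
  by rewrite (bigD1 i)//= lerDl sumr_ge0.
rewrite lebesgue_rV_box; last by move=> i; exact: measurable_itv.
under eq_bigr do rewrite lebesgue_measure_itv/= lte_fin ltr01 sube0.
by rewrite prodEFin ltry.
Qed.

Lemma integral_volume_preserving (A : 'M[R]_n) (f : 'rV[R]_n -> \bar R) :
  `|\det A| = 1 -> measurable_fun setT f ->
  (\int[vol]_x f (x *m A) = \int[vol]_x f x)%E.
Proof.
move=> detA mf.
have A0 : \det A != 0 by rewrite -normr_eq0 detA oner_eq0.
have ge0 (g : 'rV[R]_n -> \bar R) : measurable_fun setT g -> (forall x, 0 <= g x)%E ->
    (\int[vol]_x g (x *m A) = \int[vol]_x g x)%E.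
  move=> mg g0; rewrite -(change_of_variables_unit A0 0 mg g0) detA mul1e.
  by under [RHS]eq_integral => x _ do rewrite addr0.
rewrite [LHS]integralE [RHS]integralE; congr (_ - _)%E.
  rewrite -[RHS]ge0//; last exact: measurable_funepos.
  by apply: eq_integral => x _; rewrite !funeposE.
rewrite -[RHS]ge0//; last exact: measurable_funeneg.
by apply: eq_integral => x _; rewrite !funenegE.
Qed.

(** Substituting x A for x in the integral of x over [T] changes neither the domain nor the
    measure. *)
Lemma vec_integral_invariant (T : set 'rV[R]_n) (A : 'M[R]_n) :
  measurable T -> (exists M : R, forall x, T x -> forall i, `|x ord0 i| <= M) ->
  (vol T < +oo)%E -> `|\det A| = 1 ->
  (forall x, T (x *m A) <-> T x) ->
  vec_integral T *m A = vec_integral T.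
Proof.
move=> mT [M TM] Tfin detA TA.
have Tint i : vol.-integrable T (EFin \o (fun x : 'rV[R]_n => x ord0 i)).
  apply: measurable_bounded_integrable => //.
    by apply: measurable_funTS; exact: measurable_coord_rV.
  exists M; split; first exact: num_real.
  by move=> x Mx y Ty /=; apply: le_trans (ltW Mx); exact: TM.
apply: eq_rV => k; rewrite [LHS]mxE [RHS]mxE.
under eq_bigr do rewrite mxE.
have -> : \int[vol]_(x in T) x ord0 k = \int[vol]_(x in T) (x *m A) ord0 k.
  rewrite /Rintegral; congr fine; rewrite [LHS]integral_mkcond [RHS]integral_mkcond.
  rewrite -(integral_volume_preserving detA); last first.
    apply/(measurable_restrictT _ mT).
    by apply/measurable_EFinP; apply: measurable_funTS; exact: measurable_coord_rV.
  apply: eq_integral => x _; rewrite !patchE.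
  by rewrite (_ : (x *m A \in T) = (x \in T))//; apply/idP/idP; rewrite !inE TA.
rewrite /Rintegral; under [in RHS]eq_integral => x _ do rewrite mxE -sumEFin.
rewrite integral_sum//; last first.
  by move=> i; under eq_fun do rewrite EFinM muleC; exact: integrableZl (Tint i).
rewrite (eq_bigr (fun i => (A i k * \int[vol]_(x in T) x ord0 i)%:E)); last first.
  move=> i _; under eq_integral => x _ do rewrite EFinM muleC.
  rewrite (integralZl mT (Tint i)) EFinM; congr (_ * _)%E; rewrite /Rintegral fineK//.
  exact: integrable_fin_num (Tint i).
by rewrite sumEFin /=; apply: eq_bigr => i _; rewrite mulrC.
Qed.
Lemma conv_hull_bounded v :
  exists M : R, forall x, conv_hull v x -> forall i, `|x ord0 i| <= M.
Proof.
exists (\sum_j \sum_k `|v j ord0 k|) => x [w [w0 w1 ->]] i.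
rewrite summxE; apply: le_trans (ler_norm_sum _ _ _) _; apply: ler_sum => j _.
rewrite mxE normrM (ger0_norm (w0 j)).
apply: (@le_trans _ _ `|v j ord0 i|).
  by rewrite ler_piMl// -w1 (bigD1 j)//= lerDl sumr_ge0.
by rewrite (bigD1 i)//= lerDl sumr_ge0.
Qed.

Lemma conv_hull_vertex v i : conv_hull v (v i).
Proof.
exists (fun j => (j == i)%:R); split=> [j||]; first by rewrite ler0n.
  by rewrite (bigD1 i)//= eqxx big1 ?addr0// => j /negbTE ->.
by rewrite (bigD1 i)//= eqxx scale1r big1 ?addr0// => j /negbTE ->; rewrite scale0r.
Qed.

(* The linear maps A k that permute the vertices cyclically preserve the
   simplex, hence its barycenter, and their sum is zero. *)
Lemma barycenter_simplex M p : (0 < n)%N -> \det M != 0 ->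
  \sum_i simplex_vertex M p i = 0 ->
  barycenter (conv_hull (simplex_vertex M p)) = 0.
Proof.
move=> n0 detM; set v := simplex_vertex M p => sumv; set T := conv_hull v.
have mT : measurable T by exact: measurable_simplex.
have vind : affinely_independent v by exact: simplex_vertex_independent.
have volT : vol T = (`|\det M|%:E * vol standard_simplex)%E by exact: volume_simplex.
have Tfin : (vol T < +oo)%E.
  by rewrite volT lte_mul_pinfty// ?lee_fin// volume_standard_simplex_fin.
have T0 : (0 < vol T)%E.
  rewrite volT mule_gt0 ?lte_fin ?normr_gt0//.
  by apply: lt_le_trans (volume_standard_simplex_ge n0); rewrite lte_fin exprn_gt0// invr_gt0 ltr0n.
(* Indices are added modulo n + 1: the rows are v_1, ..., v_n with indices shifted by k. *)
pose U (k : 'I_n.+1) : 'M[R]_n := \matrix_i v (lift ord0 i + k).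
have uU : U 0 \in unitmx.
  rewrite -row_free_unit; apply: inj_row_free => y yU.
  (* As the vertices sum to 0, subtracting c from every weight turns a linear relation among v_1,
     ..., v_n into one among all vertices with weights of sum 0. Affine independence applies, and
     the weight -c at v_0 forces c = 0. *)
  pose c : R := (\sum_i y ord0 i) / n.+1%:R.
  pose w i := (if unlift ord0 i is Some j then y ord0 j else 0) - c.
  have wl j : w (lift ord0 j) = y ord0 j - c by rewrite /w liftK.
  have wo : w ord0 = - c by rewrite /w unlift_none sub0r.
  have w0 : \sum_i w i = 0.
    rewrite big_ord_recl (eq_bigr _ (fun j _ => wl j)) wo sumrB sumr_const card_ord.
    rewrite /c -[_ *+ n]mulr_natr -natr1; field.
    by rewrite natr1 pnatr_eq0.
  have wv : \sum_i w i *: v i = 0.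
    have -> : \sum_i w i *: v i = \sum_i (w i + c) *: v i - c *: \sum_i v i.
      by rewrite scaler_sumr -sumrB; apply: eq_bigr => i _; rewrite scalerDl addrK.
    rewrite sumv scaler0 subr0 big_ord_recl wo addNr scale0r add0r -[RHS]yU mulmx_sum_row.
    by apply: eq_bigr => j _; rewrite wl subrK rowK addr0.
  have c0 : c = 0 by apply: oppr_inj; rewrite -wo oppr0; exact: vind.
  apply: eq_rV => j; have := vind w w0 wv (lift ord0 j).
  by rewrite wl c0 subr0 mxE.
pose A k := invmx (U 0) *m U k.
have UA k : U 0 *m A k = U k by rewrite mulmxA mulmxV// mul1mx.
have sumvk k : \sum_i v (i + k) = 0.
  by rewrite -[RHS]sumv [RHS](reindex_inj (addIr k)).
have vA j k : v j *m A k = v (j + k).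
  have vlA i : v (lift ord0 i) *m A k = v (lift ord0 i + k).
    have := congr1 (row i) (UA k); rewrite row_mul !rowK addr0.
    by [].
  case: (unliftP ord0 j) => [i|] ->; first exact: vlA.
  (* [A k] is prescribed on v_1, ..., v_n only; its value at v_0 follows because the vertices sum to
     0. *)
  have v0E : v ord0 = - \sum_i v (lift ord0 i).
    by apply/eqP; rewrite -addr_eq0 -big_ord_recl sumv.
  have vkE : v (ord0 + k) = - \sum_i v (lift ord0 i + k).
    by apply/eqP; rewrite -addr_eq0 -(big_ord_recl n (fun i : 'I_n.+1 => v (i + k))) sumvk.
  rewrite v0E vkE mulNmx mulmx_suml; congr (- _).
  by apply: eq_bigr => i _; exact: vlA.
have AA k : A k *m A (- k) = 1%:M.
  apply: (can_inj (mulKmx uU)); rewrite mulmx1 mulmxA UA; apply/row_matrixP => i.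
  by rewrite row_mul !rowK vA addrK addr0.
have TA k x : T x -> T (x *m A k).
  move=> [w [w0 w1 ->]]; exists (fun j => w (j - k)); split=> //.
    by rewrite -w1 [RHS](reindex_inj (addIr (- k))).
  rewrite mulmx_suml [RHS](reindex_inj (addIr k)); apply: eq_bigr => j _.
  by rewrite -scalemxAl vA addrK.
have TAE k x : T (x *m A k) <-> T x.
  by split=> [/(TA (- k))|/(TA k)//]; rewrite -mulmxA AA mulmx1.
(* A linear bijection of [T], a set of positive finite volume, onto itself preserves volume. *)
have detA k : `|\det (A k)| = 1.
  have detA0 : \det (A k) != 0.
    have := congr1 determinant (AA k); rewrite det_mulmx det1 => h.
    by apply/eqP => d0; move: h; rewrite d0 mul0r => /esym/eqP; rewrite oner_eq0.
  have volE : (vol T = \int[vol]_x (\1_T x)%:E)%E by rewrite integral_indic// setIT.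
  have mind : measurable_fun setT (fun x => (\1_T x)%:E : \bar R).
    by apply/measurable_EFinP; exact: measurable_indic.
  have ind0 x : (0 <= (\1_T x)%:E :> \bar R)%E by [].
  have := change_of_variables_unit detA0 0 mind ind0.
  rewrite (_ : (\int[vol]_x _ = vol T)%E); last first.
    rewrite volE; apply: eq_integral => x _; rewrite addr0 !indicE.
    by congr ((nat_of_bool _)%:R%:E); apply/idP/idP; rewrite !inE TAE.
  rewrite -volE => h.
  have fT : vol T = (fine (vol T))%:E by rewrite fineK// ge0_fin_numE.
  move: h; rewrite fT -EFinM => -[] /(canRL (mulfK _)) ->.
    by rewrite divff// gt_eqF// fine_gt0// T0.
  by rewrite gt_eqF// fine_gt0// T0.
have inv k : vec_integral T *m A k = vec_integral T.
  by apply: vec_integral_invariant => //; exact: conv_hull_bounded.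
suff b0 : vec_integral T = 0 by rewrite /barycenter b0 scaler0.
have sumA : \sum_k A k = 0.
  apply: (can_inj (mulKmx uU)); rewrite mulmx0 mulmx_sumr; under eq_bigr do rewrite UA.
  apply/row_matrixP => i; rewrite row0 raddf_sum /=; under eq_bigr do rewrite rowK addrC.
  exact: sumvk.
have : vec_integral T *m (\sum_k A k) = vec_integral T *+ n.+1.
  by rewrite mulmx_sumr (eq_bigr _ (fun k _ => inv k)) sumr_const card_ord.
rewrite sumA mulmx0 -scaler_nat => /esym/eqP; rewrite scaler_eq0 pnatr_eq0 => /eqP.
by [].
Qed.

Lemma convex_conv_hull (K : set 'rV[R]_n) m (u : 'I_m -> 'rV[R]_n) :
  convex_set K -> (forall i, K (u i)) -> conv_hull u `<=` K.
Proof.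
move=> cK; elim: m u => [|m IH] u Ku x [w [w0 w1 ->]].
  by move: w1; rewrite big_ord0 => /esym/eqP; rewrite oner_eq0.
rewrite big_ord_recl; rewrite big_ord_recl in w1.
pose s := \sum_(i < m) w (lift ord0 i).
have s0 : 0 <= s by apply: sumr_ge0.
have w0E : w ord0 = 1 - s by rewrite -w1 addrK.
have [sE|sN] := eqVneq s 0.
  rewrite big1 => [|i _]; first by rewrite w0E sE subr0 scale1r addr0.
  have := sE; rewrite /s => /eqP; rewrite psumr_eq0// => /allP/(_ i).
  by rewrite mem_index_enum => /(_ isT)/eqP ->; rewrite scale0r.
have sp : 0 < s by rewrite lt_neqAle eq_sym sN.
have Ky : K (\sum_(i < m) (w (lift ord0 i) / s) *: u (lift ord0 i)).
  apply: (IH (fun i => u (lift ord0 i))); first by move=> i; exact: Ku.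
  exists (fun i => w (lift ord0 i) / s); split=> // [i|]; first by rewrite divr_ge0.
  by rewrite -mulr_suml divff.
have s1 : s <= 1 by rewrite -subr_ge0 -w0E.
have := convex_setE cK (Ku ord0) Ky (t := s); rewrite s0 s1 => /(_ isT).
rewrite w0E scaler_sumr; congr (K (_ + _)); apply: eq_bigr => i _.
by rewrite scalerA mulrCA divff// mulr1.
Qed.
End simplices.

(** * The random simplex *)

Section random_simplex.
Context {R : realType} (n : nat).
Hypothesis n0 : (0 < n)%N.
Implicit Types (x : 'I_n -> 'rV[R]_n) (s : R).

(* Singular configurations are sent to the identity frame, for f to be total. *)
Definition frame x : 'M[R]_n :=
  let M := \matrix_i x i in if \det M == 0 then 1%:M else M.

(* Chosen so that the vertices of random_simplex sum to zero. *)
Definition centered_base s x : 'rV[R]_n := - ((s / n.+1%:R) *: \sum_i row i (frame x)).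

Definition random_simplex s x : set 'rV[R]_n :=
  conv_hull (simplex_vertex (s *: frame x) (centered_base s x)).

Lemma det_frame s x : s != 0 -> \det (s *: frame x) != 0.
Proof.
move=> s0; rewrite detZ mulf_neq0 ?expf_neq0// /frame.
by have [_|//] := eqVneq (\det (\matrix_i x i)) 0; rewrite det1 oner_neq0.
Qed.

Lemma centered_random_simplex s x : s != 0 -> centered_simplex (random_simplex s x).
Proof.
move=> s0; split.
  exists (simplex_vertex (s *: frame x) (centered_base s x)); split=> //.
  exact/simplex_vertex_independent/det_frame.
apply: barycenter_simplex => //; first exact: det_frame.
transitivity (\sum_i (1 : R) *: simplex_vertex (s *: frame x) (centered_base s x) i).
  by apply: eq_bigr => i _; rewrite scale1r.
rewrite simplex_vertex_comb sumr_const card_ord /centered_base scalerN scalerA.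
rewrite mulrCA divff ?mulr1; last by rewrite pnatr_eq0.
rewrite -scalemxAr mulmx_sum_row [X in _ + s *: X](eq_bigr (fun i => row i (frame x))).
  by rewrite addNr.
by move=> i _; rewrite mxE scale1r.
Qed.

(** Reduces inclusion to n + 1 point conditions, the form in which it is both proved and seen to be
    measurable in the sample. *)
Lemma random_simplex_subset s x (K : set 'rV[R]_n) : convex_set K ->
  random_simplex s x `<=` K <->
  forall i, K (simplex_vertex (s *: frame x) (centered_base s x) i).
Proof.
move=> cK; split=> [SK i|SK]; first exact/SK/conv_hull_vertex.
exact: convex_conv_hull.
Qed.

Lemma volume_random_simplex s x : s != 0 ->
  (lebesgue_rV R n (random_simplex s x) =
   `|\det (s *: frame x)|%:E * lebesgue_rV R n standard_simplex)%E.
Proof. by move=> s0; apply: volume_simplex; exact: det_frame. Qed.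

Context d (Omega : measurableType d) (P : probability Omega R).
Variable X : 'I_n -> {RV P >-> 'rV[R]_n}.

Let Xw w (i : 'I_n) : 'rV[R]_n := X i w.

Lemma measurable_frame i j : measurable_fun setT (fun w => frame (Xw w) i j).
Proof.
have mXij a b : measurable_fun setT (fun w => X a w ord0 b).
  by apply: (measurableT_comp (measurable_coord_rV b)).
have mdet : measurable_fun setT (fun w => \det (\matrix_i Xw w i)).
  by apply: measurable_det => a b; under eq_fun do rewrite mxE; exact: mXij.
rewrite (_ : (fun w => _) = fun w => if \det (\matrix_i Xw w i) == 0 then (1%:M : 'M[R]_n) i j else X i w ord0 j).
  apply: measurable_fun_if => //; first exact: measurable_fun_eqr.
  exact: measurable_funTS (mXij i j).
by apply/funext => w; rewrite /frame; case: ifP => // _; rewrite mxE.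
Qed.

Lemma measurable_random_vertex s i : measurable_fun setT
  (fun w => simplex_vertex (s *: frame (Xw w)) (centered_base s (Xw w)) i).
Proof.
apply: measurable_fun_rVP => k.
have mbase : measurable_fun setT (fun w => centered_base s (Xw w) ord0 k).
  under eq_fun => w do rewrite /centered_base !mxE summxE.
  apply: measurable_funN; apply: measurable_funM => //.
  apply: measurable_sum => a; under eq_fun => w do rewrite mxE.
  exact: measurable_frame.
case: (unliftP ord0 i) => [j|] ->; last by under eq_fun => w do rewrite simplex_vertex0.
under eq_fun => w do rewrite simplex_vertexS mxE.
apply: measurable_funD => //; under eq_fun => w do rewrite !mxE.
by apply: measurable_funM => //; exact: measurable_frame.
Qed.

Lemma measurable_random_simplex_event s c (K : set 'rV[R]_n) : s != 0 ->
  convex_set K -> measurable K ->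
  measurable [set w | [/\ centered_simplex (random_simplex s (Xw w)),
    random_simplex s (Xw w) `<=` K &
    (c%:E <= lebesgue_rV R n (random_simplex s (Xw w)))%E]].
Proof.
move=> s0 cK mK.
rewrite (_ : [set w | _] = (\bigcap_(i in [set: 'I_n.+1])
    ((fun w => simplex_vertex (s *: frame (Xw w)) (centered_base s (Xw w)) i) @^-1` K)) `&`
    [set w | c%:E <= `|\det (s *: frame (Xw w))|%:E * lebesgue_rV R n standard_simplex]%E).
  apply: measurableI.
    apply: fin_bigcap_measurable => // i _; rewrite -[X in measurable X]setTI.
    exact: measurable_random_vertex.
  have mf : measurable_fun setT
      (fun w => `|\det (s *: frame (Xw w))|%:E * lebesgue_rV R n standard_simplex)%E.
    have fS := volume_standard_simplex_fin (R := R) (n := n).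
    rewrite (_ : lebesgue_rV R n standard_simplex = (fine (lebesgue_rV R n standard_simplex))%:E); last first.
      by rewrite fineK// ge0_fin_numE.
    apply/measurable_EFinP; apply: measurable_funM => //; apply: measurableT_comp => //.
    apply: measurable_det => i j; under eq_fun => w do rewrite mxE.
    by apply: measurable_funM => //; exact: measurable_frame.
  by have := emeasurable_fun_c_infty measurableT mf c%:E; rewrite setTI.
apply/seteqP; split=> w /=.
  move=> [_ /random_simplex_subset SK]; rewrite volume_random_simplex// => cS.
  by split=> // i _; exact: SK.
move=> [SK cS]; split.
- exact: centered_random_simplex.
- by apply/random_simplex_subset => // i; exact: (SK i I).
- by rewrite volume_random_simplex.
Qed.
End random_simplex.

(** * Absolute constants *)

Section constants.
Context {R : realType}.

(** The weight s for which each vertex is a convex combination, s X_j + (1 - s) y, with y in the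
    ball inside [K]; see [simplex_in_body]. *)
Definition shrinkage : R := (1 + sum_ratio / tail_point)^-1.

(** The square undoes the power -1/2 in Markov's inequality; the factors e and 4 produce the
    probability e^(-n) / 4. *)
Definition determinant_ratio : R := (4 * expR 1 * inv_sqrt_constant) ^- 2.

(** The factor 1/2 comes from sqrt(n!) >= n^(n/2) / 2^n. *)
Definition volume_ratio : R := shrinkage * determinant_ratio / 2.

Lemma shrinkage_gt0 : 0 < shrinkage.
Proof. by rewrite invr_gt0 addr_gt0// divr_gt0 ?sum_ratio_gt0 ?tail_point_gt0. Qed.

Lemma inv_sqrt_constant_gt0 : 0 < inv_sqrt_constant :> R.
Proof.
by rewrite addr_gt0// mulr_gt0// divr_gt0// mulr_gt0// ?tail_point_gt0 ?tail_mass_gt0.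
Qed.

Lemma determinant_ratio_gt0 : 0 < determinant_ratio.
Proof.
by rewrite invr_gt0 exprn_gt0// !mulr_gt0// ?expR_gt0 ?inv_sqrt_constant_gt0.
Qed.

Lemma volume_ratio_gt0 : 0 < volume_ratio.
Proof. by rewrite !mulr_gt0 ?shrinkage_gt0 ?determinant_ratio_gt0. Qed.

(** n^n / n! is one term of the series of e^n, and e <= 4. *)
Lemma factorial_lower_bound n : (0 < n)%N -> (n%:R ^+ n : R) <= 4 ^+ n * (n`!)%:R.
Proof.
case: n => // n _; have := expR_ge1Dxn n (ler0n R n.+1).
have e1 : expR 1 <= 4 :> R.
  have -> : expR 1 = expR (2^-1) ^+ 2 :> R by rewrite -expRM_natl divff.
  rewrite (_ : 4 = 2 ^+ 2); last by ring.
  by rewrite lerXn2r ?nnegrE ?expR_ge0// expR_half_le2.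
have -> : expR n.+1%:R = expR 1 ^+ n.+1 :> R by rewrite -expRM_natl mulr1.
move=> h; rewrite -ler_pdivrMr ?ltr0n ?fact_gt0//.
apply: (@le_trans _ _ (expR 1 ^+ n.+1)); first by lra.
by rewrite lerXn2r ?nnegrE ?expR_ge0.
Qed.

Lemma powR_half_sqrt n : (n%:R : R) `^ (n%:R / 2) = Num.sqrt (n%:R ^+ n).
Proof.
by rewrite powRrM powR12_sqrt ?powR_ge0// powR_mulrn.
Qed.
End constants.

(** * Determinant, inclusion and volume on the good event *)

Section good_event.
Context d (Omega : measurableType d) (R : realType) (P : probability Omega R).
Context (n : nat) (X : 'I_n -> {RV P >-> 'rV[R]_n}) (K : set 'rV[R]_n) (L : R).
Hypothesis n0 : (0 < n)%N.
Hypothesis isoK : isotropic K L.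
Hypothesis unifX : forall i, uniform_on K (X i).
Hypothesis indX : independent_RVs X.

Lemma distribution_uniformE i A : measurable A ->
  distribution P (X i) A = lebesgue_rV R n (A `&` K).
Proof.
move=> mA; have [_ vK _ _ _] := isoK.
by rewrite unifX// vK invr1 mul1e.
Qed.

Let L0 : 0 < L. Proof. by case: isoK. Qed.

(** Markov's inequality for |det|^(-1/2) at level tau^(-1/2); the full matrix is the minor whose two
    injections are the identity. *)
Lemma determinant_tail :
  (P [set w | `|\det (\matrix_i X i w)| <=
      determinant_ratio ^+ n * L ^+ n * Num.sqrt (n`!)%:R]%R
   <= (4^-1 * expR (- n%:R))%:E)%E.
Proof.
pose tau : R := determinant_ratio ^+ n * L ^+ n * Num.sqrt (n`!)%:R.
rewrite -/tau; set A := [set w | _].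
have sL : 0 < Num.sqrt L by rewrite sqrtr_gt0.
have C0 := @inv_sqrt_constant_gt0 R.
pose a := inv_sqrt_constant / Num.sqrt L.
have a0 : 0 < a by rewrite divr_gt0.
have moment := @determinant_moment _ _ _ P n X indX a a0
  (fun i theta th1 => inv_sqrt_moment (uniform_isotropic_marginal isoK (distribution_uniformE i) th1))
  n id id (fun _ _ => id) (fun _ _ => id).
pose D w := \det (\matrix_(i < n, j < n) X i w ord0 j).
have DE w : \det (\matrix_i X i w) = D w.
  by congr (\det _); apply/matrixP => i j; rewrite !mxE.
have mD : measurable_fun setT D.
  apply: measurable_det => i j; under eq_fun do rewrite mxE.
  by apply: (measurableT_comp (measurable_coord_rV j)).
have f0 : 0 < (n`!)%:R :> R by rewrite ltr0n fact_gt0.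
have tau0 : 0 < tau.
  by rewrite !mulr_gt0 ?exprn_gt0 ?sqrtr_gt0// determinant_ratio_gt0.
have mA : measurable A.
  rewrite (_ : A = [set w | `|D w| <= tau]).
    by apply: measurable_ler_set => //; exact: measurableT_comp.
  by apply/seteqP; split=> w; rewrite /A /= DE.
have st0 : 0 < Num.sqrt tau by rewrite sqrtr_gt0.
have key : (((Num.sqrt tau)^-1)%:E * P A <= (a ^+ n / Num.sqrt (Num.sqrt (n`!)%:R))%:E)%E.
  apply: le_trans moment.
  have m1 : measurable_fun setT (fun w => inv_sqrt (D w)) by exact: (measurableT_comp measurable_inv_sqrt).
  have i0 : (0 <= ((Num.sqrt tau)^-1)%:E :> \bar R)%E by rewrite lee_fin invr_ge0 ltW.
  apply: le_trans (markov_ge0 P m1 (fun w => inv_sqrt_ge0 (D w)) i0).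
  apply: lee_wpmul2l => //; apply: le_measure; rewrite ?inE//.
    by have := emeasurable_fun_c_infty measurableT m1 ((Num.sqrt tau)^-1)%:E; rewrite setTI.
  move=> w; rewrite /A /= DE => Dtau; rewrite /inv_sqrt; case: ifPn => [_|D0]; first exact: leey.
  by rewrite lee_fin lef_pV2 ?posrE ?sqrtr_gt0 ?normr_gt0// ler_wsqrtr.
rewrite -(@lee_pmul2l _ ((Num.sqrt tau)^-1)%:E)//; last by rewrite lte_fin invr_gt0.
apply: le_trans key _; rewrite -EFinM lee_fin.
pose q : R := 4 * expR 1 * inv_sqrt_constant.
have q0 : 0 < q by rewrite !mulr_gt0// expR_gt0.
have sqrtX (x : R) m : 0 <= x -> Num.sqrt (x ^+ m) = Num.sqrt x ^+ m.
  move=> x0; elim: m => [|m IH]; first by rewrite !expr0 sqrtr1.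
  by rewrite !exprS sqrtrM// IH.
have tauE : Num.sqrt tau = q^-1 ^+ n * Num.sqrt L ^+ n * Num.sqrt (Num.sqrt (n`!)%:R).
  have r0 := ltW (@determinant_ratio_gt0 R).
  rewrite /tau sqrtrM ?mulr_ge0 ?exprn_ge0 ?(ltW L0)// sqrtrM ?exprn_ge0//.
  rewrite !sqrtX ?(ltW L0)// /determinant_ratio -/q -exprVn sqrtr_sqr ger0_norm//.
  by rewrite invr_ge0 ltW.
rewrite tauE /a expr_div_n.
have F0 : 0 < Num.sqrt (Num.sqrt (n`!)%:R) :> R by rewrite !sqrtr_gt0.
have SL0 : 0 < Num.sqrt L ^+ n by rewrite exprn_gt0.
have -> : (q^-1 ^+ n * Num.sqrt L ^+ n * Num.sqrt (Num.sqrt n`!%:R))^-1 * (4^-1 * expR (- n%:R)) =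
    q ^+ n * (4^-1 * expR (- n%:R)) / Num.sqrt L ^+ n / Num.sqrt (Num.sqrt n`!%:R).
  by rewrite exprVn; field; rewrite !gt_eqF// exprn_gt0.
rewrite ler_pM2r ?invr_gt0// ler_pM2r ?invr_gt0//.
have eE : expR 1 ^+ n * expR (- n%:R) = 1 :> R by rewrite -expRM_natl mulr1 -expRD subrr expR0.
have -> : q ^+ n * (4^-1 * expR (- n%:R)) =
    inv_sqrt_constant ^+ n * (4 ^+ n * 4^-1) * (expR 1 ^+ n * expR (- n%:R)).
  by rewrite /q !exprMn; ring.
(* What remains is 4^n / 4 >= 1, where n >= 1 enters. *)
rewrite eE mulr1 ler_pMr ?exprn_gt0// ler_pdivlMr// mul1r.
by case: n n0 => // m _; rewrite exprS ler_peMr// exprn_ege1// ler1n.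
Qed.

(** With C = [sum_ratio / tail_point], s = 1 / (1 + C) and b the sum of the X_i divided by (n+1) C,
    the vertices are (1 - s) (-b) + s X_j and (1 - s) (-b) + s 0. The division by C brings |b| below
    [tail_point * L], so -b and 0 lie in the ball inside [K]. *)
Lemma simplex_in_body w : (forall i, K (X i w)) ->
  \det (\matrix_i X i w) != 0 ->
  dotp (\sum_i X i w) (\sum_i X i w) < (sum_ratio * n%:R * L) ^+ 2 ->
  random_simplex shrinkage (fun i => X i w) `<=` K.
Proof.
move=> KX detX sumX; have [[cK convK _] _ _ _ _] := isoK.
have ball p : dotp p p <= (tail_point * L) ^+ 2 -> K p.
  move=> pL; pose i0 := Ordinal n0.
  exact: (isotropic_contains_ball isoK (distribution_uniformE i0)).
have tp0 := @tail_point_gt0 R.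
pose C : R := sum_ratio / tail_point; have C0 : 0 < C by rewrite divr_gt0 ?sum_ratio_gt0.
have sE : shrinkage = (1 + C)^-1 by [].
have C1 : 1 + C != 0 by rewrite gt_eqF// addr_gt0.
have frameE : frame (fun i => X i w) = \matrix_i X i w by rewrite /frame (negbTE detX).
have n1 : 0 < n.+1%:R :> R by rewrite ltr0n.
pose b : 'rV[R]_n := (n.+1%:R * C)^-1 *: \sum_i X i w.
have Kb : K (- b).
  apply: ball; rewrite dotpNl dotpNr opprK /b dotpZl dotpZr mulrA -expr2.
  apply: le_trans (ler_wpM2l (sqr_ge0 _) (ltW sumX)) _.
  have bound : (n.+1%:R * C)^-1 * (sum_ratio * n%:R * L) <= tail_point * L.
    rewrite ler_pdivrMl; last exact: mulr_gt0.
    rewrite (_ : n.+1%:R * C * (tail_point * L) = sum_ratio * n.+1%:R * L); last first.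
      by rewrite /C; field; rewrite gt_eqF.
    by rewrite ler_pM2r// ler_pM2l ?sum_ratio_gt0// ler_nat.
  rewrite -[X in X <= _]exprMn; apply: lerXn2r bound; rewrite nnegrE.
    apply: mulr_ge0; first by rewrite invr_ge0; apply: mulr_ge0 => //; exact: ltW.
    by apply: mulr_ge0; [apply: mulr_ge0 => //; exact/ltW/sum_ratio_gt0|exact: ltW].
  by apply: mulr_ge0; exact: ltW.
have K0 : K 0.
  by apply: ball; rewrite (_ : dotp 0 0 = 0) ?sqr_ge0//; apply/eqP; rewrite dotp_eq0.
have rowE i : row i (\matrix_i X i w) = X i w by apply/rowP => j; rewrite !mxE.
have baseE : centered_base shrinkage (fun i => X i w) = (C / (1 + C)) *: (- b).
  rewrite /centered_base frameE scalerN /b scalerA sE; congr (- (_ *: _)).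
    by field; rewrite C1 !gt_eqF.
  by apply: eq_bigr => i _; exact: rowE.
apply/random_simplex_subset => // i; case: (unliftP ord0 i) => [j|] ->.
  rewrite simplex_vertexS baseE frameE addrC.
  have -> : row j (shrinkage *: \matrix_i X i w) = shrinkage *: X j w by apply/rowP => k; rewrite !mxE.
  have := convex_setE convK (KX j) Kb (t := C / (1 + C)).
  rewrite divr_ge0 ?(ltW C0) ?addr_ge0 ?(ltW C0)//= ler_pdivrMr ?addr_gt0// mul1r lerDr ler01 => /(_ isT).
  by rewrite (_ : 1 - C / (1 + C) = shrinkage)// sE; field.
rewrite simplex_vertex0 baseE.
have := convex_setE convK K0 Kb (t := C / (1 + C)).
rewrite divr_ge0 ?(ltW C0) ?addr_ge0 ?(ltW C0)//= ler_pdivrMr ?addr_gt0// mul1r lerDr ler01 => /(_ isT).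
by rewrite scaler0 add0r.
Qed.

(** The volume is at least s^n |det| n^(-n) with s = [shrinkage]; the factor sqrt(n!) >= n^(n/2) /
    2^n in the bound on |det| cancels half of the power n^(-n). *)
Lemma simplex_volume w :
  determinant_ratio ^+ n * L ^+ n * Num.sqrt (n`!)%:R < `|\det (\matrix_i X i w)| ->
  ((volume_ratio ^+ n * L ^+ n / (n%:R `^ (n%:R / 2)))%:E <=
    lebesgue_rV R n (random_simplex shrinkage (fun i => X i w)))%E.
Proof.
move=> detX; have s0 := @shrinkage_gt0 R; have r0 := @determinant_ratio_gt0 R.
have det0 : \det (\matrix_i X i w) != 0.
  rewrite -normr_gt0; apply: le_lt_trans detX.
  by rewrite !mulr_ge0 ?exprn_ge0 ?sqrtr_ge0 ?(ltW L0) ?(ltW r0).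
rewrite volume_random_simplex ?gt_eqF// /frame (negbTE det0).
apply: le_trans (lee_wpmul2l _ (volume_standard_simplex_ge n0)); last by rewrite lee_fin.
rewrite -EFinM lee_fin detZ normrM ger0_norm ?exprn_ge0 ?(ltW s0)//.
have nR : 0 < n%:R :> R by rewrite ltr0n.
apply: (@le_trans _ _ (shrinkage ^+ n * (determinant_ratio ^+ n * L ^+ n * Num.sqrt (n`!)%:R) * n%:R^-1 ^+ n)).
  rewrite powR_half_sqrt ler_pdivrMr ?sqrtr_gt0 ?exprn_gt0//.
  rewrite /volume_ratio !exprMn.
  have nn0 : 0 < n%:R ^+ n :> R by rewrite exprn_gt0.
  have h : Num.sqrt (n%:R ^+ n) <= 2 ^+ n * Num.sqrt (n`!)%:R :> R.
    have -> : 2 ^+ n = Num.sqrt (4 ^+ n) :> R.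
      have -> : 4 ^+ n = (2 ^+ n) ^+ 2 :> R.
        have -> : 4 = 2 ^+ 2 :> R by ring.
        by rewrite exprAC.
      by rewrite sqrtr_sqr ger0_norm// exprn_ge0.
    by rewrite -sqrtrM ?exprn_ge0// ler_wsqrtr// factorial_lower_bound.
  have {}h : 1 <= 2 ^+ n * Num.sqrt (n`!)%:R * (n%:R^-1 ^+ n) * Num.sqrt (n%:R ^+ n) :> R.
    rewrite exprVn mulrAC ler_pdivlMr// mul1r -{1}(sqr_sqrtr (ltW nn0)) expr2.
    by rewrite ler_wpM2r// sqrtr_ge0.
  have P0 : 0 <= shrinkage ^+ n * determinant_ratio ^+ n * 2^-1 ^+ n * L ^+ n.
    by rewrite ltW// !mulr_gt0 ?exprn_gt0.
  have := ler_wpM2l P0 h; rewrite mulr1 => /le_trans; apply.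
  rewrite le_eqVlt; apply/orP; left; apply/eqP.
  move: (@shrinkage R) (@determinant_ratio R) => a b; rewrite !exprVn; field.
  by rewrite (gt_eqF nn0) expf_neq0.
apply: ler_wpM2r; first by rewrite exprn_ge0// invr_ge0.
by rewrite ler_wpM2l ?exprn_ge0 ?(ltW s0)// ltW.
Qed.
End good_event.

(** * Probability of the good event *)

Section probability_of_good_event.
Context d (Omega : measurableType d) (R : realType) (P : probability Omega R).
Context (n : nat) (X : 'I_n -> {RV P >-> 'rV[R]_n}) (K : set 'rV[R]_n) (L : R).
Hypothesis n0 : (0 < n)%N.
Hypothesis isoK : isotropic K L.
Hypothesis unifX : forall i, uniform_on K (X i).
Hypothesis indX : independent_RVs X.

(** The complement of [E] is covered by the two exceptional events, small determinant and large sum,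
    and a null event. *)
Lemma random_simplex_probability (E : set Omega) : measurable E ->
  (forall w, [/\ centered_simplex (random_simplex shrinkage (fun i => X i w)),
    random_simplex shrinkage (fun i => X i w) `<=` K &
    ((volume_ratio ^+ n * L ^+ n / (n%:R `^ (n%:R / 2)))%:E <=
      lebesgue_rV R n (random_simplex shrinkage (fun i => X i w)))%E] -> E w) ->
  ((1 - expR (- n%:R))%:E < P E)%E.
Proof.
move=> mE goodE; have [[cK convK _] vK _ L0 _] := isoK.
have mK : measurable K by exact: compact_measurable_rV.
have s0 : shrinkage != 0 :> R by rewrite gt_eqF// shrinkage_gt0.
pose tau : R := determinant_ratio ^+ n * L ^+ n * Num.sqrt (n`!)%:R.
pose A := [set w | `|\det (\matrix_i X i w)| <= tau].
pose B := [set w | (sum_ratio * n%:R * L) ^+ 2 <= dotp (\sum_i X i w) (\sum_i X i w)].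
(* The vectors lie in [K] only almost surely; this null event collects the exceptions. *)
pose C := \big[setU/set0]_(i < n) (X i @^-1` (~` K)).
have mX i D : measurable D -> measurable (X i @^-1` D).
  by move=> mD; rewrite -[X in measurable X]setTI; exact: (measurable_funPT (X i)).
have mA : measurable A.
  apply: measurable_ler_set => //; apply: measurableT_comp => //.
  apply: measurable_det => i j; under eq_fun do rewrite mxE.
  by apply: (measurableT_comp (measurable_coord_rV j)).
have mB : measurable B by apply: measurable_ler_set => //; exact: measurable_norm_sum.
have [mC PC] : measurable C /\ P C = 0%E.
  rewrite /C; elim/big_ind: _ => [|D1 D2 [m1 P1] [m2 P2]|i _].
  - by rewrite measure0.
  - split; first exact: measurableU.
    apply/eqP; rewrite eq_le measure_ge0 andbT.
    by apply: le_trans (measureU2 P m1 m2) _; rewrite -[leLHS]/(P D1 + P D2)%E P1 P2 adde0.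
  - split; first by apply: mX; exact: measurableC.
    have := distribution_uniformE isoK unifX i (measurableC mK).
    by rewrite setICl measure0.
have PA : (P A <= (4^-1 * expR (- n%:R))%:E)%E by exact: (determinant_tail n0 isoK unifX indX).
have PB : (P B <= (4^-1 * expR (- n%:R))%:E)%E.
  apply: norm_sum_tail => // i theta th1; apply: exponential_moment.
  exact: (uniform_isotropic_marginal isoK (distribution_uniformE isoK unifX i) th1).
have EC : ~` E `<=` (A `|` B) `|` C.
  move=> w Ew; apply: contrapT => /not_orP[/not_orP[Aw Bw] Cw]; apply: Ew; apply: goodE.
  have KX i : K (X i w).
    by apply: contrapT => nK; apply: Cw; rewrite /C (bigD1 i)//=; left.
  have detw : tau < `|\det (\matrix_i X i w)| by rewrite ltNge; exact/negP.
  split; first exact: centered_random_simplex.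
  - apply: (simplex_in_body n0 isoK unifX) => //.
      rewrite -normr_gt0; apply: le_lt_trans detw.
      by rewrite !mulr_ge0 ?exprn_ge0 ?sqrtr_ge0 ?(ltW L0) ?(ltW determinant_ratio_gt0).
    by rewrite ltNge; exact/negP.
  - exact: (simplex_volume n0 isoK).
have e0 := expR_gt0 (- n%:R : R).
have PEC : (P (~` E) < (expR (- n%:R))%:E)%E.
  (* Two quarters of e^(-n) make a half, which leaves room for the strict inequality. *)
  apply: le_lt_trans (_ : _ <= (4^-1 * expR (- n%:R) + 4^-1 * expR (- n%:R))%:E)%E _; last first.
    by rewrite lte_fin; lra.
  apply: le_trans (le_measure P _ _ EC) _; rewrite ?inE; first exact: measurableC.
    by apply: measurableU => //; exact: measurableU.
  apply: le_trans (measureU2 P _ _) _ => //; first exact: measurableU.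
  rewrite -[X in (_ + X)%E]/(P C) PC adde0; apply: le_trans (measureU2 P _ _) _ => //.
  by rewrite EFinD; exact: leeD.
rewrite -[E]setCK probability_setC; last exact: measurableC.
have fE : P (~` E) \is a fin_num by rewrite fin_num_measure//; exact: measurableC.
by move: PEC; rewrite -(fineK fE) -EFinB !lte_fin => PEC; rewrite ltrD2l ltrN2.
Qed.
End probability_of_good_event.

Unset Implicit Arguments.

Theorem theorem1p5 (R : realType) :
  exists c : R, 0 < c /\
  forall n : nat, (1 <= n)%N ->
  exists f : ('I_n -> 'rV[R]_n) -> set 'rV[R]_n,
    (forall x : 'I_n -> 'rV[R]_n, centered_simplex (f x)) /\
    forall (K : set 'rV[R]_n) (L : R), isotropic K L ->
    forall (d : measure_display) (Omega : measurableType d)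
      (P : probability Omega R) (X : 'I_n -> {RV P >-> 'rV[R]_n}),
      (forall i : 'I_n, uniform_on K (X i)) ->
      independent_RVs X ->
      let E := [set omega : Omega |
        let S := f (fun i : 'I_n => X i omega) in
        [/\ centered_simplex S, S `<=` K &
            ((c ^+ n * L ^+ n / (n%:R `^ (n%:R / 2)))%:E
              <= lebesgue_rV R n S)%E]] in
      measurable E /\ ((1 - expR (- n%:R))%:E < P E)%E.
Proof.
exists volume_ratio; split=> [|n n0]; first exact: volume_ratio_gt0.
have s0 : shrinkage != 0 :> R by rewrite gt_eqF// shrinkage_gt0.
exists (random_simplex shrinkage); split=> [x|].
  exact: centered_random_simplex.
move=> K L isoK d Omega P X unifX indX /=.
have [[cK convK _] _ _ _ _] := isoK.
have mE : measurable [set w | [/\ centered_simplex (random_simplex shrinkage (fun i => X i w)),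
    random_simplex shrinkage (fun i => X i w) `<=` K &
    ((volume_ratio ^+ n * L ^+ n / (n%:R `^ (n%:R / 2)))%:E <=
      lebesgue_rV R n (random_simplex shrinkage (fun i => X i w)))%E]].
  by apply: measurable_random_simplex_event => //; exact: compact_measurable_rV.
split; first exact: mE.
exact: (random_simplex_probability n0 isoK unifX indX mE).
Qed.
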